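(* Let $U\subset\mathbb{R}^2$ be a domain, $N^3$ a $3$-manifold, $f:U\to N^3$ a frontal and $L:U\to (T^*N^3)^\circ$ an admissible lift of $f$. Let $D$ be an arbitrary linear connection on $N^3$. Suppose that $\gamma(t)$ $(|t|<\varepsilon)$ is a singular curve on $U$ passing through a non-degenerate singular point $p=\gamma(0)$, and that $X:U\to TN^3$ is an arbitrarily fixed smooth vector field along $f$ such that (1) $L(X)$ vanishes on $U$, and (2) $X$ is transversal to the subspace $f_*(T_pU)$ at $p$ (i.e. $X_p\notin f_*(T_pU)$). Let $\eta(t)$ be a null vector field along $\gamma$ and set $$\tilde\psi(t):=L\bigl(D^f_{\eta(t)}X\bigr)\quad\text{at }\gamma(t).$$ Then the germ of $f$ at $p=\gamma(0)$ is $\mathcal{A}$-equivalent to a cuspidal cross cap if and only if (i) $\eta(0)$ is transversal to $\gamma'(0)$, and (ii) $\tilde\psi(0)=0$ and $\tilde\psi'(0)\neq0$, where $'=d/dt$.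
   Context: Frontal: a $C^\infty$-map $f:U\to N^3$ such that, for a Riemannian metric $g$ on $N^3$, there is a smooth unit vector field $\nu$ along $f$ perpendicular to $f_*(TU)$ (this does not depend on the choice of $g$). $(T^*N^3)^\circ$ is $T^*N^3$ minus the zero section, $\pi:(T^*N^3)^\circ\to N^3$ the projection. An admissible lift of $f$ is a smooth map $L:U\to(T^*N^3)^\circ$ with $\pi\circ L=f$ and $f_*(T_qU)\subset\mathrm{Ker}\,L_q$ for all $q\in U$. For a vector field $Y$ along $f$, $L(Y)$ is the function $q\mapsto L_q(Y_q)$. Singular points: points where $\mathrm{rank}\,df<2$. The signed area density function is $\lambda=\Omega(f_u,f_v,\nu)$, with $(u,v)$ local coordinates of $U$ and $\Omega$ a (local) Riemannian volume element; singular points are the zeros of $\lambda$. A singular point $p$ is non-degenerate if $d\lambda(p)\ne0$ (independent of the choices). Near such $p$ the singular set is a regular curve, parametrized by a regular curve $\gamma:(-\varepsilon,\varepsilon)\to U$ with $\gamma(0)=p$, called the singular curve; the kernel of $df$ is one-dimensional at each $\gamma(t)$. A null vector field along $\gamma$ is a smooth nowhere-vanishing field $\eta(t)\in T_{\gamma(t)}U$ spanning $\mathrm{Ker}\,df_{\gamma(t)}$. $D^f$ is the covariant derivative of vector fields along $f$ (pull-back connection) induced by $D$. $\mathcal{A}$-equivalence: two $C^\infty$-maps $f:(U,p)\to N^3$ and $f':(V,q)\to M^3$ are $\mathcal{A}$-equivalent if $f'=\Phi\circ f\circ\varphi^{-1}$ as germs for local diffeomorphisms $\varphi$ with $\varphi(p)=q$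 and $\Phi$ with $\Phi(f(p))=f'(q)$. ''$\mathcal{A}$-equivalent to a cuspidal cross cap'' means $\mathcal{A}$-equivalent to $(u,v)\mapsto(u,v^2,uv^3)\in\mathbb{R}^3$ at the origin. *)

(* Defs.v *)
From HB Require Import structures.
From mathcomp Require Import all_boot all_order all_algebra.
From mathcomp Require Import all_classical all_reals all_analysis.

Set Implicit Arguments.
Unset Strict Implicit.
Unset Printing Implicit Defensive.
Import Order.TTheory GRing.Theory Num.Theory.
Import numFieldNormedType.Exports.

Local Open Scope classical_set_scope.
Local Open Scope ring_scope.

(* [Ck k A f] is meant for open [A]; then only the germs of [f] at points of
   [A] matter, and quantifying over all directions [v] amounts to quantifying
   over partial derivatives when [V] is finite-dimensional. *)
Fixpoint Ck (R : realType) (V W : normedModType R) (k : nat) (A : set V)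
    (f : V -> W) : Prop :=
  match k with
  | 0%N => forall x, A x -> {for x, continuous f}
  | k'.+1 => (forall x, A x -> differentiable f x) /\
             (forall v : V, Ck k' A ('D_v f))
  end.

Definition smooth_on (R : realType) (V W : normedModType R) (A : set V)
    (f : V -> W) : Prop := forall k, Ck k A f.

Lemma smooth_on_id (R : realType) (V : normedModType R) (A : set V) :
  smooth_on A (@id V).
Proof.
have Cc k (W : normedModType R) (c : W) : Ck k A (fun _ : V => c).
  elim: k W c => [W c x _|k IH W c] /=; first exact: cst_continuous.
  split=> [x _|v]; first exact: differentiable_cst.
  by rewrite (_ : 'D_v _ = fun=> 0) //; apply/funext => x; rewrite derive_cst.
case=> [x _|k] /=; first exact: cvg_id.
split=> [x _|v]; first exact: ex_diff.
by rewrite (_ : 'D_v _ = fun=> v) //; apply/funext => x; rewrite derive_id.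
Qed.

(* Charts are pairs of total functions [cmap i], [cinv i], significant only on
   [cdom i] and on its image.  [chart_at x] is a preferred chart around [x];
   it serves to represent tangent vectors (see [tangent]). *)
Record manifold (R : realType) (n : nat) := Manifold {
  mcarrier :> topologicalType ;
  chart : Type ;
  cdom : chart -> set mcarrier ;
  cmap : chart -> mcarrier -> 'rV[R]_n ;
  cinv : chart -> 'rV[R]_n -> mcarrier ;
  chart_at : mcarrier -> chart ;
  chart_atP : forall x, cdom (chart_at x) x ;
  open_cdom : forall i, open (cdom i) ;
  open_cimg : forall i, open (cmap i @` cdom i) ;
  cmapK : forall i x, cdom i x -> cinv i (cmap i x) = x ;
  cmap_continuous : forall i x, cdom i x -> {for x, continuous (cmap i)} ;
  cinv_continuous : forall i z, (cmap i @` cdom i) z ->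
    {for z, continuous (cinv i)} ;
  transition_smooth : forall i j,
    smooth_on (cmap i @` (cdom i `&` cdom j)) (cmap j \o cinv i) ;
  manifold_hausdorff : hausdorff_space mcarrier ;
  manifold_second_countable : @second_countable mcarrier }.

Lemma rV_second_countable (R : realType) (n : nat) :
  @second_countable 'rV[R]_n.
Proof.
pose b (p : 'rV[rat]_n * nat) : set 'rV[R]_n :=
  ball (map_mx ratr p.1 : 'rV[R]_n) (p.2.+1%:R^-1 : R).
exists (range b); first by apply: (card_le_trans (card_image_le _ _)); exact: countableP.
split=> [_ [p _ <-]|x V /nbhs_ballP[e /= e0 xV]]; first exact: ball_open.
have [k _ ke] : exists2 k : nat, True & k.+1%:R^-1 < e / 2.
  have [//|k] := @ltr_add_invr R 0 (e / 2) _; first by rewrite divr_gt0.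
  by rewrite add0r => ?; exists k.
have r0 : 0 < k.+1%:R^-1 :> R by rewrite invr_gt0.
have /choice[c xc] (j : 'I_n) :
    exists c : rat, `|x ord0 j - ratr c| < k.+1%:R^-1.
  have /rat_in_itvoo[c] : x ord0 j < x ord0 j + k.+1%:R^-1 by rewrite ltrDl.
  rewrite in_itv /= => /andP[xc cx]; exists c.
  by rewrite distrC gtr0_norm ?subr_gt0// ltrBlDl.
have bx : ball (map_mx ratr (\row_j c j) : 'rV[R]_n) k.+1%:R^-1 x.
  split=> // i j; rewrite !mxE ord1 /ball /= distrC; exact: xc.
exists (b (\row_j c j, k)); first by split=> //; exists (\row_j c j, k).
apply: subset_trans xV => y cy.
rewrite [e]splitr; apply: (@ball_triangle _ _
  (map_mx ratr (\row_j c j) : 'rV[R]_n)).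
  by apply/ball_sym; apply: le_ball bx; exact: ltW.
by apply: le_ball cy; exact: ltW.
Qed.

Definition euclidean (R : realType) (n : nat) : manifold R n.
Proof.
refine (@Manifold R n 'rV[R]_n unit (fun=> setT) (fun=> id) (fun=> id)
  (fun=> tt) _ _ _ _ _ _ _ _ _) => //.
- by move=> _; exact: openT.
- by move=> _; rewrite image_id; exact: openT.
- by move=> _ x _; exact: cvg_id.
- by move=> _ x _; exact: cvg_id.
- by move=> _ _; exact: smooth_on_id.
- exact: rV_second_countable.
Defined.

Definition smooth_map (R : realType) (m n : nat) (M : manifold R m)
    (N : manifold R n) (A : set M) (f : M -> N) : Prop :=
  (forall x, A x -> {for x, continuous f}) /\
  (forall (i : chart M) (j : chart N),
     smooth_on (cmap i @` (A `&` cdom i `&` f @^-1` cdom j))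
       (cmap j \o f \o cinv i)).

(* [T_x N]: a tangent vector is given by its components in the chart
   [chart_at x]. *)
Definition tangent (R : realType) (n : nat) (N : manifold R n) (x : N) : Type :=
  'rV[R]_n.

HB.instance Definition _ (R : realType) (n : nat) (N : manifold R n) (x : N) :=
  NormedModule.copy (tangent x) 'rV[R]_n.

Definition cotangent (R : realType) (n : nat) (N : manifold R n) (x : N) : Type :=
  {linear tangent x -> R}.

Section Tangent.
Context (R : realType) (n : nat) (N : manifold R n).

(* Components of [v] in an arbitrary chart [i] around [x]. *)
Definition components (i : chart N) (x : N) (v : tangent x) : 'rV[R]_n :=
  'd (cmap i \o cinv (chart_at x)) (cmap (chart_at x) x) v.

(* The coordinate vector field d/dx_a of the chart [i]. *)
Definition coord_field (i : chart N) (a : 'I_n) (x : N) : tangent x :=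
  'd (cmap (chart_at x) \o cinv i) (cmap i x) (delta_mx 0 a).

Definition smooth_fun (W : set N) (h : N -> R) : Prop :=
  forall i, smooth_on (cmap i @` (W `&` cdom i)) (h \o cinv i).

Definition dfun (h : N -> R) (x : N) (v : tangent x) : R :=
  'd (h \o cinv (chart_at x)) (cmap (chart_at x) x) v.

Definition smooth_field (W : set N) (Y : forall x : N, tangent x) : Prop :=
  forall i, smooth_on (cmap i @` (W `&` cdom i))
    (fun z => components i (Y (cinv i z))).

End Tangent.

Record riemannian_metric (R : realType) (n : nat) (N : manifold R n) :=
  RiemannianMetric {
  metric :> forall x : N, tangent x -> tangent x -> R ;
  metric_linear : forall x (u : tangent x) c (v w : tangent x),
    metric u (c *: v + w) = c * metric u v + metric u w ;
  metric_sym : forall x (u v : tangent x), metric u v = metric v u ;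
  metric_pos : forall x (v : tangent x), v != 0 -> 0 < metric v v ;
  metric_smooth : forall (i : chart N) (a b : 'I_n),
    smooth_fun (cdom i)
      (fun x => metric (coord_field i a x) (coord_field i b x)) }.

(* A linear connection, as a covariant derivative [D_v Y] of a vector field [Y]
   smooth near [x] along a vector [v] tangent at [x].  Since [Y] is only
   required to be smooth on a neighbourhood [W] of [x], locality is an axiom. *)
Record connection (R : realType) (n : nat) (N : manifold R n) := Connection {
  cov :> forall x : N, tangent x -> (forall y : N, tangent y) -> tangent x ;
  cov_linear : forall (W : set N) x Y c (v w : tangent x),
    open W -> W x -> smooth_field W Y ->
    cov (c *: v + w) Y = c *: cov v Y + cov w Y ;
  cov_add : forall (W : set N) x (v : tangent x) Y Z,
    open W -> W x -> smooth_field W Y -> smooth_field W Z ->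
    cov v (fun y => Y y + Z y) = cov v Y + cov v Z ;
  cov_leibniz : forall (W : set N) x (v : tangent x) h Y,
    open W -> W x -> smooth_fun W h -> smooth_field W Y ->
    cov v (fun y => h y *: Y y) = dfun h v *: Y x + h x *: cov v Y ;
  cov_local : forall (W : set N) x (v : tangent x) Y Z,
    open W -> W x -> smooth_field W Y -> smooth_field W Z ->
    (forall y, W y -> Y y = Z y) -> cov v Y = cov v Z ;
  cov_smooth : forall (W : set N) (V Y : forall x : N, tangent x),
    open W -> smooth_field W V -> smooth_field W Y ->
    smooth_field W (fun x => cov (V x) Y) }.

Section Along.
Context (R : realType) (m n : nat) (N : manifold R n).
Implicit Types (U : set 'rV[R]_m) (f : 'rV[R]_m -> N).

(* [f_* w] *)
Definition tangent_map f (q w : 'rV[R]_m) : tangent (f q) :=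
  'd (cmap (chart_at (f q)) \o f) q w.

Definition rank_df f (q : 'rV[R]_m) : nat :=
  \rank ('J (cmap (chart_at (f q)) \o f) q).

Definition smooth_along U f (X : forall q, tangent (f q)) : Prop :=
  forall i, smooth_on (U `&` f @^-1` cdom i) (fun q => components i (X q)).

Definition smooth_coalong U f (L : forall q, cotangent (f q)) : Prop :=
  forall i a, smooth_on (U `&` f @^-1` cdom i)
    (fun q => L q (coord_field i a (f q)) : R).

(* [D^f_w X] at [q], where [w] is tangent to the source at [q]: writing
   [X = \sum_a X^a d/dx_a] in the chart around [f q], it is
   [\sum_a (dX^a(w) d/dx_a + X^a D_{f_* w} (d/dx_a))]. *)
Definition pullback_cov (D : connection N) f (X : forall q, tangent (f q))
    (q w : 'rV[R]_m) : tangent (f q) :=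
  let i := chart_at (f q) in
  let Xi := fun q' => components i (X q') in
  \sum_(a < n) (('d Xi q w) ord0 a *: coord_field i a (f q) +
                (Xi q) ord0 a *: D (f q) (tangent_map f q w) (coord_field i a)).

End Along.

Section Frontal.
Context (R : realType) (N : manifold R 3).
Implicit Types (U : set 'rV[R]_2) (f : 'rV[R]_2 -> N).

Definition unit_normal U f (g : riemannian_metric N)
    (nu : forall q, tangent (f q)) : Prop :=
  [/\ smooth_along U nu,
      forall q, U q -> g (f q) (nu q) (nu q) = 1 &
      forall q w, U q -> g (f q) (nu q) (tangent_map f q w) = 0].

Definition frontal U f : Prop :=
  smooth_map (M := euclidean R 2) U f /\
  exists (g : riemannian_metric N) (nu : forall q, tangent (f q)),
    unit_normal U g nu.

Definition admissible_lift U f (L : forall q, cotangent (f q)) : Prop :=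
  [/\ smooth_coalong U L,
      forall q, U q -> exists v : tangent (f q), L q v != 0 &
      forall q w, U q -> L q (tangent_map f q w) = 0].

Definition singular_point U f (q : 'rV[R]_2) : Prop :=
  U q /\ (rank_df f q < 2)%N.

(* The Riemannian volume element sqrt(det g_ab) dx_0 ^ dx_1 ^ dx_2 on the
   domain of the chart [i]. *)
Definition volume_form (g : riemannian_metric N) (i : chart N) (x : N)
    (v0 v1 v2 : tangent x) : R :=
  Num.sqrt (\det (\matrix_(a < 3, b < 3)
                    g x (coord_field i a x) (coord_field i b x))) *
  \det (\matrix_(a < 3) components i (nth v0 [:: v0; v1; v2] a)).

Definition area_density f (g : riemannian_metric N)
    (nu : forall q, tangent (f q)) (i : chart N) (q : 'rV[R]_2) : R :=
  volume_form g i (tangent_map f q (delta_mx 0 0))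
                  (tangent_map f q (delta_mx 0 1)) (nu q).

(* The condition does not depend on the choice of [g], [nu], [i]. *)
Definition nondegenerate_point U f (p : 'rV[R]_2) : Prop :=
  singular_point U f p /\
  exists (g : riemannian_metric N) (nu : forall q, tangent (f q))
         (i : chart N),
    [/\ unit_normal U g nu, cdom i (f p) &
        exists w, 'd (area_density g nu i) p w != 0].

Definition singular_curve U f (eps : R) (gamma : R -> 'rV[R]_2) : Prop :=
  [/\ smooth_on (`]- eps, eps[) gamma,
      forall t : R, t \in `]- eps, eps[ -> derive1 gamma t != 0,
      forall t : R, t \in `]- eps, eps[ -> singular_point U f (gamma t) &
      \forall q \near gamma 0, singular_point U f q ->
        exists2 t : R, t \in `]- eps, eps[ & gamma t = q].

Definition null_field f (eps : R) (gamma eta : R -> 'rV[R]_2) : Prop :=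
  smooth_on (`]- eps, eps[) eta /\
  forall t : R, t \in `]- eps, eps[ ->
    eta t != 0 /\
    (forall w, tangent_map f (gamma t) w = 0 <-> exists c, w = c *: eta t).

End Frontal.

(* [Phi] restricts to a diffeomorphism, with inverse [Psi], from a neighbourhood
   of [x] onto a neighbourhood of [y], and maps [x] to [y]. *)
Definition local_diffeo (R : realType) (n : nat) (M N : manifold R n)
    (Phi : M -> N) (Psi : N -> M) (x : M) (y : N) : Prop :=
  exists (A : set M) (B : set N),
    [/\ open A /\ open B, A x /\ Phi x = y,
        smooth_map A Phi /\ smooth_map B Psi,
        forall z, A z -> B (Phi z) /\ Psi (Phi z) = z &
        forall z, B z -> A (Psi z) /\ Phi (Psi z) = z].

Definition A_equivalent (R : realType) (m n : nat) (N M : manifold R n)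
    (f : 'rV[R]_m -> N) (p : 'rV[R]_m) (f' : 'rV[R]_m -> M) (q : 'rV[R]_m) :
    Prop :=
  exists (phi phi' : euclidean R m -> euclidean R m)
         (Phi : N -> M) (Phi' : M -> N),
    [/\ local_diffeo phi phi' p q, local_diffeo Phi Phi' (f p) (f' q) &
        \forall z \near q, f' z = Phi (f (phi' z))].

Definition cuspidal_cross_cap (R : realType) (z : 'rV[R]_2) : euclidean R 3 :=
  let u := z ord0 0 in
  let v := z ord0 1 in
  (\row_(a < 3) [:: u; v ^+ 2; u * v ^+ 3]`_a : 'rV[R]_3).

(* Main.v *)
Require Import Defs.
From HB Require Import structures.
From mathcomp Require Import all_boot all_order all_algebra.
From mathcomp Require Import all_classical all_reals all_analysis.
From mathcomp Require Import ring lra zify.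
Set Implicit Arguments.
Unset Strict Implicit.
Unset Printing Implicit Defensive.
Import Order.TTheory GRing.Theory Num.Theory.
Import numFieldNormedType.Exports.
Local Open Scope classical_set_scope.
Local Open Scope ring_scope.

(** Read in a chart of the target, [f] is a map [F] from the plane to [R^3], the lift is a row
    [l] of functions with [l (dF w) = 0], and [X] is a vector valued function with [l X = 0].
    Along a null direction [dF w = 0], so the Christoffel terms of the covariant derivative
    vanish and [psi] is [l (dX eta)] ([lift_pullback_cov]).

    Suppose that, in suitable coordinates of the source and of the target, the map is a
    normal form [H = (u, v ^ 2, v ^ 3 Q(u, v ^ 2))]. The relation [l (dH w) = 0] shows that
    [l] is proportional to [(- v ^ 3 Q_u, - 3/2 v Q - v ^ 3 Q_w, 1)]. The singular curve lies
    on the axis [v = 0], the null direction there is [d/dv], and differentiating [l X = 0]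
    gives [l (dX/dv) = - (dl/dv) X = 3/2 X_2 Q(u, 0)], up to the nonvanishing third component
    of [l] ([null_derivative_axis]). Transversality of [X] says that [X_2] does not vanish.
    Hence [psi(t) = m(t) Q(s(t), 0)] where [m] does not vanish and [s] is a parameter of the
    singular curve, so that [psi] has a simple zero at [0] if and only if [Q(0) = 0] and
    [Q_u(0) <> 0]; moreover the null direction is then automatically transversal to the
    singular curve ([normal_form_criterion]). The cuspidal cross cap is the normal form with
    [Q = u], and a map equivalent to it has this normal form in some coordinates. This gives
    one implication.

    Conversely, if [eta] is transversal to the singular curve, then [(u, v)] given by
    [gamma(u) + v eta(u)] are coordinates in which [F_v = v K]. The area density is [v] times
    a continuous function, and non-degeneracy says that [F_u], [K] and the normal vector are
    independent at the base point ([null_coordinates]). Straightening [F(u, 0)] to an axis and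
    taking the square root of the second component as a new coordinate brings [F] to the form
    [(u, v ^ 2, h)] with [h_v = 0] on the axis. By Whitney's theorem on even functions,
    [h = E(u, v ^ 2) + v ^ 3 Q(u, v ^ 2)] ([fold_normal_form]), and a shear of the target
    removes [E] ([fold_form]). The map is then in normal form, so [Q(0) = 0] and
    [Q_u(0) <> 0] by the first part, and taking [Q] as a new coordinate in the source and in
    the target yields the cuspidal cross cap ([normal_map_cross_cap]).

    The analytic tools are built on the way: a calculus of smooth maps, the inverse function
    theorem ([inverse_function]), Hadamard's lemma ([hadamard]), Borel's lemma with a
    parameter ([borel]) and Whitney's theorem ([whitney_even]). Whitney's theorem follows from
    Borel's lemma: subtracting a smooth function of [(u, v ^ 2)] with the same jet along the
    axis reduces it to even functions that are flat on the axis. *)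

(** * Differentiability by first-order estimates *)

Section FirstOrder.
Context {R : realType} {V W : normedModType R}.
Implicit Types (f g : V -> W) (x : V).

(** Error estimates with explicit bounds can be passed to limits of series and of integrals. *)
Lemma differentiable_estimate f x (df : {linear V -> W}) : continuous df ->
  (forall e : R, 0 < e ->
     \forall h \near (0 : V), `|f (h + x) - f x - df h| <= e * `|h|) ->
  differentiable f x /\ 'd f x = df :> (V -> W).
Proof.
move=> cdf fe.
have E : f \o shift x = cst (f x) + df +o_ 0 id.
  apply/eqaddoP => e e0; apply: filterS (fe e e0) => h /=.
  by rewrite !fctE opprD addrA.
have D := diff_unique cdf E; split=> //.
by apply/diff_locallyP; rewrite D; split.
Qed.

Lemma estimate_of_differentiable f x : differentiable f x ->
  forall e : R, 0 < e ->
    \forall h \near (0 : V), `|f (h + x) - f x - 'd f x h| <= e * `|h|.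
Proof.
move=> /diff_locallyP[_ /eqaddoP fo] e e0.
by apply: filterS (fo e e0) => h /=; rewrite !fctE /= opprD addrA.
Qed.

Lemma differentiable_near_eq f g x : (\forall y \near x, f y = g y) ->
  differentiable f x -> differentiable g x.
Proof.
move=> fg df.
suff [] : differentiable g x /\ 'd g x = 'd f x :> (V -> W) by [].
apply: differentiable_estimate; first exact: diff_continuous.
move=> e e0; have fgx := nbhs_singleton fg.
have fg' : \forall h \near (0 : V), f (h + x) = g (h + x).
  by move: fg; rewrite (near_shift 0 x) /=; apply: filterS => y; rewrite subr0.
near do rewrite -fgx -(near fg' _)//.
exact: estimate_of_differentiable.
Unshelve. all: by end_near. Qed.

End FirstOrder.

(** * Calculus of functions of class C^k *)

Section CkBasics.
Context {R : realType} {V W : normedModType R}.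
Implicit Types (f g : V -> W) (A B : set V).

Lemma Ck_continuous k A f x : Ck k A f -> A x -> {for x, continuous f}.
Proof. by case: k => [|k] /=; [apply | case=> df _ Ax; apply/differentiable_continuous/df]. Qed.

Lemma Ck_derive k A f v : Ck k.+1 A f -> Ck k A ('D_v f).
Proof. by case=> _; apply. Qed.

Lemma CkS k A f : Ck k.+1 A f -> Ck k A f.
Proof.
elim: k f => [|k IH] f [df Df]; first by move=> x /df/differentiable_continuous.
by split=> // v; apply: IH.
Qed.

Lemma Ck_subset k A B f : B `<=` A -> Ck k A f -> Ck k B f.
Proof.
move=> BA; elim: k f => [|k IH] f /=; first by move=> + x /BA; apply.
by case=> df Df; split=> [x /BA/df|v]//; apply: IH.
Qed.

Lemma Ck_ext k A f g : open A -> (forall x, A x -> f x = g x) ->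
  Ck k A f -> Ck k A g.
Proof.
move=> oA; have nA x : A x -> \forall y \near x, A y by move=> Ax; apply: open_nbhs_nbhs.
elim: k f g => [|k IH] f g fg /= Cf.
  move=> x Ax; have fgx : {near x, f =1 g} by near=> y; apply: fg; near: y; exact: nA.
  have C : f y @[y --> x] --> f x := Cf x Ax.
  rewrite (fg x Ax) in C; apply: cvg_trans C; exact: near_eq_cvg.
have fgx x : A x -> {near x, f =1 g}.
  by move=> Ax; near=> y; apply: fg; near: y; exact: nA.
split=> [x Ax|v]; first exact: (differentiable_near_eq (fgx x Ax) (Cf.1 x Ax)).
by apply: IH (Cf.2 v) => x Ax; apply: near_eq_derive; exact: fgx.
Unshelve. all: by end_near. Qed.

Lemma Ck_cst k A (c : W) : Ck k A (fun=> c).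
Proof.
elim: k c => [c x _|k IH c] /=; first exact: cst_continuous.
split=> [x _|v]; first exact: differentiable_cst.
by rewrite (_ : 'D_v _ = fun=> 0) //; apply/funext => x; rewrite derive_cst.
Qed.

Lemma CkD k A f g : open A -> Ck k A f -> Ck k A g -> Ck k A (fun x => f x + g x).
Proof.
move=> oA; elim: k f g => [|k IH] f g /=.
  by move=> cf cg x Ax; apply: continuousD; [apply: cf|apply: cg].
move=> [df Df] [dg Dg]; split=> [x Ax|v]; first by apply: differentiableD; auto.
apply: Ck_ext oA _ (IH _ _ (Df v) (Dg v)) => x Ax.
by rewrite deriveD//; apply: diff_derivable; auto.
Qed.

Lemma smooth_on_continuous A f x : smooth_on A f -> A x -> {for x, continuous f}.
Proof. by move=> sf; apply: Ck_continuous (sf 0%N). Qed.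

Lemma smooth_on_differentiable A f x : smooth_on A f -> A x -> differentiable f x.
Proof. by move=> sf; have [+ _] := sf 1%N; apply. Qed.

Lemma smooth_on_derive A f v : smooth_on A f -> smooth_on A ('D_v f).
Proof. by move=> sf k; have [_ +] := sf k.+1; apply. Qed.

Lemma smooth_on_subset A B f : B `<=` A -> smooth_on A f -> smooth_on B f.
Proof. by move=> BA sf k; apply: Ck_subset BA (sf k). Qed.

Lemma smooth_on_ext A f g : open A -> (forall x, A x -> f x = g x) ->
  smooth_on A f -> smooth_on A g.
Proof. by move=> oA fg sf k; apply: Ck_ext oA fg (sf k). Qed.

End CkBasics.

Lemma Ck_linear (R : realType) (V W : normedModType R) k (A : set V) (f : {linear V -> W}) :
  continuous f -> Ck k A f.
Proof.
move=> cf; case: k => [|k] /=; first by move=> x _; apply: cf.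
split=> [x _|v]; first exact: linear_differentiable.
rewrite (_ : 'D_v _ = fun=> f v); first exact: Ck_cst.
apply/funext => x; rewrite deriveE ?diff_lin//; exact: linear_differentiable.
Qed.

Section RealValued.
Context {R : realType} {V : normedModType R}.
Implicit Types (f g : V -> R) (A : set V).

Lemma CkM k A f g : open A -> Ck k A f -> Ck k A g -> Ck k A (fun x => f x * g x).
Proof.
move=> oA; elim: k f g => [|k IH] f g.
  by move=> cf cg x Ax; apply: continuousM; [apply: cf|apply: cg].
move=> Cf Cg; have [df Df] := Cf; have [dg Dg] := Cg.
split=> [x Ax|v]; first by apply: differentiableM; auto.
apply: Ck_ext oA _ (CkD oA (IH _ _ (CkS Cf) (Dg v)) (IH _ _ (CkS Cg) (Df v))) => x Ax.
by rewrite deriveM//; apply: diff_derivable; auto.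
Qed.

Lemma smooth_onM A f g : open A -> smooth_on A f -> smooth_on A g ->
  smooth_on A (fun x => f x * g x).
Proof. by move=> oA sf sg k; apply: CkM. Qed.

Lemma smooth_onX A f k : open A -> smooth_on A f -> smooth_on A (fun x => f x ^+ k).
Proof.
move=> oA sf; elim: k => [|k IH]; first by move=> m; exact: Ck_cst.
by apply: smooth_on_ext (smooth_onM oA sf IH) => // x _; rewrite exprS.
Qed.

Lemma Ck_sum k A (I : Type) (r : seq I) (P : pred I) (F : I -> V -> R) : open A ->
  (forall i, P i -> Ck k A (F i)) -> Ck k A (fun x => \sum_(i <- r | P i) F i x).
Proof.
move=> oA CF; elim: r => [|i r IH].
  by apply: Ck_ext oA _ (Ck_cst k A 0) => x _; rewrite big_nil.
apply: (@Ck_ext _ _ _ _ _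
  (fun x => (if P i then F i x else 0) + \sum_(i <- r | P i) F i x)) => //.
  by move=> x _; rewrite big_cons; case: (P i); rewrite ?add0r.
apply: CkD => //; case Pi : (P i); [exact: CF | exact: Ck_cst].
Qed.

Lemma smooth_on_sum A (I : Type) (r : seq I) (P : pred I) (F : I -> V -> R) : open A ->
  (forall i, P i -> smooth_on A (F i)) ->
  smooth_on A (fun x => \sum_(i <- r | P i) F i x).
Proof. by move=> oA sF k; apply: Ck_sum => // i Pi; apply: sF. Qed.

Lemma smooth_on_prod A (I : Type) (r : seq I) (P : pred I) (F : I -> V -> R) : open A ->
  (forall i, P i -> smooth_on A (F i)) ->
  smooth_on A (fun x => \prod_(i <- r | P i) F i x).
Proof.
move=> oA CF; elim: r => [|i r IH].
  have sc : smooth_on A (fun=> 1 : R) by move=> k; apply: Ck_cst.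
  by apply: smooth_on_ext sc => // x _; rewrite big_nil.
apply: (@smooth_on_ext _ _ _ _
  (fun x => (if P i then F i x else 1) * \prod_(i <- r | P i) F i x)) => //.
  by move=> x _; rewrite big_cons; case: (P i); rewrite ?mul1r.
apply: smooth_onM => //; case Pi : (P i); first exact: CF.
by move=> k; apply: Ck_cst.
Qed.

End RealValued.

Section Smooth.
Context {R : realType} {V W : normedModType R}.
Implicit Types (f g : V -> W) (A : set V).

Lemma smooth_on_cst A (c : W) : smooth_on A (fun=> c).
Proof. by move=> k; apply: Ck_cst. Qed.

Lemma smooth_onD A f g : open A -> smooth_on A f -> smooth_on A g ->
  smooth_on A (fun x => f x + g x).
Proof. by move=> oA sf sg k; apply: CkD. Qed.

Lemma CkZ k A f (c : R) : open A -> Ck k A f -> Ck k A (fun x => c *: f x).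
Proof.
move=> oA; elim: k f => [|k IH] f /=.
  by move=> cf x Ax; apply: continuousZl_tmp; apply: cf.
move=> [df Df]; split=> [x Ax|v]; first by apply: differentiableZ; auto.
apply: Ck_ext oA _ (IH _ (Df v)) => x Ax.
by rewrite deriveZ//; apply: diff_derivable; auto.
Qed.

Lemma smooth_onZ A f (c : R) : open A -> smooth_on A f -> smooth_on A (fun x => c *: f x).
Proof. by move=> oA sf k; apply: CkZ. Qed.

Lemma smooth_onN A f : open A -> smooth_on A f -> smooth_on A (fun x => - f x).
Proof.
move=> oA sf; apply: smooth_on_ext oA _ (smooth_onZ (-1) oA sf) => x _.
by rewrite scaleN1r.
Qed.

Lemma smooth_onB A f g : open A -> smooth_on A f -> smooth_on A g ->
  smooth_on A (fun x => f x - g x).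
Proof. by move=> oA sf sg; apply: smooth_onD => //; apply: smooth_onN. Qed.

End Smooth.

Section Coordinates.
Context {R : realType} {V : normedModType R} {n : nat}.
Implicit Types (f : V -> 'rV[R]_n) (A : set V).

Definition coord (j : 'I_n) (z : 'rV[R]_n) : R := z ord0 j.

Lemma coord_is_linear j : linear (coord j).
Proof. by move=> a x y; rewrite /coord !mxE. Qed.

HB.instance Definition _ j :=
  GRing.isLinear.Build R 'rV[R]_n R _ (coord j) (coord_is_linear j).

Lemma coord_continuous' j : continuous (coord j).
Proof. exact: coord_continuous. Qed.

Lemma row_sumE (z : 'rV[R]_n) : z = \sum_j z ord0 j *: delta_mx 0 j.
Proof. exact: row_sum_delta. Qed.

Lemma differentiable_coordinates f x :
  differentiable f x <-> forall j, differentiable (fun y => f y ord0 j) x.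
Proof.
split=> [df j|df].
  have dc : differentiable (coord j) (f x).
    by apply: linear_differentiable; exact: coord_continuous'.
  exact: (differentiable_comp df dc).
have -> : f = \sum_(j < n) (fun y => f y ord0 j *: delta_mx 0 j).
  by apply/funext => y; rewrite fct_sumE {1}[f y]row_sumE.
by apply: differentiable_sum => j; apply: differentiableZl.
Qed.

Lemma derive_coordinates f x v j : differentiable f x ->
  'D_v (fun y => f y ord0 j) x = 'D_v f x ord0 j.
Proof.
move=> df; have dc : differentiable (coord j) (f x).
  by apply: linear_differentiable; exact: coord_continuous'.
rewrite !deriveE//; last exact: (differentiable_comp df dc).
rewrite [X in X v](diff_comp df dc) /= diff_lin//; exact: coord_continuous'.
Qed.

(** Both directions go by induction on [k], since directional derivatives are taken
    coordinatewise. *)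
Lemma Ck_coordinates k A f : open A ->
  Ck k A f <-> forall j, Ck k A (fun y => f y ord0 j).
Proof.
move=> oA; split.
  elim: k f => [f cf j x Ax|k IH f [df Df] j].
    by apply: (@continuous_comp _ _ _ f (coord j)); [apply: cf|apply: coord_continuous'].
  split=> [x Ax|v]; first by move: j; apply/differentiable_coordinates/df.
  apply: Ck_ext oA _ (IH _ (Df v) j) => x Ax.
  by rewrite derive_coordinates//; apply: df.
elim: k f => [f cf x Ax|k IH f Cf].
  have -> : f = \sum_(j < n) (fun y => f y ord0 j *: delta_mx 0 j).
    by apply/funext => y; rewrite fct_sumE {1}[f y]row_sumE.
  apply: (big_ind (fun g : V -> 'rV[R]_n => {for x, continuous g})).
  - exact: cst_continuous.
  - by move=> g h cg ch; apply: continuousD.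
  - by move=> j _; apply: continuousZr_tmp; apply: cf.
have df x : A x -> differentiable f x.
  by move=> Ax; apply/differentiable_coordinates => j; have [+ _] := Cf j; apply.
split=> // v; apply: IH => j; have [_ Dj] := Cf j.
by apply: Ck_ext oA _ (Dj v) => x Ax; rewrite derive_coordinates//; apply: df.
Qed.

Lemma smooth_on_coordinates A f : open A ->
  smooth_on A f <-> forall j, smooth_on A (fun y => f y ord0 j).
Proof.
move=> oA; split=> [sf j k|sf k]; first by move: j; apply/Ck_coordinates.
by apply/Ck_coordinates => // j; apply: sf.
Qed.

End Coordinates.

Lemma smooth_on_coord (R : realType) n (A : set 'rV[R]_n) j :
  smooth_on A (fun z : 'rV[R]_n => z ord0 j).
Proof. by move=> k; apply: (@Ck_linear _ _ _ k A (coord j)); exact: coord_continuous'. Qed.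

(** * Partial derivatives and the chain rule *)

Section Partials.
Context {R : realType} {n : nat} {W : normedModType R}.
Implicit Types (g : 'rV[R]_n -> W) (A : set 'rV[R]_n).

Definition pderive (j : 'I_n) g : 'rV[R]_n -> W := 'D_(delta_mx 0 j) g.

Lemma derive_partials g x v : differentiable g x ->
  'D_v g x = \sum_j v ord0 j *: pderive j g x.
Proof.
move=> dg; rewrite deriveE// {1}[v]row_sumE linear_sum; apply: eq_bigr => j _.
by rewrite linearZ /pderive deriveE.
Qed.

Lemma pderive_smooth A g j : smooth_on A g -> smooth_on A (pderive j g).
Proof. exact: smooth_on_derive. Qed.

Lemma pderive_ext A g h j : open A -> (forall z, A z -> g z = h z) ->
  forall z, A z -> pderive j g z = pderive j h z.
Proof.
move=> oA gh z Az; apply: near_eq_derive; near=> y; apply: gh; near: y.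
exact: open_nbhs_nbhs.
Unshelve. all: by end_near. Qed.

End Partials.

Section Chain.
Context {R : realType} {V : normedModType R} {n : nat}.
Implicit Types (f : V -> 'rV[R]_n) (g : 'rV[R]_n -> R).

Lemma derive_chain f (W : normedModType R) (g : 'rV[R]_n -> W) x v :
  differentiable f x -> differentiable g (f x) ->
  'D_v (g \o f) x = \sum_j 'D_v f x ord0 j *: pderive j g (f x).
Proof.
move=> df dg; rewrite deriveE; last exact: differentiable_comp.
by rewrite [X in X v](diff_comp df dg) /= -derive_partials// !deriveE.
Qed.

Lemma Ck_comp_real k (A : set V) (B : set 'rV[R]_n) f g : open A ->
  (forall x, A x -> B (f x)) -> Ck k A f -> Ck k B g -> Ck k A (g \o f).
Proof.
move=> oA AB; elim: k f g AB => [|k IH] f g AB.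
  by move=> cf cg x Ax; apply: continuous_comp; [apply: cf|apply: cg; apply: AB].
move=> Cf Cg; have [df Df] := Cf; have [dg Dg] := Cg.
split=> [x Ax|v]; first by apply: differentiable_comp; auto.
apply: (@Ck_ext _ _ _ _ _
  (fun x => \sum_(j < n) 'D_v f x ord0 j * (pderive j g \o f) x)) => //.
  by move=> x Ax; rewrite derive_chain//; auto.
apply: Ck_sum => // j _; apply: CkM => //; first exact: (iffLR (Ck_coordinates k _ oA) (Ck_derive v Cf) j).
by apply: IH => //; [exact: CkS Cf|exact: Ck_derive Cg].
Qed.

End Chain.

Lemma smooth_on_comp (R : realType) (V : normedModType R) m n (A : set V)
    (B : set 'rV[R]_m) (f : V -> 'rV[R]_m) (g : 'rV[R]_m -> 'rV[R]_n) : open A -> open B ->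
  (forall x, A x -> B (f x)) -> smooth_on A f -> smooth_on B g -> smooth_on A (g \o f).
Proof.
move=> oA oB AB sf sg; apply/smooth_on_coordinates => // j k.
apply: (@Ck_comp_real _ _ _ k A B f (fun z => g z ord0 j)) => //.
by move: j; apply/Ck_coordinates.
Qed.

Lemma smooth_on_comp_real (R : realType) (V : normedModType R) m (A : set V)
    (B : set 'rV[R]_m) (f : V -> 'rV[R]_m) (g : 'rV[R]_m -> R) : open A ->
  (forall x, A x -> B (f x)) -> smooth_on A f -> smooth_on B g -> smooth_on A (g \o f).
Proof. by move=> oA AB sf sg k; apply: Ck_comp_real AB (sf k) (sg k). Qed.

(** Directional derivatives are combinations of the partial ones, with constant coefficients. *)
Lemma Ck_partials (R : realType) n (W : normedModType R) k (A : set 'rV[R]_n)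
    (f : 'rV[R]_n -> W) : open A ->
  (forall x, A x -> differentiable f x) -> (forall j, Ck k A (pderive j f)) ->
  Ck k.+1 A f.
Proof.
move=> oA df Df; split=> // v.
apply: (@Ck_ext _ _ _ _ _ (fun x => \sum_j v ord0 j *: pderive j f x)) => //.
  by move=> x Ax; rewrite derive_partials//; auto.
have : forall r : seq 'I_n, Ck k A (fun x => \sum_(j <- r) v ord0 j *: pderive j f x).
  elim=> [|j r IH].
    by apply: Ck_ext oA _ (Ck_cst k A 0) => x _; rewrite big_nil.
  apply: (@Ck_ext _ _ _ _ _ (fun x => v ord0 j *: pderive j f x +
     \sum_(i <- r) v ord0 i *: pderive i f x)) => //.
    by move=> x _; rewrite big_cons.
  by apply: CkD => //; apply: CkZ.
exact.
Qed.

(** A class of functions stable under partial derivatives, up to equality on the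
    open set [A], consists of smooth functions; this is how functions defined by
    integrals and series are shown to be smooth. *)
Lemma smooth_coind (R : realType) n (W : normedModType R) (A : set 'rV[R]_n)
    (P : ('rV[R]_n -> W) -> Prop) : open A ->
  (forall f, P f -> forall x, A x -> differentiable f x) ->
  (forall f j, P f -> exists2 g, P g & forall x, A x -> pderive j f x = g x) ->
  forall f, P f -> smooth_on A f.
Proof.
move=> oA dP DP f Pf k; elim: k f Pf => [|k IH] f Pf.
  by move=> x Ax; apply: differentiable_continuous; apply: dP Ax.
apply: Ck_partials => // [|j]; first exact: dP.
have [g Pg fg] := DP f j Pf.
by apply: Ck_ext oA _ (IH g Pg) => x Ax; rewrite fg.
Qed.

(** * Functions of one real variable *)

Section OneVariable.
Context {R : realType}.
Implicit Types (A : set R).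

Lemma derive_derive1 (W : normedModType R) (f : R -> W) x v : differentiable f x ->
  'D_v f x = v *: derive1 f x.
Proof.
move=> df; rewrite deriveE// derive1E' // -{1}[v]mulr1.
by rewrite -[v * 1]/(v *: (1 : R)) linearZ.
Qed.

Lemma linear_real (l : {linear R -> R}) (a : R) : l a = a * l 1.
Proof. by rewrite -{1}[a]mulr1 -[a * 1]/(a *: (1 : R)) linearZ. Qed.

Lemma smooth_coind1 (W : normedModType R) A (P : (R -> W) -> Prop) : open A ->
  (forall f, P f -> forall x, A x -> derivable f x 1) ->
  (forall f, P f -> exists2 g, P g & forall x, A x -> derive1 f x = g x) ->
  forall f, P f -> smooth_on A f.
Proof.
move=> oA dP DP f Pf k; elim: k f Pf => [|k IH] f Pf.
  by move=> x Ax; apply/differentiable_continuous/derivable1_diffP; apply: dP Ax.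
have df x : A x -> differentiable f x by move=> Ax; apply/derivable1_diffP; apply: dP Ax.
split=> // v; have [g Pg fg] := DP f Pf.
apply: Ck_ext oA _ (CkZ v oA (IH g Pg)) => x Ax.
by rewrite -fg// derive_derive1//; apply: df.
Qed.

Lemma Ck_comp1 (V : normedModType R) k (A : set V) (B : set R) (f : V -> R)
    (g : R -> R) : open A -> open B ->
  (forall x, A x -> B (f x)) -> Ck k A f -> Ck k B g -> Ck k A (g \o f).
Proof.
move=> oA oB AB; elim: k f g AB => [|k IH] f g AB.
  by move=> cf cg x Ax; apply: continuous_comp; [apply: cf|apply: cg; apply: AB].
move=> Cf Cg; have [df Df] := Cf; have [dg Dg] := Cg.
have dgf x : A x -> differentiable (g \o f) x.
  by move=> Ax; apply: differentiable_comp; [exact: df|apply: dg; apply: AB].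
split=> // v.
apply: (@Ck_ext _ _ _ _ _ (fun x => 'D_v f x * ('D_1 g \o f) x)) => //.
  move=> x Ax; have dgx := dg _ (AB _ Ax); rewrite (deriveE _ (dgf _ Ax)).
  have -> : 'd (g \o f) x v = 'd g (f x) ('d f x v) by rewrite (diff_comp (df _ Ax) dgx).
  rewrite (deriveE _ (df _ Ax)) /= (deriveE _ dgx).
  exact/esym/linear_real.
apply: CkM => //; first exact: Ck_derive Cf.
by apply: IH => //; [exact: CkS Cf|exact: Ck_derive Cg].
Qed.

Lemma smooth_on_comp1 (V : normedModType R) (A : set V) (B : set R) (f : V -> R)
    (g : R -> R) : open A -> open B ->
  (forall x, A x -> B (f x)) -> smooth_on A f -> smooth_on B g -> smooth_on A (g \o f).
Proof. by move=> oA oB AB sf sg k; apply: Ck_comp1 oB AB (sf k) (sg k). Qed.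

Lemma open_neq0 : open [set x : R | x != 0].
Proof. exact: open_neq. Qed.

Lemma smooth_inv : smooth_on [set x : R | x != 0] GRing.inv.
Proof.
pose P (f : R -> R) := exists c m, f = fun x : R => c * x^-1 ^+ m.
apply: (@smooth_coind1 _ _ P open_neq0); last first.
- by exists 1, 1%N; apply/funext => x; rewrite mul1r expr1.
- move=> _ [c [m ->]]; exists (fun x => (- c * m%:R) * x^-1 ^+ m.+1).
    by exists (- c * m%:R), m.+1.
  move=> x /= x0.
  have dV : derivable (GRing.inv : R -> R) x 1 by apply: derivableV.
  rewrite derive1E.
  have -> : (fun x : R => c * x^-1 ^+ m) = c \*: ((GRing.inv : R -> R) ^+ m).
    by apply/funext => y; rewrite /= exprfctE.
  rewrite deriveZ; last exact: derivableX.
  have DV : 'D_1 (GRing.inv : R -> R) x = - x ^- 2 *: (1 : R).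
    by rewrite deriveE ?diff_Rinv//; exact: differentiable_Rinv.
  rewrite (deriveX _ dV) DV.
  rewrite /GRing.scale /= mulr1.
  case: m => [|m]; rewrite ?mulr0 ?mul0r//= ?mulr0//.
  rewrite !exprVn; have -> : x ^- m.+2 = x ^- m * x ^- 2 by rewrite -!exprVn -addn2 exprD.
  by rewrite mulrN mulrN mulNr mulNr !mulrA.
move=> _ [c [m ->]] x x0.
have dV : derivable (GRing.inv : R -> R) x 1 by apply: derivableV.
have -> : (fun x : R => c * x^-1 ^+ m) = c \*: ((GRing.inv : R -> R) ^+ m).
  by apply/funext => y; rewrite /= exprfctE.
by apply: derivableZ; apply: derivableX.
Qed.

Lemma smooth_onV (V : normedModType R) (A : set V) (f : V -> R) : open A ->
  (forall x, A x -> f x != 0) -> smooth_on A f -> smooth_on A (fun x => (f x)^-1).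
Proof. by move=> oA f0 sf; apply: smooth_on_comp1 open_neq0 f0 sf smooth_inv. Qed.

End OneVariable.

(** * Mean value inequalities *)

Lemma continuous_estimate (R : realType) (V W : normedModType R) (f : V -> W) x :
  (forall e : R, 0 < e -> \forall z \near x, `|f x - f z| < e) <->
  {for x, continuous f}.
Proof. by split=> [H|/cvgrPdist_lt//]; apply/cvgrPdist_lt. Qed.

Lemma near_shift_to0 (R : realType) (V : normedModType R) (y : V) (P : V -> Prop) :
  (\forall z \near y, P z) <-> (\forall h \near (0 : V), P (h + y)).
Proof.
by rewrite (near_shift 0 y) /=; split; apply: filterS => z; rewrite subr0.
Qed.

Lemma derive_comp (R : realType) (V W X : normedModType R) (f : V -> W) (g : W -> X) x v :
  differentiable f x -> differentiable g (f x) ->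
  'D_v (g \o f) x = 'D_('D_v f x) g (f x).
Proof.
move=> df dg; rewrite !deriveE//; last exact: differentiable_comp.
by rewrite (diff_comp df dg).
Qed.

Lemma derive_linear (R : realType) (W X : normedModType R) (l : {linear W -> X}) x v :
  continuous l -> 'D_v l x = l v.
Proof. by move=> cl; rewrite deriveE ?diff_lin//; exact: linear_differentiable. Qed.

Lemma near_preimage (R : realType) (V W : normedModType R) (f : V -> W) x (B : set W) :
  {for x, continuous f} -> open B -> B (f x) -> \forall z \near x, B (f z).
Proof. by move=> cf oB Bx; apply: cf; exact: open_nbhs_nbhs. Qed.

Lemma near_neq0 (R : realType) (V : normedModType R) (f : V -> R) x :
  {for x, continuous f} -> f x != 0 -> \forall z \near x, f z != 0.
Proof. by move=> cf; apply: near_preimage cf (open_neq0 (R := R)). Qed.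

Lemma near_forall_ord (R : realType) (V : normedModType R) (x : V) n (P : 'I_n -> V -> Prop) :
  (forall i, \forall z \near x, P i z) -> \forall z \near x, forall i, P i z.
Proof. exact: filter_forall. Qed.

Lemma rV_norm_leP (R : realType) n (x : 'rV[R]_n) (e : R) : 0 <= e ->
  `|x| <= e <-> forall j, `|x ord0 j| <= e.
Proof.
move=> e0; rewrite [`|x|]mx_normrE; split.
  by move=> /bigmax_leP[_ H] j; apply: (H (ord0, j)).
by move=> H; apply/bigmax_leP; split=> // -[i j] _ /=; rewrite ord1.
Qed.

Lemma rV_coord_le (R : realType) n (x : 'rV[R]_n) j : `|x ord0 j| <= `|x|.
Proof. by move: j; apply/rV_norm_leP. Qed.

Lemma ball_segment (R : realType) (V : normedModType R) (p : V) (r : R) x y (t : R) :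
  ball p r x -> ball p r y -> 0 <= t <= 1 -> ball p r (x + t *: (y - x)).
Proof.
rewrite -!ball_normE /= => px py /andP[t0 t1].
have -> : p - (x + t *: (y - x)) = (1 - t) *: (p - x) + t *: (p - y).
  rewrite scalerBl scale1r [t *: (p - y)]scalerBr [t *: (p - x)]scalerBr !scalerBr.
  by rewrite opprD !opprB !addrA subrK.
apply: le_lt_trans (ler_normD _ _) _; rewrite !normrZ.
have t1' : 0 <= 1 - t by rewrite subr_ge0.
rewrite !ger0_norm//.
have [->|tn0] := eqVneq t 0; first by rewrite subr0 mul1r mul0r addr0.
apply: (@lt_le_trans _ _ ((1 - t) * r + t * r)); last by rewrite -mulrDl subrK mul1r.
apply: ler_ltD; first by apply: ler_wpM2l => //; exact: ltW.
by rewrite ltr_pM2l // lt_def tn0.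
Qed.

Lemma mean_value (R : realType) (V : normedModType R) (f : V -> R) x y :
  (forall t : R, 0 <= t <= 1 -> differentiable f (x + t *: (y - x))) ->
  exists2 t : R, 0 <= t <= 1 & f y - f x = 'D_(y - x) f (x + t *: (y - x)).
Proof.
move=> df; pose g (t : R) := f (x + t *: (y - x)).
have dl t : is_diff t (fun t : R => x + t *: (y - x)) (fun h : R => h *: (y - x)).
  have D : is_diff t (cst x + ( *:%R^~ (y - x) : R -> V)) (0 + ( *:%R^~ (y - x) : R -> V)).
    exact: is_diffD.
  by rewrite add0r in D; exact: D.
have dg (t : R) : 0 <= t <= 1 -> is_derive t 1 g ('D_(y - x) f (x + t *: (y - x))).
  move=> t01; have D : differentiable g t by apply: differentiable_comp; auto.
  apply: DeriveDef; first exact: diff_derivable.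
  rewrite deriveE// [X in X 1](@diff_comp _ _ _ _ _ f)//; last exact: df.
  by rewrite /= diff_val scale1r deriveE//; exact: df.
have [//|t|c|c c01] := @MVT R g (fun t => 'D_(y - x) f (x + t *: (y - x))) 0 1.
- by rewrite in_itv /= => /andP[/ltW ? /ltW ?]; apply: dg; apply/andP.
- apply: continuous_in_subspaceT => t /set_mem /=; rewrite in_itv /= => t01.
  by apply: differentiable_continuous; apply: differentiable_comp; auto.
rewrite /g scale0r addr0 scale1r subr0 mulr1 addrCA subrr addr0 => E.
exists c => //; move: c01; rewrite in_itv /= => /andP[/ltW -> /ltW ->]; exact.
Qed.

Lemma lipschitz_on_ball (R : realType) n (f : 'rV[R]_n -> R) (p : 'rV[R]_n) (r M : R) :
  (forall z, ball p r z -> differentiable f z) ->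
  (forall z j, ball p r z -> `|pderive j f z| <= M) ->
  forall x y, ball p r x -> ball p r y -> `|f y - f x| <= M *+ n * `|y - x|.
Proof.
move=> df bf x y px py.
have [t t01 ->] := @mean_value _ _ f x y (fun t t01 => df _ (ball_segment px py t01)).
have pz := ball_segment px py t01.
rewrite derive_partials; last exact: df.
apply: le_trans (ler_norm_sum _ _ _) _.
rewrite -[n in M *+ n]card_ord -sumr_const mulr_suml; apply: ler_sum => j _.
by rewrite normrM mulrC; apply: ler_pM => //; [exact: bf|exact: rV_coord_le].
Qed.

(** * The inverse function theorem *)

Section SmoothMatrices.
Context {R : realType} {V : normedModType R}.
Variables (A : set V).
Hypothesis oA : open A.

Lemma smooth_on_det n (M : V -> 'M[R]_n) :
  (forall i j, smooth_on A (fun x => M x i j)) -> smooth_on A (fun x => \det (M x)).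
Proof.
move=> sM; apply: smooth_on_sum => // s _; apply: smooth_onM => //.
  exact: smooth_on_cst.
by apply: smooth_on_prod.
Qed.

Lemma smooth_on_invmx n (M : V -> 'M[R]_n) :
  (forall i j, smooth_on A (fun x => M x i j)) -> (forall x, A x -> M x \in unitmx) ->
  forall i j, smooth_on A (fun x => invmx (M x) i j).
Proof.
move=> sM uM i j.
have sd := smooth_on_det sM.
apply: (@smooth_on_ext _ _ _ _ (fun x => (\det (M x))^-1 * cofactor (M x) j i)) => //.
  by move=> x Ax; rewrite /invmx uM// !mxE.
apply: smooth_onM => //.
  by apply: smooth_onV => // x /uM; rewrite unitmxE unitfE.
apply: smooth_onM => //; first exact: smooth_on_cst.
apply: smooth_on_det => k l.
by apply: smooth_on_ext (sM (lift j k) (lift i l)) => // x _; rewrite !mxE.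
Qed.

End SmoothMatrices.

Definition local_inverse (R : realType) n (F G : 'rV[R]_n -> 'rV[R]_n)
    (x y : 'rV[R]_n) : Prop :=
  exists (A B : set 'rV[R]_n),
    [/\ open A /\ open B, A x /\ F x = y,
        smooth_on A F /\ smooth_on B G,
        forall z, A z -> B (F z) /\ G (F z) = z &
        forall z, B z -> A (G z) /\ F (G z) = z].

Section InverseFunction.
Context {R : realType} {n : nat}.
Implicit Types (F G : 'rV[R]_n -> 'rV[R]_n) (A B : set 'rV[R]_n).

(** Contractions of a compact convex set have a fixed point: a point where
    [|T x - x|] is minimal is fixed, since [T] brings it closer to its image. *)
Lemma contraction_fixed_point (K : set 'rV[R]_n) (T : 'rV[R]_n -> 'rV[R]_n) :
  K !=set0 -> compact K -> {within K, continuous T} -> (forall x, K x -> K (T x)) ->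
  (forall x y, K x -> K y -> `|T x - T y| <= 2^-1 * `|x - y|) ->
  exists2 x, K x & T x = x.
Proof.
move=> K0 cK cT KT lT.
have cN : {within K, continuous (fun x => `|T x - x|)}.
  move=> x; apply: cvg_norm; apply: cvgB; first exact: cT.
  by move: x; apply: continuous_subspaceT => x; exact: cvg_id.
have [c /set_mem Kc cmin] := EVT_min_rV K0 cK cN.
exists c => //; apply/eqP; rewrite -subr_eq0 -normr_le0.
have := cmin (T c) (mem_set (KT c Kc)).
by have := lT (T c) c (KT c Kc) Kc; lra.
Qed.

Lemma continuous_pderive_bound F (p : 'rV[R]_n) (A : set 'rV[R]_n) (e : R) : open A -> A p ->
  smooth_on A F -> 0 < e ->
  \forall z \near p, forall i j, `|pderive j F z ord0 i - pderive j F p ord0 i| < e.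
Proof.
move=> oA Ap sF e0.
have H i j : \forall z \near p, `|pderive j F z ord0 i - pderive j F p ord0 i| < e.
  have cF : {for p, continuous (fun z => pderive j F z ord0 i)}.
    apply: smooth_on_continuous Ap.
    by move: i; apply/smooth_on_coordinates => //; apply: pderive_smooth.
  have := (continuous_estimate _ _).2 cF e e0.
  by apply: filterS => z h; rewrite -normrN opprB; exact: h.
by apply: near_forall_ord => i; apply: near_forall_ord => j.
Qed.

Lemma smooth_on_mulmx m (A : set 'rV[R]_m) (M : 'M[R]_(m, n)) : open A ->
  smooth_on A (fun k => k *m M).
Proof.
move=> oA; apply/smooth_on_coordinates => // j.
apply: (@smooth_on_ext _ _ _ _ (fun k : 'rV[R]_m => \sum_i k ord0 i * M i j)) => //.
  by move=> k _; rewrite mxE.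
apply: smooth_on_sum => // i _; apply: smooth_onM => //; last exact: smooth_on_cst.
exact: smooth_on_coord.
Qed.

Lemma mulmx_continuous m (M : 'M[R]_(m, n)) : continuous (fun k : 'rV[R]_m => k *m M).
Proof. by move=> k; apply: smooth_on_continuous (smooth_on_mulmx M openT) _. Qed.

Definition jacobian_mx F (x : 'rV[R]_n) : 'M[R]_n :=
  \matrix_(j, i) pderive j F x ord0 i.

Lemma derive_jacobian_mx F x v : differentiable F x -> 'D_v F x = v *m jacobian_mx F x.
Proof.
move=> dF; rewrite derive_partials//; apply/rowP => i; rewrite mxE summxE.
by apply: eq_bigr => j _; rewrite !mxE.
Qed.

Lemma smooth_on_jacobian A F i j : open A -> smooth_on A F ->
  smooth_on A (fun x => jacobian_mx F x i j).
Proof.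
move=> oA sF; apply: (@smooth_on_ext _ _ _ _ (fun x => pderive i F x ord0 j)) => //.
  by move=> x _; rewrite mxE.
by move: j; apply/smooth_on_coordinates => //; apply: pderive_smooth.
Qed.

(** A Lipschitz inverse of a smooth map with invertible differentials is smooth:
    its differential is the inverse matrix, so each order of differentiability
    gives the next one. *)
Lemma smooth_inverse A B F G : open A -> open B -> smooth_on A F ->
  (forall x, A x -> jacobian_mx F x \in unitmx) ->
  (forall y, B y -> A (G y) /\ F (G y) = y) ->
  (forall y z, B y -> B z -> `|G y - G z| <= 2 * `|y - z|) -> smooth_on B G.
Proof.
move=> oA oB sF uJ BG lG.
have cG y : B y -> {for y, continuous G}.
  move=> By; apply/continuous_estimate => e e0; near=> z.
  have Bz : B z by near: z; exact: open_nbhs_nbhs.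
  apply: le_lt_trans (lG _ _ By Bz) _; rewrite -ltr_pdivlMl// mulrC.
  by near: z; apply: (@cvgr_dist_lt _ _ _ (nbhs y) _ id y); [exact: cvg_id|rewrite divr_gt0].
have dG y : B y -> differentiable G y /\
    forall v, 'D_v G y = v *m invmx (jacobian_mx F (G y)).
  move=> By; have [Ax Fx] := BG y By; set x := G y in Ax Fx *.
  set M := invmx _; pose L : {linear 'rV[R]_n -> 'rV[R]_n} := mulmxr M.
  have cL : continuous L by exact: mulmx_continuous.
  have [C C0 LC] := linear_lipschitz cL.
  have dF : differentiable F x by exact: smooth_on_differentiable sF Ax.
  suff [dG DG] : differentiable G y /\ 'd G y = L :> ('rV[R]_n -> 'rV[R]_n).
    by split=> // v; rewrite deriveE// DG.
  apply: differentiable_estimate => // e e0.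
  have e'0 : 0 < e / (2 * C) by rewrite divr_gt0// mulr_gt0.
  have Fe : \forall h \near (0 : 'rV[R]_n),
      `|F (G (h + y) - x + x) - F x - 'd F x (G (h + y) - x)| <=
        e / (2 * C) * `|G (h + y) - x|.
    pose Q k := `|F (k + x) - F x - 'd F x k| <= e / (2 * C) * `|k|.
    have Q0 : \forall w \near x, Q (w - x).
      apply/near_shift_to0; apply: filterS (estimate_of_differentiable dF e'0) => k.
      by rewrite addrK.
    by apply: (iffLR (near_shift_to0 y (fun z => Q (G z - x)))); exact: cG Q0.
  have Bn : \forall h \near (0 : 'rV[R]_n), B (h + y).
    by apply/(near_shift_to0 y B); exact: open_nbhs_nbhs.
  near=> h.
  have Bh : B (h + y) by near: h; exact: Bn.
  have [Axh Fxh] := BG _ Bh.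
  have : `|F (G (h + y) - x + x) - F x - 'd F x (G (h + y) - x)| <=
     e / (2 * C) * `|G (h + y) - x| by near: h; exact: Fe.
  rewrite subrK Fxh Fx addrK -deriveE// derive_jacobian_mx//.
  set k := G (h + y) - x => hk.
  have kh : `|k| <= 2 * `|h| by have := lG _ _ Bh By; rewrite addrK.
  have -> : k - L h = L (k *m jacobian_mx F x - h).
    by rewrite linearB /= mulmxK//; exact: uJ.
  apply: le_trans (LC _) _; rewrite distrC.
  apply: le_trans (ler_wpM2l (ltW C0) hk) _.
  apply: le_trans (ler_wpM2l (ltW C0) (ler_wpM2l (ltW e'0) kh)) _.
  rewrite le_eqVlt; apply/orP; left; apply/eqP; field.
  by rewrite gt_eqF.
elim=> [|k IH]; first by move=> y By; exact: cG.
split=> [y By|v]; first exact: (dG y By).1.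
apply: (@Ck_ext _ _ _ _ _ (fun y => v *m invmx (jacobian_mx F (G y)))) => //.
  by move=> y By; rewrite (dG y By).2.
apply/Ck_coordinates => // j.
apply: (@Ck_ext _ _ _ _ _
  (fun y => \sum_i v ord0 i * ((fun x => invmx (jacobian_mx F x) i j) \o G) y)) => //.
  by move=> y _; rewrite mxE.
apply: Ck_sum => // i _; apply: CkM => //; first exact: Ck_cst.
apply: (@Ck_comp_real _ _ _ _ _ A) => //; first by move=> y /BG[].
apply: smooth_on_invmx => // a b; exact: smooth_on_jacobian.
Unshelve. all: by end_near. Qed.

(** When the differential at [p] is the identity, [x - F x] is a contraction near
    [p], and [F x = y] is a fixed point equation for [x - F x + y]. *)
Lemma inverse_function_id A F p : open A -> A p -> smooth_on A F ->
  jacobian_mx F p = 1%:M -> exists G, local_inverse F G p (F p).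
Proof.
move=> oA Ap sF Jp.
pose e : R := (2 * n.+1%:R)^-1.
have e0 : 0 < e by rewrite invr_gt0 mulr_gt0.
have ne : e *+ n <= 2^-1.
  rewrite -[e *+ n]mulr_natl ler_pdivrMr ?mulr_gt0// mulrA mulVf// mul1r ler_nat.
  exact: leqnSn.
have : \forall z \near p, [/\ A z, jacobian_mx F z \in unitmx &
   forall i j, `|pderive j F z ord0 i - pderive j F p ord0 i| < e].
  have H1 := continuous_pderive_bound oA Ap sF e0.
  have H2 : \forall z \near p, A z by exact: open_nbhs_nbhs.
  have H3 : \forall z \near p, \det (jacobian_mx F z) != 0.
    have cd : {for p, continuous (fun z => \det (jacobian_mx F z))}.
      apply: smooth_on_continuous Ap; apply: smooth_on_det => // i j.
      exact: smooth_on_jacobian.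
    by apply: (near_neq0 cd); rewrite Jp det1 oner_neq0.
  near=> z; split; [near: z; exact: H2 | rewrite unitmxE unitfE; near: z; exact: H3 | near: z; exact: H1].
move=> /nbhs_ballP[r r0 Hr]; pose rho := r / 2.
have rho0 : 0 < rho by rewrite divr_gt0.
have rhor : rho < r by rewrite /rho gtr_pMr// invf_lt1// ltr1n.
pose phi x := x - F x.
have dF z : ball p r z -> differentiable F z.
  by move=> /Hr[Az _ _]; exact: smooth_on_differentiable sF Az.
have lip x y : ball p r x -> ball p r y -> `|phi y - phi x| <= 2^-1 * `|y - x|.
  move=> px py; apply/rV_norm_leP => [|i]; first by rewrite mulr_ge0.
  have dc z : ball p r z -> differentiable (fun z => F z ord0 i) z.
    by move=> pz; exact: (iffLR (differentiable_coordinates _ _) (dF _ pz) i).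
  have := @lipschitz_on_ball R n (fun z => z ord0 i - F z ord0 i) p r e _ _ x y px py.
  rewrite !mxE => H; apply: le_trans (H _ _) _; last by rewrite ler_wpM2r.
    move=> z pz; apply: differentiableB; [exact: differentiable_coord|exact: dc].
  move=> z j pz; rewrite /pderive deriveB; first last.
  - exact/diff_derivable/dc.
  - exact/diff_derivable/differentiable_coord.
  rewrite (derive_coordinates _ _ (dF _ pz)) (@derive_coordinates _ _ _ id)// derive_id.
  have [_ _ /(_ i j)/ltW] := Hr _ pz; rewrite -normrN opprB; congr (`|_ - _| <= _).
  by move/matrixP: Jp => /(_ j i); rewrite !mxE eqxx eq_sym.
have inj x y : ball p r x -> ball p r y -> `|x - y| <= 2 * `|F x - F y|.
  move=> px py; have := lip _ _ py px.
  have -> : phi x - phi y = (x - y) - (F x - F y) by rewrite /phi !opprB addrACA [RHS]addrACA [- F x - y]addrC.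
  have := ler_distD (F x - F y) 0 (x - y); rewrite !sub0r !normrN distrC.
  lra.
pose K := [set x | `|p - x| <= rho].
have Kr x : K x -> ball p r x by move=> Kx; rewrite -ball_normE /=; apply: le_lt_trans rhor.
have cK : compact K.
  apply: bounded_closed_compact.
    exists (`|p| + rho); split; first exact: num_real.
    move=> M pM x Kx; apply: le_trans (ltW pM).
    rewrite -[x](subKr p); apply: le_trans (ler_normB _ _) _; exact: lerD.
  have -> : K = closed_ball p rho by rewrite closed_ballE.
  exact: closed_ball_closed.
pose B := ball (F p) (rho / 2).
have sol y : B y -> exists x, ball p rho x /\ F x = y.
  rewrite /B -ball_normE /= => By.
  have bnd x : ball p r x -> `|p - (phi x + y)| <= 2^-1 * `|p - x| + `|F p - y|.
    move=> px; have := lip _ _ px (ballxx p r0); rewrite {1}/phi.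
    have -> : p - (phi x + y) = (p - F p - phi x) + (F p - y).
      by rewrite opprD !addrA; congr (_ - _); rewrite addrAC subrK.
    by move=> h; apply: le_trans (ler_normD _ _) _; rewrite lerD2r.
  have [x Kx Tx] : exists2 x, K x & phi x + y = x.
    apply: contraction_fixed_point => //.
    - by exists p; rewrite /K /= subrr normr0 ltW.
    - apply: continuous_in_subspaceT => x /set_mem Kx.
      apply: continuousD; last exact: cst_continuous.
      apply: continuousB; first exact: cvg_id.
      exact/differentiable_continuous/dF/Kr.
    - by move=> x Kx; apply: le_trans (bnd _ (Kr _ Kx)) _; move: Kx; rewrite /K /=; lra.
    - move=> x z Kx Kz; rewrite opprD addrACA subrr addr0.
      by apply: lip; apply: Kr.
  exists x; split.
    by have := bnd _ (Kr _ Kx); rewrite Tx; lra.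
  by apply: (addrI (phi x)); rewrite Tx /phi subrK.
pose G y := xget p [set x | ball p rho x /\ F x = y].
have GP y : B y -> ball p rho (G y) /\ F (G y) = y.
  by move=> /sol; exact: (@xgetPex _ p [set x | ball p rho x /\ F x = y]).
have br x : ball p rho x -> ball p r x by apply: le_ball; exact: ltW.
pose A0 := ball p rho `&` F @^-1` B.
have oA0 : open A0.
  rewrite openE => x [px Bx]; apply: filterI; first by apply: open_nbhs_nbhs; split=> //; exact: ball_open.
  apply: (differentiable_continuous (dF _ (br _ px))).
  by apply: open_nbhs_nbhs; split=> //; apply: ball_open; rewrite divr_gt0.
have oB : open B by apply: ball_open; rewrite divr_gt0.
exists G, A0, B; split.
- by [].
- by split=> //; split; [exact: ballxx|apply: ballxx; rewrite divr_gt0].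
- split; first by apply: smooth_on_subset sF => x [/br/Hr[]].
  apply: (@smooth_inverse (ball p rho) B F) => //.
  + exact: ball_open.
  + by apply: smooth_on_subset sF => x /br/Hr[].
  + by move=> x /br/Hr[].
  + move=> y z By Bz; have [py Fy] := GP _ By; have [pz Fz] := GP _ Bz.
    by have := inj _ _ (br _ py) (br _ pz); rewrite Fy Fz.
- move=> z [pz Bz]; split=> //; have [pG FG] := GP _ Bz.
  apply/eqP; rewrite -subr_eq0 -normr_le0; apply: le_trans (inj _ _ (br _ pG) (br _ pz)) _.
  by rewrite FG subrr normr0 mulr0.
- by move=> y By; have [pG FG] := GP _ By; split=> //; split=> //; rewrite /preimage /= FG.
Unshelve. all: by end_near. Qed.

(** Composing with the inverse of the differential at [p] reduces to the identity. *)
Theorem inverse_function A F p : open A -> A p -> smooth_on A F ->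
  (forall v, 'D_v F p = 0 -> v = 0) -> exists G, local_inverse F G p (F p).
Proof.
move=> oA Ap sF injF.
have dF : differentiable F p by exact: smooth_on_differentiable sF Ap.
set J := jacobian_mx F p.
have uJ : J \in unitmx.
  rewrite -row_free_unit; apply: inj_row_free => v vJ.
  by apply: injF; rewrite derive_jacobian_mx.
pose F1 x := F x *m invmx J.
have sF1 : smooth_on A F1.
  exact: (@smooth_on_comp _ _ _ _ A setT F (mulmxr (invmx J)) oA openT _ sF
    (smooth_on_mulmx _ openT)).
have [|G1 [A1 [B1 [[oA1 oB1] [A1p _] [sA1 sB1] AB BA]]]] := @inverse_function_id A F1 p oA Ap sF1.
  apply/row_matrixP => j; rewrite rowE -derive_jacobian_mx; last exact: smooth_on_differentiable sF1 Ap.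
  have dM : differentiable (fun k : 'rV[R]_n => k *m invmx J) (F p).
    exact: smooth_on_differentiable (smooth_on_mulmx _ openT) _.
  have dF1 : differentiable F1 p by exact: differentiable_comp dF dM.
  rewrite (derive_comp _ dF dM).
  rewrite (@derive_linear _ _ _ (mulmxr (invmx J))); last exact: mulmx_continuous.
  by rewrite /= derive_jacobian_mx// mulmxK// rowE mulmx1.
pose l : 'rV[R]_n -> 'rV[R]_n := mulmxr (invmx J).
have cl : continuous l by exact: mulmx_continuous.
have lK : injective l.
  by move=> x y /(congr1 (mulmxr J)); rewrite /l /= !mulmxKV.
pose B := l @^-1` B1.
have oB : open B by apply: open_comp => // y _; exact: cl.
have sG : smooth_on B (G1 \o l).
  by apply: (@smooth_on_comp _ _ _ _ _ B1) => //; exact: smooth_on_mulmx.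
pose B2 := B `&` (G1 \o l) @^-1` A.
have oB2 : open B2.
  rewrite openE => y [By Ay]; apply: filterI; first exact: open_nbhs_nbhs.
  by apply: (smooth_on_continuous sG By); exact: open_nbhs_nbhs.
have FG y : B y -> A (G1 (l y)) -> F (G1 (l y)) = y.
  by move=> By Ay; apply: lK; exact: (BA _ By).2.
exists (G1 \o l), (A `&` A1), B2; split.
- by split=> //; exact: openI.
- by [].
- by split; [apply: smooth_on_subset sF => x []|apply: smooth_on_subset sG => x []].
- move=> z [Az A1z]; have [Bz Gz] := AB _ A1z.
  by split; [split=> //; rewrite /preimage /= /l /= Gz|rewrite /= /l /= Gz].
- by move=> y [By Ay]; split; [split=> //; case: (BA _ By)|exact: FG].
Qed.

End InverseFunction.

(** * Second-order estimates *)

Lemma continuous_at_norm (R : realType) (V W : normedModType R) (f : V -> W) x :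
  {for x, continuous f} -> {for x, continuous (fun y => `|f y|)}.
Proof.
move=> /continuous_estimate cf; apply/continuous_estimate => e e0.
by apply: filterS (cf e e0) => z; apply: le_lt_trans; exact: ler_dist_dist.
Qed.

Lemma near_and3 (R : realType) (V : normedModType R) (x : V) (P Q S : V -> Prop) :
  (\forall y \near x, P y) -> (\forall y \near x, Q y) -> (\forall y \near x, S y) ->
  \forall y \near x, [/\ P y, Q y & S y].
Proof. by move=> p q s; near do split. Unshelve. all: by end_near. Qed.

Lemma derive_scale_dir (R : realType) (V W : normedModType R) (f : V -> W) x v (c : R) :
  differentiable f x -> 'D_(c *: v) f x = c *: 'D_v f x.
Proof. by move=> df; rewrite !deriveE// linearZ. Qed.

Lemma derive_translate (R : realType) (V W : normedModType R) (f : V -> W) x v (a : V) :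
  'D_v (fun y => f (y + a)) x = 'D_v f (x + a).
Proof.
rewrite /derive; set u := (X in lim (X @ _)); set w := (X in _ = lim (X @ _)).
by suff -> : u = w by []; apply/funext => h; rewrite /u /w /= addrA.
Qed.

Lemma differentiable_translate (R : realType) (V W : normedModType R) (f : V -> W) x (a : V) :
  differentiable f (x + a) -> differentiable (fun y => f (y + a)) x.
Proof.
by move=> df; apply: (@differentiable_comp _ _ _ _ (fun y => y + a) f).
Qed.

Section SecondOrder.
Context {R : realType} {n : nat}.
Implicit Types (f : 'rV[R]_n -> R) (p z h : 'rV[R]_n).

Lemma taylor2 f p (r C : R) : 0 <= C ->
  (forall z, ball p r z -> differentiable f z) ->
  (forall z j, ball p r z -> differentiable (pderive j f) z) ->
  (forall z i j, ball p r z -> `|pderive i (pderive j f) z| <= C) ->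
  forall z h, ball p r z -> ball p r (h + z) ->
  `|f (h + z) - f z - \sum_j h ord0 j * pderive j f z| <= C * n%:R ^+ 2 * `|h| ^+ 2.
Proof.
move=> C0 df ddf bf z h pz phz.
have seg (t : R) : 0 <= t <= 1 -> ball p r (z + t *: (h + z - z)).
  exact: ball_segment.
have [t t01 E] := @mean_value R _ f z (h + z) (fun t t01 => df _ (seg t t01)).
have hz : h + z - z = h by rewrite addrK.
rewrite hz in E seg.
rewrite E derive_partials; last exact/df/seg.
rewrite -sumrB; apply: le_trans (ler_norm_sum _ _ _) _.
have -> : C * n%:R ^+ 2 * `|h| ^+ 2 = \sum_(j < n) `|h| * (C *+ n * `|h|).
  by rewrite sumr_const card_ord -mulr_natr -[C *+ n]mulr_natr; ring.
apply: ler_sum => j _; rewrite -[_ *: _]/(_ * _) -mulrBr normrM.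
apply: ler_pM => //; first exact: rV_coord_le.
apply: le_trans (@lipschitz_on_ball R n (pderive j f) p r C _ _ z _ pz (seg t t01)) _.
- by move=> y py; exact: ddf.
- by move=> y i py; exact: bf.
rewrite addrC addKr normrZ; apply: ler_wpM2l; first by rewrite mulrn_wge0.
by rewrite ler_piMl// ger0_norm; case/andP: t01.
Qed.

(** Quadratic error bounds are uniform when second derivatives are, which is what makes
    differentiation under a sum or an integral possible. *)
Lemma differentiable_quadratic f z (a : 'I_n -> R) (K d : R) : 0 < d ->
  (forall h, `|h| < d -> `|f (h + z) - f z - \sum_j h ord0 j * a j| <= K * `|h| ^+ 2) ->
  differentiable f z /\ forall j, pderive j f z = a j.
Proof.
move=> d0 H; pose A := \col_j a j.
pose l := fun h : 'rV[R]_n => (h *m A) ord0 ord0.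
have lE h : l h = \sum_j h ord0 j * a j.
  by rewrite /l mxE; apply: eq_bigr => j _; rewrite mxE.
have ll : linear l by move=> c x y; rewrite /l mulmxDl -scalemxAl !mxE.
pose L : {linear 'rV[R]_n -> R} := HB.pack l (GRing.isLinear.Build R _ R _ l ll).
have cL : continuous L.
  move=> x; apply: (@continuous_comp _ _ _ (fun h : 'rV[R]_n => h *m A) (coord ord0)).
    exact: mulmx_continuous.
  exact: coord_continuous'.
have [|df dfE] := @differentiable_estimate R _ _ f z L cL.
  move=> e e0; have K1 : 0 < `|K| + 1 by rewrite ltr_wpDl.
  apply/nbhs_ballP; exists (Num.min d (e / (`|K| + 1))) => /=.
    by rewrite lt_min d0 divr_gt0.
  move=> h; rewrite -ball_normE /= sub0r normrN lt_min => /andP[hd he].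
  rewrite /L /= lE; apply: le_trans (H _ hd) _.
  rewrite expr2 mulrA ler_wpM2r//.
  have := ler_norm K; rewrite ltr_pdivlMr// in he.
  by move=> KK; have := normr_ge0 h; nra.
split=> // j; rewrite /pderive deriveE// dfE /L /= lE (bigD1 j)//= big1 ?addr0.
  by rewrite mxE !eqxx mul1r.
by move=> i ij; rewrite mxE eqxx (negbTE ij) mul0r.
Qed.

Lemma bounded_on_ball f p (r r' : R) : r' < r ->
  (forall z, ball p r z -> {for z, continuous f}) ->
  exists2 C, 0 <= C & forall z, ball p r' z -> `|f z| <= C.
Proof.
move=> rr cf; have [r'0|r'0] := leP r' 0.
  exists 0 => // z; rewrite -ball_normE /= => pz.
  by have := le_lt_trans (normr_ge0 _) (lt_le_trans pz r'0); rewrite ltxx.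
pose K := [set x | `|p - x| <= r'].
have cK : compact K.
  have -> : K = closed_ball p r' by rewrite closed_ballE.
  apply: bounded_closed_compact; last exact: closed_ball_closed.
  exists (`|p| + r'); split; first exact: num_real.
  move=> M pM x; rewrite closed_ballE//= => Kx; apply: le_trans (ltW pM).
  rewrite -[x](subKr p); apply: le_trans (ler_normB _ _) _; exact: lerD.
have [||c _ cmax] := @EVT_max_rV R n (fun x => `|f x|) K _ cK.
- by exists p; rewrite /K /= subrr normr0 ltW.
- apply: continuous_in_subspaceT => x /set_mem Kx; apply: continuous_at_norm.
  by apply: cf; rewrite -ball_normE /=; apply: le_lt_trans rr.
exists `|f c| => // z; rewrite -ball_normE /= => pz; apply: cmax.
by rewrite inE; exact: ltW.
Qed.

(** The second difference of [f] over a parallelogram with sides [h e_i] and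
    [h e_j] is symmetric in [i] and [j], and is a value of a mixed second
    derivative by two applications of the mean value theorem. *)
Lemma second_difference (A : set 'rV[R]_n) f i j z (r h : R) : ball z r `<=` A ->
  smooth_on A f -> 0 < h -> 2 * h < r ->
  exists2 y, ball z r y &
    f (z + h *: delta_mx 0 i + h *: delta_mx 0 j) - f (z + h *: delta_mx 0 i)
    - (f (z + h *: delta_mx 0 j) - f z) = h * (h * pderive j (pderive i f) y).
Proof.
move=> zA sf h0 hr; set a := h *: delta_mx 0 i; set b := h *: delta_mx 0 j.
have nd k : `|h *: delta_mx 0 k : 'rV[R]_n| <= h.
  rewrite normrZ gtr0_norm// ger_pMr//; apply/rV_norm_leP => // l.
  by rewrite mxE eqxx /=; case: eqP => _; rewrite ?normr1 ?normr0.
have inb (s t : R) : 0 <= s <= 1 -> 0 <= t <= 1 -> ball z r (z + s *: a + t *: b).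
  move=> /andP[s0 s1] /andP[t0 t1]; rewrite -ball_normE /= opprD opprD !addrA subrr sub0r.
  apply: le_lt_trans (ler_normB _ _) _.
  rewrite normrN (normrZ s) (normrZ t) (ger0_norm s0) (ger0_norm t0).
  apply: le_lt_trans hr; rewrite mulr_natl mulr2n; apply: lerD.
    by apply: le_trans (nd i); rewrite ler_piMl.
  by apply: le_trans (nd j); rewrite ler_piMl.
have z01 : 0 <= (0 : R) <= 1 by rewrite lexx ler01.
have o01 : 0 <= (1 : R) <= 1 by rewrite lexx ler01.
have df y : ball z r y -> differentiable f y by move=> /zA; exact: smooth_on_differentiable.
have ddf y : ball z r y -> differentiable (pderive i f) y.
  by move=> /zA; apply: smooth_on_differentiable; exact: pderive_smooth.
pose phi x := f (x + b) - f x.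
have dphi (s : R) : 0 <= s <= 1 -> differentiable phi (z + s *: (z + a - z)).
  move=> s01; have -> : z + a - z = a by rewrite addrAC subrr add0r.
  apply: differentiableB; last first.
    by apply: df; have := inb s 0 s01 z01; rewrite scale0r addr0.
  by apply: differentiable_translate; apply: df; have := inb s 1 s01 o01; rewrite scale1r.
have [s s01] := mean_value dphi.
have -> : z + a - z = a by rewrite addrAC subrr add0r.
set x := z + s *: a.
have bx : ball z r x by have := inb s 0 s01 z01; rewrite scale0r addr0.
have bxb : ball z r (x + b) by have := inb s 1 s01 o01; rewrite scale1r.
have -> : 'D_a phi x = h * (pderive i f (x + b) - pderive i f x).
  rewrite deriveB.
  - by rewrite derive_translate !derive_scale_dir; [rewrite mulrBr|exact: df|exact: df].
  - by apply/diff_derivable/differentiable_translate/df.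
  - by apply/diff_derivable/df.
have [|t t01 E] := @mean_value R _ (pderive i f) x (x + b).
  move=> t t01; have -> : x + b - x = b by rewrite addrAC subrr add0r.
  by apply: ddf; exact: inb.
rewrite E; have -> : x + b - x = b by rewrite addrAC subrr add0r.
move=> Ephi; exists (x + t *: b); first exact: inb.
move: Ephi; rewrite /phi => ->; congr (h * _).
by rewrite derive_scale_dir//; apply: ddf; exact: inb.
Qed.

Lemma pderive_commute (A : set 'rV[R]_n) f i j z : open A -> A z -> smooth_on A f ->
  pderive i (pderive j f) z = pderive j (pderive i f) z.
Proof.
move=> oA Az sf; apply/eqP; rewrite -subr_eq0 -normr_le0.
apply/ler_addgt0Pr => e e0; rewrite add0r.
have cont k l : {for z, continuous (pderive k (pderive l f))}.
  by apply: smooth_on_continuous Az; do 2 apply: pderive_smooth.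
have e20 : 0 < e / 2 by rewrite divr_gt0.
have : \forall y \near z, [/\ A y,
    `|pderive i (pderive j f) z - pderive i (pderive j f) y| < e / 2 &
    `|pderive j (pderive i f) z - pderive j (pderive i f) y| < e / 2].
  have H1 : \forall y \near z, A y by exact: open_nbhs_nbhs.
  have H2 := (continuous_estimate _ _).2 (cont i j) _ e20.
  have H3 := (continuous_estimate _ _).2 (cont j i) _ e20.
  exact: near_and3.
move=> /nbhs_ballP[r /= r0 Hr].
have zA : ball z r `<=` A by move=> y /Hr[].
have h0 : 0 < r / 3 by rewrite divr_gt0.
have hr : 2 * (r / 3) < r by lra.
have [y1 b1 E1] := second_difference i j zA sf h0 hr.
have [y2 b2] := second_difference j i zA sf h0 hr.
have -> : z + (r / 3) *: delta_mx 0 j + (r / 3) *: delta_mx 0 i =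
          z + (r / 3) *: delta_mx 0 i + (r / 3) *: delta_mx 0 j by rewrite addrAC.
have -> (a b c d : R) : a - b - (c - d) = a - c - (b - d) by ring.
rewrite E1 => /(mulfI (lt0r_neq0 h0))/(mulfI (lt0r_neq0 h0)) E2.
have [_ _ H1] := Hr _ b1; have [_ H2 _] := Hr _ b2.
rewrite -E2 in H2; clear -H1 H2.
move: (pderive j _ y1) (pderive i _ z) (pderive j _ z) H1 H2 => u v w H1 H2.
rewrite [e]splitr; apply: le_trans (ler_distD u v w) _.
by apply: lerD; apply: ltW; rewrite // distrC.
Qed.
End SecondOrder.

(** * Points of the plane *)

Section Plane.
Context {R : realType}.

Definition pt (u v : R) : 'rV[R]_2 := \row_(j < 2) (if j == 0 then u else v).

Lemma pt0 u v : pt u v ord0 0 = u. Proof. by rewrite mxE. Qed.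
Lemma pt1 u v : pt u v ord0 1 = v. Proof. by rewrite mxE. Qed.

Lemma ord2_ind (P : 'I_2 -> Prop) : P 0 -> P 1 -> forall j, P j.
Proof.
move=> P0 P1 [[|[|j]] lj] //; [rewrite (_ : Ordinal _ = 0)//|rewrite (_ : Ordinal _ = 1)//];
  exact: val_inj.
Qed.

Lemma ptE (z : 'rV[R]_2) : z = pt (z ord0 0) (z ord0 1).
Proof. by apply/rowP; apply: ord2_ind; rewrite ?pt0 ?pt1. Qed.

Lemma ball0_pt (r : R) (z : 'rV[R]_2) : 0 < r -> ball 0 r z <-> (`|z ord0 0| < r /\ `|z ord0 1| < r).
Proof.
move=> r0; rewrite -ball_normE /= sub0r normrN; split.
  by move=> zr; split; apply: le_lt_trans (rV_coord_le _ _) zr.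
move=> [z0 z1]; apply: (@le_lt_trans _ _ (Num.max `|z ord0 0| `|z ord0 1|)).
  apply/rV_norm_leP; first by rewrite le_max normr_ge0.
  by apply: ord2_ind; rewrite le_max lexx ?orbT.
by rewrite gt_max z0.
Qed.

Lemma smooth_on_pt (V : normedModType R) (A : set V) (f g : V -> R) : open A ->
  smooth_on A f -> smooth_on A g -> smooth_on A (fun x => pt (f x) (g x)).
Proof.
move=> oA sf sg; apply/smooth_on_coordinates => //; apply: ord2_ind.
  by apply: smooth_on_ext sf => // x _; rewrite pt0.
by apply: smooth_on_ext sg => // x _; rewrite pt1.
Qed.

Lemma sum2E (W : zmodType) (F : 'I_2 -> W) : \sum_j F j = F 0 + F 1.
Proof. by rewrite big_ord_recl big_ord1; congr (_ + F _); exact: val_inj. Qed.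

End Plane.

Lemma near_ballW (R : realType) (V : normedModType R) (x : V) (P : V -> Prop) :
  (\forall y \near x, P y) -> exists2 d : R, 0 < d & forall y, ball x d y -> P y.
Proof. by move=> /nbhs_ballP[d /= d0 H]; exists d. Qed.

(** * Series of smooth functions *)

Section Series.
Context {R : realType}.

Lemma cvg_sum_seq (I : Type) (r : seq I) (f : I -> nat -> R) (l : I -> R) :
  (forall i, f i n @[n --> \oo] --> l i) ->
  (\sum_(i <- r) f i n) @[n --> \oo] --> \sum_(i <- r) l i.
Proof.
move=> fl; elim: r => [|i r IH].
  by under eq_fun do rewrite big_nil; rewrite big_nil; exact: cvg_cst.
by under eq_fun do rewrite big_cons; rewrite big_cons; exact: cvgD.
Qed.

Lemma sum_half_le M : \sum_(0 <= k < M) (2^-1 : R) ^+ k <= 2.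
Proof.
have -> : \sum_(0 <= k < M) (2^-1 : R) ^+ k = 2 - 2 * 2^-1 ^+ M.
  elim: M => [|M IH]; first by rewrite big_nil expr0 mulr1 subrr.
  by rewrite big_nat_recr//= IH exprS; field.
by rewrite gerBl// mulr_ge0// exprn_ge0// invr_ge0.
Qed.

Lemma geometric_domination (u : nat -> R) (C : R) :
  (forall k, `|u k| <= C * 2^-1 ^+ k) ->
  cvgn (series u) /\ `|limn (series u)| <= 2 * C.
Proof.
move=> uC; have C0 : 0 <= C by have := le_trans (normr_ge0 _) (uC 0%N); rewrite expr0 mulr1.
have cu : cvgn (series u).
  apply: normed_cvg; apply: (@series_le_cvg _ _ (geometric C 2^-1)) => //=.
  - by move=> k; rewrite mulr_ge0// exprn_ge0// invr_ge0.
  - by apply: is_cvg_geometric_series; rewrite ger0_norm ?invr_ge0// invf_lt1// ltr1n.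
split=> //; have bu M : `|series u M| <= 2 * C.
  rewrite /series /=; apply: le_trans (ler_norm_sum _ _ _) _.
  apply: (@le_trans _ _ (\sum_(0 <= k < M) C * 2^-1 ^+ k)).
    by apply: ler_sum => k _; exact: uC.
  by rewrite -mulr_sumr mulrC ler_wpM2r// sum_half_le.
rewrite ler_norml; apply/andP; split.
  by apply: limr_ge => //; near=> M; have := bu M; rewrite ler_norml => /andP[].
by apply: limr_le => //; near=> M; have := bu M; rewrite ler_norml => /andP[].
Unshelve. all: by end_near. Qed.

Context {n : nat} (p : 'rV[R]_n) (r : R).
Let B := ball p r.
Implicit Types (b : nat -> 'rV[R]_n -> R).

Definition pderives (s : seq 'I_n) (f : 'rV[R]_n -> R) := foldr (@pderive R n R) f s.

Lemma pderives_smooth (A : set 'rV[R]_n) s f : smooth_on A f -> smooth_on A (pderives s f).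
Proof. by move=> sf; elim: s => [//|j s IH] /=; exact: pderive_smooth. Qed.

(** All the derivatives of the series are dominated by the same geometric series; the class of
    such families is stable under partial derivatives. *)
Definition geometric_family b : Prop :=
  (forall k, smooth_on B (b k)) /\
  forall s, exists2 C : R, 0 <= C &
    forall k z, B z -> `|pderives s (b k) z| <= C * 2^-1 ^+ k.

Definition ssum b (z : 'rV[R]_n) : R := limn (series (fun k => b k z)).

Lemma geometric_family_pderive b j : geometric_family b ->
  geometric_family (fun k => pderive j (b k)).
Proof.
move=> [sb gb]; split=> [k|s]; first exact: pderive_smooth.
have [C C0 bC] := gb (rcons s j); exists C => // k z Bz.
by have := bC k z Bz; rewrite /pderives foldr_rcons.
Qed.

Lemma ssum_differentiable b z : geometric_family b -> B z ->
  differentiable (ssum b) z /\ forall j, pderive j (ssum b) z = ssum (fun k => pderive j (b k)) z.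
Proof.
move=> gfb Bz; have [sb gb] := gfb.
have /choice[C HC] : forall ij : 'I_n * 'I_n, exists C : R, 0 <= C /\
    forall k z, B z -> `|pderive ij.1 (pderive ij.2 (b k)) z| <= C * 2^-1 ^+ k.
  by move=> [i j]; have [C C0 bC] := gb [:: i; j]; exists C; split.
pose C2 := \sum_ij C ij.
have C2C ij : C ij <= C2.
  by rewrite /C2 (bigD1 ij)//= lerDl sumr_ge0// => kl _; case: (HC kl).
have C20 : 0 <= C2 by apply: sumr_ge0 => ij _; case: (HC ij).
have cvb y : B y -> cvgn (series (fun k => b k y)).
  move=> By; have [C0 _ bC0] := gb [::].
  by apply: (geometric_domination (C := C0) _).1 => k; exact: (bC0 k y By).
have cvd j y : B y -> cvgn (series (fun k => pderive j (b k) y)).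
  move=> By; have [C0 _ bC0] := gb [:: j].
  by apply: (geometric_domination (C := C0) _).1 => k; exact: (bC0 k y By).
have [d d0 zB] : exists2 d : R, 0 < d & forall y, ball z d y -> B y.
  by apply: near_ballW; apply: open_nbhs_nbhs; split=> //; exact: ball_open.
apply: (@differentiable_quadratic R n _ z _ (2 * (C2 * n%:R ^+ 2)) d) => // h hd.
have Bhz : B (h + z).
  by apply: zB; rewrite -ball_normE /= opprD addrCA subrr addr0 normrN.
pose w k := b k (h + z) - b k z - \sum_j h ord0 j * pderive j (b k) z.
have wC k : `|w k| <= C2 * n%:R ^+ 2 * `|h| ^+ 2 * 2^-1 ^+ k.
  have -> : C2 * n%:R ^+ 2 * `|h| ^+ 2 * 2^-1 ^+ k =
            (C2 * 2^-1 ^+ k) * n%:R ^+ 2 * `|h| ^+ 2 by ring.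
  apply: (@taylor2 R n (b k) p r) => //.
  - by rewrite mulr_ge0// exprn_ge0// invr_ge0.
  - by move=> y By; exact: smooth_on_differentiable (sb k) By.
  - move=> y j By; apply: smooth_on_differentiable By; exact: pderive_smooth.
  - move=> y i j By; apply: le_trans ((HC (i, j)).2 k y By) _.
    by apply: ler_wpM2r; [rewrite exprn_ge0// invr_ge0|exact: C2C].
have := (geometric_domination wC).2.
suff -> : limn (series w) = ssum b (h + z) - ssum b z -
    \sum_j h ord0 j * ssum (fun k => pderive j (b k)) z by rewrite !mulrA.
apply: cvg_lim => //.
have -> : series w = fun M => series (fun k => b k (h + z)) M - series (fun k => b k z) M -
    \sum_j h ord0 j * series (fun k => pderive j (b k) z) M.
  apply/funext => M; rewrite /series /= /w !sumrB; congr (_ - _).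
  by rewrite exchange_big; apply: eq_bigr => j _; rewrite mulr_sumr.
apply: cvgB; first by apply: cvgB; exact: cvb.
by apply: cvg_sum_seq => j; apply: cvgMr; exact: cvd.
Qed.

Lemma ssum_smooth b : geometric_family b -> smooth_on B (ssum b).
Proof.
move=> gb; apply: (@smooth_coind _ _ _ _ (fun f => exists2 b, geometric_family b & f = ssum b)).
- exact: ball_open.
- by move=> _ [c gc ->] z Bz; exact: (ssum_differentiable gc Bz).1.
- move=> _ j [c gc ->]; exists (ssum (fun k => pderive j (c k))).
    by exists (fun k => pderive j (c k)) => //; exact: geometric_family_pderive.
  by move=> z Bz; exact: (ssum_differentiable gc Bz).2.
- by exists b.
Qed.

Lemma pderives_ssum b s z : geometric_family b -> B z ->
  pderives s (ssum b) z = ssum (fun k => pderives s (b k)) z.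
Proof.
move=> gb; have oB : open B by exact: ball_open.
elim: s z => [//|j s IH] z Bz /=.
have gs : geometric_family (fun k => pderives s (b k)).
  by elim: s {IH} => [//|i s IH] /=; exact: geometric_family_pderive.
by rewrite (pderive_ext _ oB IH)// (ssum_differentiable gs Bz).2.
Qed.

End Series.

(** * Hadamard's lemma *)

Section Hadamard.
Context {R : realType}.
Notation mu := (@lebesgue_measure R).

Definition squeeze (t : R) (z : 'rV[R]_2) := pt (z ord0 0) (t * z ord0 1).

Lemma squeeze_is_linear t : linear (squeeze t).
Proof. by move=> a x y; apply/rowP; apply: ord2_ind; rewrite !mxE//=; ring. Qed.

HB.instance Definition _ t :=
  GRing.isLinear.Build R 'rV[R]_2 'rV[R]_2 _ (squeeze t) (squeeze_is_linear t).

Lemma squeeze_continuous t : continuous (squeeze t).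
Proof.
have -> : squeeze t = fun z => z *m \matrix_(i, j) squeeze t (delta_mx 0 i) ord0 j.
    by apply/funext => z; apply/rowP; apply: ord2_ind; rewrite /squeeze ?pt0 ?pt1 mxE sum2E
    !mxE /= ?mxE /=; ring.
exact: mulmx_continuous.
Qed.

Lemma squeeze_ball (r t : R) z : 0 <= t <= 1 -> ball 0 r z -> ball 0 r (squeeze t z).
Proof.
move=> /andP[t0 t1] rz; have r0 : 0 < r.
  by move: rz; rewrite -ball_normE /=; apply: le_lt_trans.
move/(ball0_pt z r0): rz => [z0 z1]; apply/(ball0_pt _ r0); rewrite pt0 pt1; split=> //.
by apply: le_lt_trans z1; rewrite normrM ger0_norm// ler_piMl.
Qed.

Lemma squeeze0E (z : 'rV[R]_2) : squeeze 0 z = pt (z ord0 0) 0.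
Proof. by rewrite /squeeze mul0r. Qed.

Lemma ball_axis (r : R) (z : 'rV[R]_2) : ball 0 r z -> ball 0 r (pt (z ord0 0) 0).
Proof. by move=> rz; rewrite -squeeze0E; apply: squeeze_ball => //; rewrite lexx ler01. Qed.

Lemma squeeze_norm t z : 0 <= t <= 1 -> `|squeeze t z| <= `|z|.
Proof.
move=> /andP[t0 t1]; apply/rV_norm_leP => //; apply: ord2_ind; rewrite ?pt0 ?pt1.
  exact: rV_coord_le.
by rewrite normrM ger0_norm//; apply: le_trans (rV_coord_le z 1); rewrite ler_piMl.
Qed.

(** [moment m g] is the average of [t^m g(u, t v)] over [t] in [0, 1]; partial
    derivatives of such averages are again of this form. *)
Definition moment (m : nat) (g : 'rV[R]_2 -> R) (z : 'rV[R]_2) : R :=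
  \int[mu]_(t in `[0, 1]) (t ^+ m * g (squeeze t z)).

Definition continuous01 (f : R -> R) := forall t : R, 0 <= t <= 1 -> {for t, continuous f}.

Lemma continuous01_integrable (f : R -> R) :
  continuous01 f -> mu.-integrable `[0, 1] (EFin \o f).
Proof.
move=> cf; apply: continuous_compact_integrable; first exact: segment_compact.
by apply: continuous_in_subspaceT => t /set_mem /=; rewrite in_itv /=; exact: cf.
Qed.

Lemma squeeze_curve_differentiable z (t : R) : differentiable (fun t => squeeze t z) t.
Proof.
apply/differentiable_coordinates; apply: ord2_ind.
  rewrite (_ : (fun _ => _) = cst (z ord0 0)); first exact: differentiable_cst.
  by apply/funext => s; rewrite pt0.
rewrite (_ : (fun _ => _) = (fun s : R => s) * cst (z ord0 1)).
  by apply: differentiableM => //; exact: differentiable_cst.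
by apply/funext => s; rewrite pt1.
Qed.

Variable r : R.
Let B : set 'rV[R]_2 := ball (0 : 'rV[R]_2) r.

Lemma moment_integrand_continuous m (g : 'rV[R]_2 -> R) z :
  (forall z, B z -> {for z, continuous g}) -> B z ->
  continuous01 (fun t => t ^+ m * g (squeeze t z)).
Proof.
move=> cg Bz t t01; apply: continuousM; first exact: exprn_continuous.
apply: (@continuous_comp _ _ _ (fun t => squeeze t z) g).
  exact/differentiable_continuous/squeeze_curve_differentiable.
exact/cg/squeeze_ball.
Qed.

Lemma continuous01D f g : continuous01 f -> continuous01 g -> continuous01 (fun t => f t + g t).
Proof. by move=> cf cg t t01; apply: continuousD; [exact: cf|exact: cg]. Qed.

Lemma continuous01B f g : continuous01 f -> continuous01 g -> continuous01 (fun t => f t - g t).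
Proof. by move=> cf cg t t01; apply: continuousB; [exact: cf|exact: cg]. Qed.

Lemma continuous01Z (c : R) f : continuous01 f -> continuous01 (fun t => c * f t).
Proof. by move=> cf t t01; apply: continuousM; [exact: cst_continuous|exact: cf]. Qed.

Lemma integral01D f g : continuous01 f -> continuous01 g ->
  \int[mu]_(t in `[0, 1]) (f t + g t) =
  \int[mu]_(t in `[0, 1]) f t + \int[mu]_(t in `[0, 1]) g t.
Proof. by move=> cf cg; rewrite RintegralD//; exact: continuous01_integrable. Qed.

Lemma integral01B f g : continuous01 f -> continuous01 g ->
  \int[mu]_(t in `[0, 1]) (f t - g t) =
  \int[mu]_(t in `[0, 1]) f t - \int[mu]_(t in `[0, 1]) g t.
Proof. by move=> cf cg; rewrite RintegralB//; exact: continuous01_integrable. Qed.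

Lemma integral01Z (c : R) f : continuous01 f ->
  \int[mu]_(t in `[0, 1]) (c * f t) = c * \int[mu]_(t in `[0, 1]) f t.
Proof. by move=> cf; rewrite RintegralZl//; exact: continuous01_integrable. Qed.

Lemma norm_integral01_le (f : R -> R) (C : R) : continuous01 f ->
  (forall t, 0 <= t <= 1 -> `|f t| <= C) -> `|\int[mu]_(t in `[0, 1]) f t| <= C.
Proof.
move=> cf fC.
have If := continuous01_integrable cf.
have H : `|\int[mu]_(t in `[0, 1]) f t| <= \int[mu]_(t in `[0, 1]) `|f t|.
  exact: le_normr_Rintegral.
apply: le_trans H _.
have -> : C = \int[mu]_(t in `[0, 1]) C.
  have E : fine (mu (`[0, 1]%classic : set R)) = 1.
    by rewrite lebesgue_measure_itv /= lte_fin ltr01 oppr0 adde0.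
  by rewrite Rintegral_cst//= E mulr1.
apply: le_Rintegral => //.
- by apply: continuous01_integrable => t t01; apply: continuous_at_norm; exact: cf.
- by apply: continuous01_integrable => t _; exact: cst_continuous.
Qed.

Lemma moment_differentiable m g z : smooth_on B g -> B z ->
  [/\ differentiable (moment m g) z,
      pderive 0 (moment m g) z = moment m (pderive 0 g) z &
      pderive 1 (moment m g) z = moment m.+1 (pderive 1 g) z].
Proof.
move=> sg Bz.
have cg (f : 'rV[R]_2 -> R) : smooth_on B f -> forall z, B z -> {for z, continuous f}.
  by move=> sf y; exact: smooth_on_continuous.
have sd j : smooth_on B (pderive j g) by exact: pderive_smooth.
(* the Taylor estimate needs bounds on second derivatives, which hold on a smaller ball *)
pose r' := (`|z| + r) / 2; have nz : `|z| < r by move: Bz; rewrite /B -ball_normE /= sub0r normrN.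
have r'r : r' < r by rewrite /r'; lra.
have zr' : `|z| < r' by rewrite /r'; lra.
have /choice[C HC] : forall ij : 'I_2 * 'I_2, exists C : R, 0 <= C /\
    forall z, ball 0 r' z -> `|pderive ij.1 (pderive ij.2 g) z| <= C.
  move=> [i j]; have [|C C0 bC] := @bounded_on_ball R 2 (pderive i (pderive j g)) 0 r r' r'r.
    by apply: cg; do 2 apply: pderive_smooth.
  by exists C; split.
pose C2 := \sum_ij C ij.
have C2C ij : C ij <= C2.
  by rewrite /C2 (bigD1 ij)//= lerDl sumr_ge0// => kl _; case: (HC kl).
have C20 : 0 <= C2 by apply: sumr_ge0 => ij _; case: (HC ij).
have r'B : ball 0 r' `<=` B by apply: le_ball; exact: ltW.
pose a (j : 'I_2) := if j == 0 then moment m (pderive 0 g) z else moment m.+1 (pderive 1 g) z.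
suff [dm ma] : differentiable (moment m g) z /\ forall j, pderive j (moment m g) z = a j.
  by split=> //; rewrite ma.
apply: (@differentiable_quadratic R 2 _ z a (C2 * 2%:R ^+ 2) (r' - `|z|)); first by lra.
move=> h hd; have Bhz' : ball 0 r' (h + z).
  by rewrite -ball_normE /= sub0r normrN; have := ler_normD h z; lra.
have Bz' : ball 0 r' z by rewrite -ball_normE /= sub0r normrN.
have Bhz := r'B _ Bhz'.
rewrite sum2E /a /=.
have mc k f y (sf : smooth_on B f) (By : B y) := @moment_integrand_continuous k f y (cg f sf) By.
have c1 := mc m _ _ sg Bhz; have c2 := mc m _ _ sg Bz.
have c3 := continuous01Z (c := h ord0 0) (mc m _ _ (sd 0) Bz).
have c4 := continuous01Z (c := h ord0 1) (mc m.+1 _ _ (sd 1) Bz).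
have -> : moment m g (h + z) - moment m g z -
   (h ord0 0 * moment m (pderive 0 g) z + h ord0 1 * moment m.+1 (pderive 1 g) z) =
   \int[mu]_(t in `[0, 1]) (t ^+ m * g (squeeze t (h + z)) - t ^+ m * g (squeeze t z) -
    (h ord0 0 * (t ^+ m * pderive 0 g (squeeze t z)) +
     h ord0 1 * (t ^+ m.+1 * pderive 1 g (squeeze t z)))).
  rewrite (integral01B (continuous01B c1 c2) (continuous01D c3 c4)) (integral01B c1 c2).
  by rewrite (integral01D c3 c4) (integral01Z _ (mc m _ _ (sd 0) Bz)) (integral01Z _ (mc m.+1 _ _ (sd 1) Bz)).
apply: norm_integral01_le => [|t t01].
  exact: continuous01B (continuous01B c1 c2) (continuous01D c3 c4).
have [t0 t1] := andP t01.
rewrite -mulrBr.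
have -> : h ord0 0 * (t ^+ m * pderive 0 g (squeeze t z)) +
     h ord0 1 * (t ^+ m.+1 * pderive 1 g (squeeze t z)) =
   t ^+ m * \sum_j (squeeze t h) ord0 j * pderive j g (squeeze t z).
  by rewrite sum2E pt0 pt1 exprS; ring.
rewrite -mulrBr linearD normrM.
have tm : `|t ^+ m| <= 1 by rewrite normrX ger0_norm// exprn_ile1.
apply: (@le_trans _ _ (1 * (C2 * 2 ^+ 2 * `|squeeze t h| ^+ 2))); last first.
  rewrite mul1r; apply: ler_wpM2l; first by rewrite mulr_ge0// exprn_ge0.
  by apply: lerXn2r; rewrite ?nnegrE// squeeze_norm.
apply: (ler_pM (normr_ge0 _) (normr_ge0 _) tm); apply: (@taylor2 R 2 g 0 r' _ C20).
- by move=> y /r'B; exact: smooth_on_differentiable.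
- by move=> y j /r'B; exact: smooth_on_differentiable.
- by move=> y i j By; apply: le_trans ((HC (i, j)).2 y By) (C2C _).
- exact: squeeze_ball.
- by rewrite -linearD; exact: squeeze_ball.
Qed.

Lemma moment_smooth m g : smooth_on B g -> smooth_on B (moment m g).
Proof.
move=> sg; apply: (@smooth_coind _ _ _ _
  (fun f => exists m g, smooth_on B g /\ f = moment m g)); last by exists m, g.
- exact: ball_open.
- by move=> _ [k [f [sf ->]]] z Bz; case: (moment_differentiable k sf Bz).
- move=> _ j [k [f [sf ->]]]; move: j; apply: ord2_ind.
    exists (moment k (pderive 0 f)); last by move=> z Bz; case: (moment_differentiable k sf Bz).
    by exists k, (pderive 0 f); split=> //; exact: pderive_smooth.
  exists (moment k.+1 (pderive 1 f)); last by move=> z Bz; case: (moment_differentiable k sf Bz).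
  by exists k.+1, (pderive 1 f); split=> //; exact: pderive_smooth.
Qed.

Lemma derive_squeeze_curve g z (t : R) : differentiable g (squeeze t z) ->
  is_derive t 1 (fun t => g (squeeze t z)) (z ord0 1 * pderive 1 g (squeeze t z)).
Proof.
move=> dg; have dc := squeeze_curve_differentiable z t.
apply: DeriveDef; first exact/diff_derivable/(differentiable_comp dc dg).
rewrite (derive_comp _ dc dg).
suff -> : 'D_1 (fun t => squeeze t z) t = z ord0 1 *: delta_mx 0 1.
  by rewrite derive_scale_dir.
apply/rowP => j; rewrite -derive_coordinates//; move: j; apply: ord2_ind.
  rewrite (_ : (fun _ => _) = cst (z ord0 0)); last by apply/funext => s; rewrite pt0.
  by rewrite derive_cst !mxE /= mulr0.
rewrite (_ : (fun _ => _) = (fun s : R => s) * cst (z ord0 1)); last first.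
  by apply/funext => s; rewrite pt1.
rewrite deriveM// derive_cst derive_id !mxE /= mulr1 scaler0 add0r.
by rewrite /GRing.scale /= mulr1.
Qed.

(** [g(u, v)] is the integral of [v g_v(u, t v)] over [t] in [0, 1]. *)
Theorem hadamard g : smooth_on B g -> (forall z, B z -> g (pt (z ord0 0) 0) = 0) ->
  exists2 k, smooth_on B k & forall z, B z -> g z = z ord0 1 * k z.
Proof.
move=> sg g0; exists (moment 0 (pderive 1 g)); first by apply: moment_smooth; exact: pderive_smooth.
move=> z Bz; have sd : smooth_on B (pderive 1 g) by exact: pderive_smooth.
have cm : continuous01 (fun t => t ^+ 0 * pderive 1 g (squeeze t z)).
  by apply: moment_integrand_continuous => // y; exact: smooth_on_continuous.
rewrite /moment -(integral01Z _ cm).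
have F (t : R) : 0 <= t <= 1 -> is_derive t 1 (fun t => g (squeeze t z))
    (z ord0 1 * pderive 1 g (squeeze t z)).
  by move=> t01; apply: derive_squeeze_curve; apply: (smooth_on_differentiable sg); exact: squeeze_ball.
rewrite /Rintegral (@continuous_FTC2 R _ (fun t => g (squeeze t z)) 0 1 ltr01).
- rewrite -EFinB /=; have -> : squeeze 1 z = z by rewrite /squeeze mul1r -ptE.
  by rewrite /squeeze mul0r g0// subr0.
- have cz := continuous01Z (c := z ord0 1) cm.
  by apply: continuous_in_subspaceT => t /set_mem /=; rewrite in_itv /= => t01; exact: cz.
- have cF (t : R) : 0 <= t <= 1 -> {for t, continuous (fun t => g (squeeze t z))}.
    by move=> /F[dF _]; apply/differentiable_continuous/derivable1_diffP.
  split; first by move=> t; rewrite in_itv /= => /andP[/ltW t0 /ltW t1]; case: (F t (introT andP (conj t0 t1))).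
    by apply: cvg_at_right_filter; apply: cF; rewrite lexx ler01.
  by apply: cvg_at_left_filter; apply: cF; rewrite lexx ler01.
- move=> t; rewrite in_itv /= => /andP[/ltW t0 /ltW t1].
  by rewrite derive1E; have [_ ->] := F t (introT andP (conj t0 t1)); rewrite expr0 mul1r.
Qed.

End Hadamard.

(** * Borel's lemma with a parameter *)

Section Trigonometric.
Context {R : realType}.

(** A class of bounded functions stable under differentiation that contains the
    [sin (t v) ^ k / t ^ k]. These replace the monomials [v ^ k] multiplied by cutoff functions
    in the usual proof of Borel's lemma. *)
Inductive trig_poly : (R -> R) -> Prop :=
| trig_cst c : trig_poly (fun=> c)
| trig_sin : trig_poly sin
| trig_cos : trig_poly cos
| trig_add f g : trig_poly f -> trig_poly g -> trig_poly (fun x => f x + g x)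
| trig_mul f g : trig_poly f -> trig_poly g -> trig_poly (fun x => f x * g x)
| trig_dilate f t : trig_poly f -> trig_poly (fun x => f (t * x)).

Lemma derive1_dilate (f : R -> R) (t x : R) : derivable f (t * x) 1 ->
  derivable (fun x => f (t * x)) x 1 /\
  derive1 (fun x => f (t * x)) x = t * derive1 f (t * x).
Proof.
move=> df; have dl : derivable ( *%R t) x 1 by apply/derivable1_diffP.
have Dl : derive1 ( *%R t) x = t.
  by rewrite derive1E (deriveMl _ (@derivable_id _ _ _ _)) derive_id mulr1.
split; last by rewrite -[LHS]/(derive1 (f \o *%R t) x) (derive1_comp dl df) Dl mulrC.
move: dl df => /derivable1_diffP dl /derivable1_diffP df; apply/derivable1_diffP.
exact: differentiable_comp dl df.
Qed.

Lemma trig_bounded f : trig_poly f -> exists2 C, 0 <= C & forall x, `|f x| <= C.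
Proof.
elim=> [c|||g h _ [C C0 gC] _ [D D0 hD]|g h _ [C C0 gC] _ [D D0 hD]|g t _ [C C0 gC]].
- by exists `|c|.
- by exists 1 => // x; rewrite ler_norml sin_geN1 sin_le1.
- by exists 1 => // x; rewrite ler_norml cos_geN1 cos_le1.
- exists (C + D); first exact: addr_ge0.
  by move=> x; apply: le_trans (ler_normD _ _) _; exact: lerD.
- exists (C * D); first exact: mulr_ge0.
  by move=> x; rewrite normrM; apply: ler_pM.
- by exists C.
Qed.

Lemma trig_derive f : trig_poly f ->
  (forall x, derivable f x 1) /\ trig_poly (derive1 f).
Proof.
elim=> [c|||g h tg [dg Dg] th [dh Dh]|g h tg [dg Dg] th [dh Dh]|g t tg [dg Dg]].
- split=> [x|]; first exact: derivable_cst.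
  rewrite (_ : derive1 _ = fun=> 0); first exact: trig_cst.
  by apply/funext => x; rewrite derive1_cst.
- split=> [x|]; first by case: (is_derive_sin x).
  rewrite (_ : derive1 _ = cos); first exact: trig_cos.
  by apply/funext => x; rewrite derive1E; case: (is_derive_sin x).
- split=> [x|]; first by case: (is_derive_cos x).
  rewrite (_ : derive1 _ = fun x => (-1) * sin x).
    by apply: trig_mul; [exact: trig_cst|exact: trig_sin].
  by apply/funext => x; rewrite derive1E mulN1r; case: (is_derive_cos x).
- split=> [x|]; first exact: derivableD.
  rewrite (_ : derive1 _ = fun x => derive1 g x + derive1 h x); first exact: trig_add.
  by apply/funext => x; rewrite !derive1E deriveD.
- split=> [x|]; first exact: derivableM.
  rewrite (_ : derive1 _ = fun x => g x * derive1 h x + h x * derive1 g x).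
    by apply: trig_add; exact: trig_mul.
  by apply/funext => x; rewrite !derive1E deriveM.
- split=> [x|]; first by case: (derive1_dilate (dg (t * x))).
  rewrite (_ : derive1 _ = fun x => t * derive1 g (t * x)).
    by apply: trig_mul; [exact: trig_cst|exact: trig_dilate].
  by apply/funext => x; case: (derive1_dilate (dg (t * x))).
Qed.

Lemma trig_derive1n f q : trig_poly f -> trig_poly (derive1n q f).
Proof. by move=> tf; elim: q => [//|q IH]; rewrite derive1nS; exact: (trig_derive IH).2. Qed.

Lemma trig_exp f k : trig_poly f -> trig_poly (fun x => f x ^+ k).
Proof.
move=> tf; elim: k => [|k IH]; first exact: trig_cst.
rewrite (_ : (fun _ => _) = fun x => f x * f x ^+ k); first exact: trig_mul.
by apply/funext => x; rewrite exprS.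
Qed.

Lemma trig_smooth f : trig_poly f -> smooth_on setT f.
Proof.
move=> tf; apply: (@smooth_coind1 _ _ _ trig_poly) => //; first exact: openT.
  by move=> g tg x _; exact: (trig_derive tg).1.
by move=> g tg; exists (derive1 g) => //; exact: (trig_derive tg).2.
Qed.

Lemma derive1n_sin_exp k q : (q <= k)%N -> exists F, [/\ trig_poly F,
  derive1n q (fun x : R => sin x ^+ k) = (fun x => F x * sin x ^+ (k - q)) &
  F 0 = (k ^_ q)%:R].
Proof.
elim: q => [_|q IH qk].
  exists (fun=> 1); split; first exact: trig_cst.
    by apply/funext => x; rewrite derive1n0 subn0 mul1r.
  by rewrite ffactn0.
have [F [tF DF F0]] := IH (ltnW qk); have [dF tF'] := trig_derive tF.
exists (fun x => derive1 F x * sin x + (k - q)%:R * (F x * cos x)); split.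
- apply: trig_add; first by apply: trig_mul => //; exact: trig_sin.
  apply: trig_mul; first exact: trig_cst.
  by apply: trig_mul => //; exact: trig_cos.
- rewrite derive1nS DF; apply/funext => x.
  have ds : derivable (sin : R -> R) x 1 by case: (is_derive_sin x).
  have Ds : 'D_1 (sin : R -> R) x = cos x by case: (is_derive_sin x).
  have -> : (fun x => F x * sin x ^+ (k - q)) = F * (sin : R -> R) ^+ (k - q).
    by apply/funext => y; rewrite /= mulrfctE exprfctE.
  have dsk : derivable ((sin : R -> R) ^+ (k - q)) x 1 by exact: derivableX.
  rewrite derive1E (deriveM (dF x) dsk) (deriveX _ ds) Ds -derive1E.
  have -> : (k - q = (k - q.+1).+1)%N by lia.
  by rewrite exprfctE /GRing.scale /= exprS; ring.
- by rewrite sin0 cos0 mulr0 add0r mulr1 F0 -natrM ffactnSr mulnC.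
Qed.

Lemma derive1n_dilate f (t : R) q : trig_poly f ->
  derive1n q (fun x => f (t * x)) = fun x => t ^+ q * derive1n q f (t * x).
Proof.
move=> tf; elim: q => [|q IH]; first by apply/funext => x; rewrite !derive1n0 mul1r.
rewrite derive1nS IH; apply/funext => x.
have [dc Dc] := derive1_dilate ((trig_derive (trig_derive1n q tf)).1 (t * x)).
by rewrite (derive1Ml _ dc) Dc -derive1nS mulrA exprSr.
Qed.

Lemma derive1n_scale f (c : R) q : trig_poly f ->
  derive1n q (fun x => c * f x) = fun x => c * derive1n q f x.
Proof.
move=> tf; elim: q => [|q IH]; first by [].
rewrite derive1nS IH; apply/funext => x.
by rewrite (derive1Ml _ ((trig_derive (trig_derive1n q tf)).1 x)) derive1nS.
Qed.

End Trigonometric.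

Section Borel.
Context {R : realType} (r r' : R).
Hypotheses (r'0 : 0 < r') (rr : r' < r).
Notation B := (ball (0 : 'rV[R]_2) r).
Notation B' := (ball (0 : 'rV[R]_2) r').

Definition tensor (c : 'rV[R]_2 -> R) (tau : R -> R) (z : 'rV[R]_2) :=
  c (squeeze 0 z) * tau (z ord0 1).

Lemma squeeze0_ball (a : R) z : ball 0 a z -> ball 0 a (squeeze 0 z).
Proof. by rewrite squeeze0E; exact: ball_axis. Qed.

Lemma squeeze0K z : squeeze 0 (squeeze 0 z) = squeeze 0 z :> 'rV[R]_2.
Proof. by rewrite /squeeze pt0 pt1 !mul0r. Qed.

Lemma pderive_squeeze (c : 'rV[R]_2 -> R) t z : differentiable c (squeeze t z) ->
  [/\ differentiable (c \o squeeze t) z,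
      pderive 0 (c \o squeeze t) z = pderive 0 c (squeeze t z) &
      pderive 1 (c \o squeeze t) z = t * pderive 1 c (squeeze t z)].
Proof.
move=> dc; have ds : differentiable (squeeze t) z.
  by apply: linear_differentiable; exact: squeeze_continuous.
split; first exact: differentiable_comp.
  rewrite /pderive (derive_comp _ ds dc) derive_linear; last exact: squeeze_continuous.
  by congr ('D__ c _); apply/rowP; apply: ord2_ind; rewrite !mxE //= mulr0.
rewrite /pderive (derive_comp _ ds dc) derive_linear; last exact: squeeze_continuous.
rewrite -[t * _]/(t *: _) -(derive_scale_dir _ _ dc); congr ('D__ c _).
by apply/rowP; apply: ord2_ind; rewrite !mxE //= mulr0.
Qed.

Lemma pderive_coord1 (tau : R -> R) (z : 'rV[R]_2) : derivable tau (z ord0 1) 1 ->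
  [/\ differentiable (fun z : 'rV[R]_2 => tau (z ord0 1)) z,
      pderive 0 (fun z : 'rV[R]_2 => tau (z ord0 1)) z = 0 &
      pderive 1 (fun z : 'rV[R]_2 => tau (z ord0 1)) z = derive1 tau (z ord0 1)].
Proof.
move=> /derivable1_diffP dt; have dc : differentiable (coord 1 : 'rV[R]_2 -> R) z.
  by apply: linear_differentiable; exact: coord_continuous'.
have E v : 'D_v (tau \o coord 1) z = v ord0 1 * derive1 tau (z ord0 1).
  rewrite (derive_comp _ dc dt) derive_linear; last exact: coord_continuous'.
  by rewrite derive_derive1.
split; first exact: (differentiable_comp dc dt).
  by rewrite /pderive [LHS]E mxE /= mul0r.
by rewrite /pderive [LHS]E mxE /= mul1r.
Qed.

Lemma tensor_derive c (tau : R -> R) z : smooth_on B c -> (forall x, derivable tau x 1) -> B z ->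
  pderive 0 (tensor c tau) z = tensor (pderive 0 c) tau z /\
  pderive 1 (tensor c tau) z = tensor c (derive1 tau) z.
Proof.
move=> sc dt Bz; have dc : differentiable c (squeeze 0 z).
  by apply: (smooth_on_differentiable sc); exact: squeeze0_ball.
have [d1 D10 D11] := pderive_squeeze dc; have [d2 D20 D21] := pderive_coord1 (dt (z ord0 1)).
have -> : tensor c tau = (c \o squeeze 0) * (fun z : 'rV[R]_2 => tau (z ord0 1)) by [].
have E v := @deriveM R _ (c \o squeeze 0) (fun z : 'rV[R]_2 => tau (z ord0 1)) z v
  (diff_derivable d1) (diff_derivable d2).
split; rewrite /pderive E; rewrite -!/(pderive _ _ _).
  by rewrite D10 D20 /tensor /GRing.scale /= mulr0 add0r mulrC.
by rewrite D11 D21 /tensor /GRing.scale /= mul0r mulr0 addr0.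
Qed.

Lemma tensor_smooth c tau : smooth_on B c -> smooth_on setT tau -> smooth_on B (tensor c tau).
Proof.
move=> sc st; have oB : open B by exact: ball_open.
apply: smooth_onM => //.
  apply: (@smooth_on_comp_real _ _ _ _ B (squeeze 0) c) => //; first exact: squeeze0_ball.
  by move=> k; apply: Ck_linear; exact: squeeze_continuous.
apply: (@smooth_on_comp1 _ _ _ setT (fun z : 'rV[R]_2 => z ord0 1) tau) => //; first exact: openT.
exact: smooth_on_coord.
Qed.

Lemma pderives_tensor s c tau : smooth_on B c -> trig_poly tau -> forall z, B z ->
  pderives s (tensor c tau) z =
  tensor (iter (count_mem 0 s) (pderive 0) c) (derive1n (count_mem 1 s) tau) z.
Proof.
move=> sc tt; have oB : open B by exact: ball_open.
have si p : smooth_on B (iter p (pderive 0) c) by elim: p => [//|p IH]; exact: pderive_smooth.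
elim: s => [//|j s IH] z Bz /=; rewrite (pderive_ext _ oB IH)//.
have [T0 T1] := tensor_derive (si (count_mem 0 s))
  (trig_derive (trig_derive1n (count_mem 1 s) tt)).1 Bz.
move: j; apply: ord2_ind.
  by rewrite T0 eqxx add1n (_ : (0 == 1 :> 'I_2) = false).
by rewrite T1 eqxx add1n (_ : (1 == 0 :> 'I_2) = false)// derive1nS.
Qed.

(** The [k]-th term of the series: the dilation factor [t] in [sin (t v) ^ k / t ^ k]
    makes all derivatives of order less than [k] as small as we like. *)
Lemma borel_term k c : smooth_on B c -> exists b, [/\ smooth_on B b,
  forall s z, (size s < k)%N -> B' z -> `|pderives s b z| <= 2^-1 ^+ k,
  forall j z, (j < k)%N -> B z -> pderives (nseq j 1) b (squeeze 0 z) = 0 &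
  forall z, B z -> pderives (nseq k 1) b (squeeze 0 z) = c (squeeze 0 z)].
Proof.
move=> sc; have oB : open B by exact: ball_open.
have tsk : trig_poly (fun x : R => sin x ^+ k) by apply: trig_exp; exact: trig_sin.
have /choice[M HM] p : exists M : R, 0 <= M /\ forall z, B' z -> `|iter p (pderive 0) c z| <= M.
  have [|M M0 bM] := @bounded_on_ball R 2 (iter p (pderive 0) c) 0 r r' rr; last by exists M.
  move=> z; apply: smooth_on_continuous; elim: p => [//|p IH]; exact: pderive_smooth.
have /choice[T HT] q : exists C : R, 0 <= C /\ forall x,
    `|derive1n q (fun x : R => sin x ^+ k) x| <= C.
  by have [C C0 bC] := trig_bounded (trig_derive1n q tsk); exists C.
pose K := \sum_(p < k) \sum_(q < k) M p * T q.
have K0 : 0 <= K.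
  apply: sumr_ge0 => p _; apply: sumr_ge0 => q _; apply: mulr_ge0.
    by case: (HM p).
  by case: (HT q).
have KMT p q : (p < k)%N -> (q < k)%N -> M p * T q <= K.
  move=> pk qk; rewrite /K (bigD1 (Ordinal pk))//= (bigD1 (Ordinal qk))//= -addrA lerDl.
  have MT a b : 0 <= M a * T b by apply: mulr_ge0; [case: (HM a)|case: (HT b)].
  by apply: addr_ge0; do ?[apply: sumr_ge0 => ? _].
pose t : R := 1 + 2 ^+ k * K.
have t1 : 1 <= t by rewrite lerDl mulr_ge0// exprn_ge0.
have t0 : 0 < t by apply: lt_le_trans t1.
pose a : R := (t ^+ k * k`!%:R)^-1.
have kf0 : 0 < k`!%:R :> R by rewrite ltr0n fact_gt0.
pose tau x := a * (fun x => sin (t * x) ^+ k) x.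
have ttk : trig_poly (fun x => sin (t * x) ^+ k) by exact: (trig_dilate t tsk).
have tt : trig_poly tau by apply: trig_mul => //; exact: trig_cst.
have tauE q x : derive1n q tau x = a * (t ^+ q * derive1n q (fun x : R => sin x ^+ k) (t * x)).
  by rewrite derive1n_scale// (derive1n_dilate t q tsk).
have tau0 q : (q <= k)%N -> derive1n q tau 0 = (q == k)%:R.
  move=> qk; have [F [_ DF F0]] := @derive1n_sin_exp R k q qk.
  rewrite tauE mulr0 DF sin0 F0 expr0n subn_eq0 eqn_leq qk /=.
  case: leqP => [kq|_]; last by rewrite mulr0n !mulr0.
  have -> : q = k by apply/eqP; rewrite eqn_leq qk.
  rewrite ffactnn mulr1n mulr1 /a mulVf// mulf_neq0// gt_eqF// exprn_gt0//.
have val0 q z : (q <= k)%N -> B z ->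
    pderives (nseq q 1) (tensor c tau) (squeeze 0 z) = c (squeeze 0 z) *+ (q == k).
  move=> qk Bz; rewrite pderives_tensor//; last exact: squeeze0_ball.
  have -> : count_mem (0 : 'I_2) (nseq q 1) = 0%N by rewrite count_nseq.
  have -> : count_mem (1 : 'I_2) (nseq q 1) = q by rewrite count_nseq /= mul1n.
  rewrite /tensor squeeze0K pt1 mul0r tau0//.
  by rewrite mulr_natr.
exists (tensor c tau); split.
- by apply: tensor_smooth => //; exact: trig_smooth.
- move=> s z sk B'z; have Bz : B z by apply: le_ball B'z; exact: ltW.
  rewrite pderives_tensor// /tensor normrM.
  set p := count_mem 0 s; set q := count_mem 1 s.
  have pk : (p < k)%N by apply: leq_ltn_trans sk; exact: count_size.
  have qk : (q < k)%N by apply: leq_ltn_trans sk; exact: count_size.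
  have [M0 bM] := HM p; have [T0 bT] := HT q.
  have [a0 a1] : 0 <= a /\ a * t ^+ q <= t^-1.
    split; first by rewrite invr_ge0 mulr_ge0 ?exprn_ge0// ltW.
    rewrite /a mulrC ler_pdivrMr ?mulr_gt0 ?exprn_gt0//.
    have -> : t ^+ k = t ^+ q * (t * t ^+ (k - q.+1)).
      by rewrite -exprS -exprD; congr (_ ^+ _); lia.
    have -> : t^-1 * (t ^+ q * (t * t ^+ (k - q.+1)) * k`!%:R) =
              t ^+ q * (t ^+ (k - q.+1) * k`!%:R) by field; rewrite gt_eqF.
    apply: ler_peMr; first by rewrite exprn_ge0// ltW.
    apply: mulr_ege1; first exact: exprn_ege1.
    by rewrite -[1]/(1%:R) ler_nat fact_gt0.
  have h1 := bM _ (squeeze0_ball B'z).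
  have h2 : `|derive1n q tau (z ord0 1)| <= t^-1 * T q.
    rewrite tauE mulrA normrM (@ger0_norm _ (a * t ^+ q)); last by rewrite mulr_ge0// exprn_ge0// ltW.
    by apply: ler_pM => //; rewrite mulr_ge0// exprn_ge0// ltW.
  apply: le_trans (ler_pM _ _ h1 h2) _ => //.
  have -> : M p * (t^-1 * T q) = (M p * T q) / t by rewrite mulrCA mulrC.
  rewrite ler_pdivrMr//; apply: le_trans (KMT p q pk qk) _.
  rewrite /t mulrDr mulr1 mulrA -exprMn mulVf// expr1n mul1r lerDr exprn_ge0// invr_ge0//.
- by move=> j z jk Bz; rewrite val0 ?(ltnW jk)// ltn_eqF.
- by move=> z Bz; rewrite val0// eqxx.
Qed.

Lemma pderives_cst0 s (z : 'rV[R]_2) : pderives s (fun=> 0 : R) z = 0.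
Proof.
suff -> : pderives s (fun=> 0 : R) = fun=> 0 by [].
elim: s => [//|j s IH] /=; rewrite IH; apply/funext => y; exact: derive_cst.
Qed.

Lemma pderivesD (A : set 'rV[R]_2) s f g z : open A -> smooth_on A f -> smooth_on A g ->
  A z -> pderives s (fun z => f z + g z) z = pderives s f z + pderives s g z.
Proof.
move=> oA sf sg; elim: s z => [//|j s IH] z Az /=.
rewrite (pderive_ext _ oA IH)// [LHS]deriveD//; apply: diff_derivable.
  by apply: smooth_on_differentiable Az; exact: pderives_smooth.
by apply: smooth_on_differentiable Az; exact: pderives_smooth.
Qed.

(** The terms are chosen one after the other: the [k]-th one corrects the [k]-th derivative on
    the axis and leaves the lower ones unchanged. *)
Theorem borel (a : nat -> 'rV[R]_2 -> R) : (forall k, smooth_on B (a k)) ->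
  exists2 e, smooth_on B' e &
    forall k z, B' z -> iter k (pderive 1) e (squeeze 0 z) = a k (squeeze 0 z).
Proof.
move=> sa; have B'B z : B' z -> B z by apply: le_ball; exact: ltW.
have /choice[st HS] : forall kS : nat * ('rV[R]_2 -> R), exists b, smooth_on B kS.2 ->
   [/\ smooth_on B b,
  forall s z, (size s < kS.1)%N -> B' z -> `|pderives s b z| <= 2^-1 ^+ kS.1,
  forall j z, (j < kS.1)%N -> B z -> pderives (nseq j 1) b (squeeze 0 z) = 0 &
  forall z, B z -> pderives (nseq kS.1 1) b (squeeze 0 z) =
    a kS.1 (squeeze 0 z) - pderives (nseq kS.1 1) kS.2 (squeeze 0 z)].
  move=> [k S] /=; have [sS|nS] := pselect (smooth_on B S); last by exists (fun=> 0).
  have [|b Hb] := @borel_term k (fun z => a k z - pderives (nseq k 1) S z); last by exists b.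
  by apply: smooth_onB; [exact: ball_open|exact: sa|exact: pderives_smooth].
pose S := fix S k := if k is k'.+1 then fun z => S k' z + st (k', S k') z else fun=> 0.
pose b k := st (k, S k).
have sS k : smooth_on B (S k).
  elim: k => [|k IH] /=; first exact: smooth_on_cst.
  by apply: smooth_onD => //; [exact: ball_open|case: (HS (k, S k) IH)].
have Hb k := HS (k, S k) (sS k).
have SE k z : S k z = \sum_(i < k) b i z.
  by elim: k => [|k IH]; [rewrite big_ord0|rewrite big_ord_recr /= IH].
have gb : geometric_family 0 r' b.
  split=> [k|s]; first by case: (Hb k) => sb _ _ _; exact: smooth_on_subset sb.
  have /choice[C HC] k : exists C : R, 0 <= C /\ forall z, B' z -> `|pderives s (b k) z| <= C.
    have [|C C0 bC] := @bounded_on_ball R 2 (pderives s (b k)) 0 r r' rr; last by exists C.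
    by move=> z; apply: smooth_on_continuous; apply: pderives_smooth; case: (Hb k).
  pose D := 1 + \sum_(k < (size s).+1) 2 ^+ k * C k.
  have D0 : 0 <= \sum_(k < (size s).+1) 2 ^+ k * C k.
    by apply: sumr_ge0 => k _; rewrite mulr_ge0 ?exprn_ge0//; case: (HC k).
  exists D => [|k z Bz]; first by rewrite addr_ge0.
  have p0 : 0 <= (2^-1 : R) ^+ k by rewrite exprn_ge0// invr_ge0.
  have [sk|ks] := ltnP (size s) k.
    have [_ bk _ _] := Hb k; apply: le_trans (bk s z sk Bz) _.
    by rewrite ler_peMl// lerDl.
  apply: le_trans ((HC k).2 z Bz) _.
  apply: (@le_trans _ _ (2 ^+ k * C k * 2^-1 ^+ k)).
    by rewrite mulrAC -exprMn mulfV// expr1n mul1r.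
  apply: ler_wpM2r => //; rewrite /D (bigD1 (Ordinal (ks : (k < (size s).+1)%N)))//= addrCA lerDl.
  by rewrite addr_ge0//; apply: sumr_ge0 => i _; rewrite mulr_ge0 ?exprn_ge0//; case: (HC i).
exists (ssum b); first exact: ssum_smooth.
move=> k z B'z; have Bz := B'B _ B'z; have Bz0 := squeeze0_ball Bz.
have E (f : 'rV[R]_2 -> R) : iter k (pderive 1) f = pderives (nseq k 1) f.
  by elim: (k) => [//|m IH] /=; rewrite IH.
rewrite E (pderives_ssum _ gb (squeeze0_ball B'z)).
rewrite /ssum; set u := fun i => _.
have uk i : (k < i)%N -> u i = 0 by move=> ki; case: (Hb i) => _ _ + _; apply.
have -> : limn (series u) = series u k.+1.
  apply: lim_near_cst => //; exists k.+1 => // M /= kM.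
  rewrite -(subnKC kM); elim: (M - k.+1)%N => [|d IH]; first by rewrite addn0.
  by rewrite addnS seriesSr IH uk ?addr0// leq_addr.
rewrite /series /= big_nat_recr//=.
have H m : \sum_(0 <= i < m) u i = pderives (nseq k 1) (S m) (squeeze 0 z).
  elim: m => [|m IH]; first by rewrite big_nil pderives_cst0.
  rewrite big_nat_recr//= IH (pderivesD _ _ (sS m) _ Bz0)//; first exact: ball_open.
  by case: (Hb m).
rewrite H.
by rewrite /u; case: (Hb k) => _ _ _ ->//=; rewrite addrC subrK.
Qed.

End Borel.

(** * Whitney's theorem on even functions *)

Section Whitney.
Context {R : realType}.
Implicit Types (f g : 'rV[R]_2 -> R) (r : R) (z : 'rV[R]_2).
Local Notation B r := (ball (0 : 'rV[R]_2) r).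

Lemma derive_coord n (x v : 'rV[R]_n) j : 'D_v (fun z : 'rV[R]_n => z ord0 j) x = v ord0 j.
Proof. exact: (derive_linear _ _ (@coord_continuous' R n j)). Qed.

Lemma pderive_mul_coord1 f z : differentiable f z ->
  pderive 1 (fun z : 'rV[R]_2 => z ord0 1 * f z) z = f z + z ord0 1 * pderive 1 f z.
Proof.
move=> df; have dc : differentiable (fun z : 'rV[R]_2 => z ord0 1) z by exact: differentiable_coord.
rewrite /pderive [LHS](deriveM (diff_derivable dc) (diff_derivable df)) derive_coord addrC.
by rewrite !mxE /GRing.scale /= mulr1.
Qed.

(** On the axis [v = 0] both functions are the derivatives of their products by [v]. *)
Lemma coord1_cancel (A : set 'rV[R]_2) f g : open A -> smooth_on A f -> smooth_on A g ->
  (forall z, A z -> z ord0 1 * f z = z ord0 1 * g z) -> forall z, A z -> f z = g z.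
Proof.
move=> oA sf sg fg z Az; have [z1|z1] := eqVneq (z ord0 1) 0; last exact: (mulfI z1 (fg z Az)).
have := pderive_ext 1 oA fg Az.
rewrite !pderive_mul_coord1 ?z1 ?mul0r ?addr0//.
  exact: smooth_on_differentiable sg Az.
exact: smooth_on_differentiable sf Az.
Qed.

Definition flip z : 'rV[R]_2 := squeeze (-1) z.
Definition fold z : 'rV[R]_2 := pt (z ord0 0) (z ord0 1 ^+ 2).

Lemma ball_pos (V : normedModType R) r (z : V) : ball 0 r z -> 0 < r.
Proof. by rewrite -ball_normE /=; apply: le_lt_trans. Qed.

Lemma flip_ball r z : B r z -> B r (flip z).
Proof.
move=> rz; have r0 := ball_pos rz; move: rz => /(ball0_pt _ r0)[z0 z1].
by apply/(ball0_pt _ r0); rewrite /flip pt0 pt1 mulN1r normrN.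
Qed.

Lemma flipK z : flip (flip z) = z.
Proof. by rewrite /flip /squeeze pt0 pt1 mulrA mulrNN !mul1r -ptE. Qed.

Lemma flip_squeeze0 z : flip (squeeze 0 z) = squeeze 0 z.
Proof. by rewrite /flip /squeeze pt0 pt1 !mul0r mulr0. Qed.

Lemma flip_axis z : z ord0 1 = 0 -> flip z = z.
Proof. by move=> z1; rewrite {2}[z]ptE /flip /squeeze z1 mulr0. Qed.

Lemma squeeze0_axis z : z ord0 1 = 0 -> squeeze 0 z = z.
Proof. by move=> z1; rewrite {2}[z]ptE /squeeze z1 mulr0. Qed.

Lemma fold_ball r z : r <= 1 -> B r z -> B r (fold z).
Proof.
move=> r1 rz; have r0 := ball_pos rz; move: rz => /(ball0_pt _ r0)[z0 z1].
apply/(ball0_pt _ r0); rewrite /fold pt0 pt1; split=> //.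
by rewrite normrX expr2; apply: le_lt_trans (z1); rewrite ler_piMl//; apply/ltW/(lt_le_trans z1).
Qed.

Lemma pderive_flip g r z : smooth_on (B r) g -> B r z ->
  pderive 1 (g \o flip) z = - pderive 1 g (flip z).
Proof.
move=> sg Bz; have dg := smooth_on_differentiable sg (flip_ball Bz).
by have [_ _ ->] := pderive_squeeze dg; rewrite mulN1r.
Qed.

Lemma smooth_flip g r : smooth_on (B r) g -> smooth_on (B r) (g \o flip).
Proof.
move=> sg; apply: (@smooth_on_comp_real _ _ _ _ (B r) flip g) => //.
- exact: ball_open.
- exact: flip_ball.
- by move=> k; apply: (@Ck_linear _ _ _ k _ (squeeze (-1))); exact: squeeze_continuous.
Qed.

(** The derivative of an even function is odd, hence vanishes on the axis; its quotient by [v]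
    is even again. *)
Lemma even_derivative g r : smooth_on (B r) g -> (forall z, B r z -> g (flip z) = g z) ->
  exists g', [/\ smooth_on (B r) g', forall z, B r z -> g' (flip z) = g' z &
    forall z, B r z -> pderive 1 g z = 2 * z ord0 1 * g' z].
Proof.
move=> sg eg; have oB : open (B r) by exact: ball_open.
have od z : B r z -> pderive 1 g (flip z) = - pderive 1 g z.
  move=> Bz; apply/eqP; rewrite -eqr_oppLR; apply/eqP; rewrite -(pderive_flip sg Bz).
  by apply: (pderive_ext 1 oB _ Bz) => y By; rewrite /= eg.
have [|k sk gk] := hadamard (pderive_smooth 1 sg).
  move=> z Bz; rewrite -squeeze0E.
  have := od _ (squeeze0_ball Bz); rewrite flip_squeeze0; lra.
exists (fun z => 2^-1 * k z); split.
- by apply: smooth_onM => //; exact: smooth_on_cst.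
- move=> z Bz; congr (_ * _); have [z1|z1] := eqVneq (z ord0 1) 0; first by rewrite flip_axis.
  apply: (mulfI z1); rewrite -gk//.
  have := gk _ (flip_ball Bz); rewrite od// pt1 mulN1r mulNr => /oppr_inj ->.
  by [].
- by move=> z Bz; rewrite gk//; field.
Qed.

(** With [w = v ^ 2] one has [d/dv = 2 v d/dw], so [G k] is the [k]-th derivative of [g] with
    respect to [w]. *)
Lemma even_chain g r : smooth_on (B r) g -> (forall z, B r z -> g (flip z) = g z) ->
  exists G : nat -> 'rV[R]_2 -> R, [/\ G 0%N = g, forall k, smooth_on (B r) (G k) &
    forall k z, B r z -> pderive 1 (G k) z = 2 * z ord0 1 * G k.+1 z].
Proof.
move=> sg eg.
pose P g := smooth_on (B r) g /\ forall z, B r z -> g (flip z) = g z.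
have /choice[st HS] : forall g, exists g', P g ->
    P g' /\ forall z, B r z -> pderive 1 g z = 2 * z ord0 1 * g' z.
  move=> f; have [[sf ef]|nP] := pselect (P f); last by exists f.
  by have [f' [sf' ef' ff']] := even_derivative sf ef; exists f'.
pose G k := iter k st g.
have PG k : P (G k) by elim: k => [//|k /HS[]].
by exists G; split=> // [k|k z Bz]; [case: (PG k)|exact: (HS _ (PG k)).2].
Qed.

Lemma is_diff_fold z : differentiable fold z /\
  ('D_(delta_mx 0 0) fold z = delta_mx 0 0 /\
   'D_(delta_mx 0 1) fold z = (2 * z ord0 1) *: delta_mx 0 1).
Proof.
have E0 : (fun y : 'rV[R]_2 => fold y ord0 0) = coord 0 by apply/funext => y; rewrite pt0.
have E1 : (fun y : 'rV[R]_2 => fold y ord0 1) = coord 1 * (coord 1 : 'rV[R]_2 -> R).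
  by apply/funext => y; rewrite pt1 expr2.
have dc j : differentiable (coord j : 'rV[R]_2 -> R) z.
  by apply: linear_differentiable; exact: coord_continuous'.
have df : differentiable fold z.
  apply/differentiable_coordinates; apply: ord2_ind; rewrite ?E0 ?E1//.
  exact: differentiableM.
have D v : 'D_v fold z = pt (v ord0 0) (2 * z ord0 1 * v ord0 1).
  apply/rowP => j; rewrite -derive_coordinates//; move: j; apply: ord2_ind; rewrite ?pt0 ?pt1.
    by rewrite E0 derive_linear//; exact: coord_continuous'.
  rewrite E1 (deriveM (diff_derivable (dc 1)) (diff_derivable (dc 1))) derive_linear; last exact: coord_continuous'.
  by rewrite /GRing.scale /= /coord; ring.
split=> //; split; rewrite D; apply/rowP; apply: ord2_ind; rewrite !mxE //=; ring.
Qed.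

Lemma fold_smooth (A : set 'rV[R]_2) : open A -> smooth_on A fold.
Proof.
move=> oA; apply: smooth_on_pt => //; first exact: smooth_on_coord.
by apply: smooth_onX => //; exact: smooth_on_coord.
Qed.

Lemma pderive_fold f z : differentiable f (fold z) ->
  pderive 1 (f \o fold) z = 2 * z ord0 1 * pderive 1 f (fold z).
Proof.
move=> df; have [dF [_ D1]] := is_diff_fold z.
by rewrite /pderive (derive_comp _ dF df) D1 (derive_scale_dir _ _ df).
Qed.

(** [F 0] vanishes to infinite order on the axis [v = 0], and so do the functions
    [F k], which are the successive derivatives of [F 0] with respect to [v ^ 2]. *)
Definition flat_chain r (F : nat -> 'rV[R]_2 -> R) : Prop :=
  [/\ forall k, smooth_on (B r) (F k),
      forall k z, B r z -> pderive 1 (F k) z = 2 * z ord0 1 * F k.+1 z &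
      forall k z, B r z -> F k (squeeze 0 z) = 0].

(** A function [f(u, v)] that is flat on the axis, as a function of [w = v ^ 2] extended by 0
    to [w <= 0]. *)
Definition sqrt_ext f z := if 0 < z ord0 1 then f (pt (z ord0 0) (Num.sqrt (z ord0 1))) else 0.

(** The mean value theorem gains one power of [v], and the factor [2 v] another one. *)
Lemma vanishing_step r F G (C : R) m :
  (forall z, B r z -> differentiable F z) ->
  (forall z, B r z -> pderive 1 F z = 2 * z ord0 1 * G z) ->
  (forall z, B r z -> F (squeeze 0 z) = 0) -> 0 <= C ->
  (forall z, B r z -> `|G z| <= C * `|z ord0 1| ^+ m) ->
  forall z, B r z -> `|F z| <= 2 * C * `|z ord0 1| ^+ m.+2.
Proof.
move=> dF FG F0 C0 bG z Bz.
have E (t : R) : squeeze 0 z + t *: (z - squeeze 0 z) = squeeze t z.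
  by apply/rowP; apply: ord2_ind; rewrite !mxE /=; ring.
have Bt (t : R) : 0 <= t <= 1 -> B r (squeeze t z) by move=> t01; exact: squeeze_ball.
have [|t t01] := @mean_value R _ F (squeeze 0 z) z.
  by move=> t t01; rewrite E; apply: dF; exact: Bt.
rewrite E F0// subr0 => ->.
have -> : z - squeeze 0 z = z ord0 1 *: delta_mx 0 1.
  by apply/rowP; apply: ord2_ind; rewrite !mxE /=; ring.
rewrite derive_scale_dir; last exact/dF/Bt.
rewrite -/(pderive 1 F _) FG; last exact: Bt.
rewrite pt1 /GRing.scale /= !normrM (@ger0_norm _ 2)//.
have [t0 t1] := andP t01; rewrite (ger0_norm t0).
have bGt := bG _ (Bt t t01); rewrite pt1 normrM (ger0_norm t0) in bGt.
set a := `|z ord0 1| in bGt *; have a0 : 0 <= a by exact: normr_ge0.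
have -> : 2 * C * a ^+ m.+2 = a * (2 * (1 * a) * (C * a ^+ m)) by rewrite !exprS; ring.
apply: ler_wpM2l => //; apply: ler_pM => //.
- by rewrite !mulr_ge0.
- by apply: ler_wpM2l => //; apply: ler_wpM2r.
- apply: le_trans bGt _; apply: ler_wpM2l => //.
  by apply: lerXn2r; rewrite ?nnegrE ?mulr_ge0// ler_piMl.
Qed.

(** Derivatives of a flat function with respect to [w] are again flat, so the class of functions
    [sqrt_ext (F 0)] is stable under partial derivatives. *)
Lemma sqrt_ext_differentiable r F z : 0 < r <= 1 -> flat_chain r F -> B (r ^+ 2) z ->
  [/\ differentiable (sqrt_ext (F 0%N)) z,
      pderive 0 (sqrt_ext (F 0%N)) z = sqrt_ext (pderive 0 (F 0%N)) z &
      pderive 1 (sqrt_ext (F 0%N)) z = sqrt_ext (F 1%N) z].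
Proof.
move=> /andP[r0 r1] [sF FF F0] Bz.
have r20 := ball_pos Bz.
have [z0 z1] := (ball0_pt _ r20).1 Bz.
have r2r : r ^+ 2 <= r by rewrite expr2 ler_piMl// ltW.
have c1 : {for z, continuous (coord 1 : 'rV[R]_2 -> R)} by exact: coord_continuous'.
have [z1p|z1n|z10] := ltgtP 0 (z ord0 1).
- (* above the axis, [sqrt_ext] is composition with [psi] *)
  pose psi (y : 'rV[R]_2) := pt (y ord0 0) (Num.sqrt (y ord0 1)).
  have np : \forall y \near z, 0 < (y : 'rV[R]_2) ord0 1.
    by apply: (near_preimage c1 (@open_gt _ 0)).
  have nf f : {near z, sqrt_ext f =1 f \o psi}.
    by apply: filterS np => y y1; rewrite /sqrt_ext y1.
  have nf' f : {near z, f \o psi =1 sqrt_ext f}.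
    by apply: filterS (nf f) => y ->.
  have Bpsi : B r (psi z).
    apply/(ball0_pt _ r0); rewrite pt0 pt1; split; first exact: lt_le_trans z0 r2r.
    rewrite ger0_norm ?sqrtr_ge0// -[r]ger0_norm ?ltW// -sqrtr_sqr ltr_sqrt//.
    by rewrite gtr0_norm in z1.
  have [dsq Dsq] := is_derive1_sqrt z1p.
  have [ds D0 D1] := pderive_coord1 dsq.
  have dpsi : differentiable psi z.
    apply/differentiable_coordinates; apply: ord2_ind.
      by under eq_fun do rewrite pt0; exact: differentiable_coord.
    by under eq_fun do rewrite pt1.
  have Dpsi v : 'D_v psi z = pt (v ord0 0) ('D_v (fun y : 'rV[R]_2 => Num.sqrt (y ord0 1)) z).
    apply/rowP => j; rewrite -derive_coordinates//; move: j; apply: ord2_ind; rewrite ?pt0 ?pt1.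
      under eq_fun do rewrite pt0.
      by rewrite (derive_linear _ _ (@coord_continuous' _ _ 0)).
    by under eq_fun do rewrite pt1.
  have dF := smooth_on_differentiable (sF 0%N) Bpsi.
  split.
  + exact: differentiable_near_eq (nf' _) (differentiable_comp dpsi dF).
  + rewrite /pderive (near_eq_derive _ (nf _)) (derive_comp _ dpsi dF) Dpsi.
    rewrite -/(pderive 0 _ z) D0 /sqrt_ext z1p; congr ('D__ _ _).
    by apply/rowP; apply: ord2_ind; rewrite !mxE.
  + rewrite /pderive (near_eq_derive _ (nf _)) (derive_comp _ dpsi dF) Dpsi.
    rewrite -/(pderive 1 _ z) D1 derive1E Dsq /sqrt_ext z1p.
    have -> : pt ((delta_mx 0 1 : 'rV[R]_2) ord0 0) (2 * Num.sqrt (z ord0 1))^-1 =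
              (2 * Num.sqrt (z ord0 1))^-1 *: delta_mx 0 1.
      by apply/rowP; apply: ord2_ind; rewrite !mxE /= ?mulr0 ?mulr1.
    rewrite (derive_scale_dir _ _ dF) -/(pderive 1 _ _) FF// pt1 /GRing.scale /= mulKf//.
    by rewrite mulf_neq0// gt_eqF// sqrtr_gt0.
- have np : \forall y \near z, (y : 'rV[R]_2) ord0 1 < 0.
    by apply: (near_preimage c1 (@open_lt _ 0)).
  have nf f : {near z, sqrt_ext f =1 fun=> 0}.
    by apply: filterS np => y y1; rewrite /sqrt_ext ltNge (ltW y1).
  have nf' f : {near z, (fun=> 0) =1 sqrt_ext f}.
    by apply: filterS (nf f) => y ->.
  have E f : sqrt_ext f z = 0 by rewrite /sqrt_ext ltNge (ltW z1n).
  by rewrite /pderive !(near_eq_derive _ (nf _)) !derive_cst !E; split=> //;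
    exact: differentiable_near_eq (nf' _) (differentiable_cst _ _).
- have E f : sqrt_ext f z = 0 by rewrite /sqrt_ext -z10 ltxx.
  (* [F 0] is bounded by a multiple of [v ^ 4], hence [sqrt_ext (F 0)] by the
     same multiple of the square of the second coordinate *)
  pose rho := (`|z ord0 0| + r) / 2.
  have z0r : `|z ord0 0| < r by exact: lt_le_trans z0 r2r.
  have rho0 : 0 < rho by rewrite /rho; have := normr_ge0 (z ord0 0); lra.
  have rhor : rho < r by rewrite /rho; lra.
  have z0rho : `|z ord0 0| < rho by rewrite /rho; lra.
  have sub y : B rho y -> B r y by apply: le_ball; exact: ltW.
  have [|C C0 bC] := @bounded_on_ball R 2 (F 2%N) 0 r rho rhor.
    by move=> y; exact: smooth_on_continuous.
  have bF1 := @vanishing_step rho (F 1%N) (F 2%N) C 0 _ _ _ C0 _.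
  have {}bF1 y : B rho y -> `|F 1%N y| <= 2 * C * `|y ord0 1| ^+ 2.
    apply: bF1 => x Bx; [exact: smooth_on_differentiable (sF 1%N) (sub _ Bx)
      |exact/FF/sub|exact/F0/sub|by rewrite expr0 mulr1; exact: bC].
  have C20 : 0 <= 2 * C by rewrite mulr_ge0.
  have bF0 := @vanishing_step rho (F 0%N) (F 1%N) (2 * C) 2 _ _ _ C20 bF1.
  have {}bF0 y : B rho y -> `|F 0%N y| <= 2 * (2 * C) * `|y ord0 1| ^+ 4.
    apply: bF0 => x Bx; [exact: smooth_on_differentiable (sF 0%N) (sub _ Bx)
      |exact/FF/sub|exact/F0/sub].
  rewrite !E; have rho2 : 0 < Num.min (rho - `|z ord0 0|) (rho ^+ 2).
    by rewrite lt_min subr_gt0 z0rho exprn_gt0.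
  have [|dS DS] := @differentiable_quadratic R 2 (sqrt_ext (F 0%N)) z (fun=> 0) (2 * (2 * C)) _ rho2.
    move=> h; rewrite lt_min => /andP[h0 h1].
    rewrite E subr0 big1 ?subr0; last by move=> j _; rewrite mulr0.
    rewrite /sqrt_ext !mxE -z10 addr0; case: ifP => [h1p|_]; last first.
      by rewrite normr0 !mulr_ge0// exprn_ge0.
    have hh0 := rV_coord_le h 0; have hh1 := rV_coord_le h 1.
    apply: le_trans (bF0 _ _) _.
      apply/(ball0_pt _ rho0); rewrite pt0 pt1; split.
        by apply: le_lt_trans (ler_normD _ _) _; lra.
      rewrite ger0_norm ?sqrtr_ge0// -[rho]ger0_norm ?ltW// -sqrtr_sqr ltr_sqrt ?exprn_gt0//.
      by apply: le_lt_trans h1; apply: le_trans hh1; rewrite ler_norm.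
    rewrite pt1; apply: ler_wpM2l; first by rewrite mulr_ge0.
    rewrite ger0_norm ?sqrtr_ge0// -[4%N]/(2 * 2)%N exprM sqr_sqrtr; last exact: ltW.
    by apply: lerXn2r; rewrite ?nnegrE ?(ltW h1p)// (le_trans _ hh1)// ler_norm.
  by split=> //; rewrite DS.
Qed.

Lemma sqrt_ext_smooth r F : 0 < r <= 1 -> flat_chain r F ->
  smooth_on (B (r ^+ 2)) (sqrt_ext (F 0%N)).
Proof.
move=> r1 fF; apply: (@smooth_coind _ _ _ _
  (fun f => exists2 F, flat_chain r F & f = sqrt_ext (F 0%N))); last by exists F.
- exact: ball_open.
- by move=> _ [G fG ->] z Bz; case: (sqrt_ext_differentiable r1 fG Bz).
- move=> _ j [G fG ->]; have [sG GG G0] := fG; have oB : open (B r) by exact: ball_open.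
  move: j; apply: ord2_ind; last first.
    exists (sqrt_ext (G 1%N)); last by move=> z Bz; case: (sqrt_ext_differentiable r1 fG Bz).
    by exists (fun k => G k.+1) => //; split=> [k|k z|k z]; [exact: sG|exact: GG|exact: G0].
  exists (sqrt_ext (pderive 0 (G 0%N))); last by move=> z Bz; case: (sqrt_ext_differentiable r1 fG Bz).
  exists (fun k => pderive 0 (G k)) => //; split=> [k|k z Bz|k z Bz].
  + exact: pderive_smooth.
  + rewrite (pderive_commute _ _ oB Bz)// (pderive_ext 0 oB (GG k))//.
    have dt : derivable ( *%R (2 : R)) (z ord0 1) 1 by apply/derivable1_diffP.
    have [d1 D1 _] := pderive_coord1 dt.
    have d2 := smooth_on_differentiable (sG k.+1) Bz.
    rewrite /pderive [LHS](deriveM (diff_derivable d1) (diff_derivable d2)).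
    by rewrite [X in _ + _ *: X]D1 scaler0 addr0.
  + have dG := smooth_on_differentiable (sG k) (squeeze0_ball Bz).
    have [_ <- _] := pderive_squeeze dG.
    have -> : pderive 0 (G k \o squeeze 0) z = pderive 0 (fun=> 0) z.
      by apply: (pderive_ext _ oB _ Bz) => y By; exact: G0.
    exact: derive_cst.
Qed.

(** Borel's lemma gives [e] with the same derivatives in [w = v ^ 2] as [g] on the axis; the
    difference [g - e(u, v ^ 2)] is even and flat, and [sqrt_ext] applies to it. *)
Theorem whitney_even g r : 0 < r -> smooth_on (B r) g ->
  (forall z, B r z -> g (flip z) = g z) ->
  exists2 d, 0 < d <= Num.min r 1 & exists2 h, smooth_on (B d) h & forall z, B d z -> g z = h (fold z).
Proof.
move=> r0 sg eg.
have [G [G0 sG GG]] := even_chain sg eg.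
pose r' := Num.min (r / 2) 1.
have r'0 : 0 < r' by rewrite /r' lt_min ltr01 divr_gt0.
have r'1 : r' <= 1 by rewrite /r' ge_min lexx orbT.
have r'r : r' < r.
  by apply: (@le_lt_trans _ _ (r / 2)); [rewrite /r' ge_min lexx|rewrite ltr_pdivrMr// ltr_pMr// ltr1n].
have sub z : B r' z -> B r z by apply: le_ball; exact: ltW.
have [e se eG] := borel r'0 r'r sG.
have oB : open (B r') by exact: ball_open.
have sei k : smooth_on (B r') (iter k (pderive 1) e).
  by elim: k => [//|k IH]; exact: pderive_smooth.
pose F k z := G k z - (iter k (pderive 1) e \o fold) z.
have sef k : smooth_on (B r') (iter k (pderive 1) e \o fold).
  apply: (@smooth_on_comp_real _ _ _ _ (B r')) => //; last exact: fold_smooth.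
  by move=> z; exact: fold_ball.
have sGk k : smooth_on (B r') (G k) by apply: smooth_on_subset (sG k).
have fF : flat_chain r' F.
  split=> [k|k z Bz|k z Bz].
  - exact: smooth_onB.
  - rewrite /pderive deriveB; first last.
    + exact: diff_derivable (smooth_on_differentiable (sef k) Bz).
    + exact: diff_derivable (smooth_on_differentiable (sGk k) Bz).
    rewrite -!/(pderive _ _ _) GG; last exact: sub.
    rewrite pderive_fold; last exact: smooth_on_differentiable (sei k) (fold_ball r'1 Bz).
    by rewrite -mulrBr.
  - rewrite /F /=; have -> : fold (squeeze 0 z) = squeeze 0 z.
      by rewrite /fold /squeeze pt0 pt1 mul0r expr0n.
    by rewrite eG// subrr.
have r2r' : r' ^+ 2 <= r' by rewrite expr2 ler_piMl// ltW.
exists (r' ^+ 2).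
  rewrite exprn_gt0//= le_min; apply/andP; split; apply: le_trans r2r' _ => //; exact: ltW.
have r'01 : 0 < r' <= 1 by rewrite r'0.
have sub2 z : B (r' ^+ 2) z -> B r' z by exact: le_ball.
exists (fun z => e z + sqrt_ext (F 0%N) z).
  apply: smooth_onD; [exact: ball_open|exact: smooth_on_subset se|exact: sqrt_ext_smooth].
move=> z Bz; have Bz' := sub2 _ Bz; rewrite /sqrt_ext /fold !pt0 !pt1 sqrtr_sqr.
have [z1|z1] := eqVneq (z ord0 1) 0.
  rewrite z1 expr0n ltxx addr0; have [_ _ /(_ 0%N z Bz')] := fF.
  rewrite /F /= (squeeze0_axis z1) G0 /fold z1 expr0n => /eqP; rewrite subr_eq0 => /eqP ->.
  by [].
rewrite exprn_even_gt0//= z1.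
have F0 : F 0%N (pt (z ord0 0) `|z ord0 1|) = F 0%N z.
  have [p|n] := leP 0 (z ord0 1); first by rewrite ger0_norm// -ptE.
  rewrite ltr0_norm// -mulN1r -/(squeeze (-1) z) -/(flip z) /F G0 eg; last exact: sub.
  by rewrite /= /fold /flip /squeeze pt0 pt1 mulN1r sqrrN.
by rewrite F0 /F G0 /= addrC /fold subrK.
Qed.

(** The even part of [g] is a function of [(u, v ^ 2)], the odd part is [v] times
    such a function, which vanishes for [v = 0] when [g_v] does. *)
Theorem fold_normal_form g r : 0 < r -> smooth_on (B r) g ->
  (forall z, B r z -> pderive 1 g (squeeze 0 z) = 0) ->
  exists2 d, 0 < d <= Num.min r 1 & exists E Q, [/\ smooth_on (B d) E, smooth_on (B d) Q &
    forall z, B d z -> g z = E (fold z) + z ord0 1 ^+ 3 * Q (fold z)].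
Proof.
move=> r0 sg g1; have oB : open (B r) by exact: ball_open.
have sgf := smooth_flip sg.
pose ge z := 2^-1 * (g z + (g \o flip) z); pose go z := 2^-1 * (g z - (g \o flip) z).
have sge : smooth_on (B r) ge.
  by apply: smooth_onM => //; [exact: smooth_on_cst|exact: smooth_onD].
have sgo : smooth_on (B r) go.
  by apply: smooth_onM => //; [exact: smooth_on_cst|exact: smooth_onB].
have [|d1 d10 [E sE gE]] := whitney_even r0 sge.
  by move=> z Bz; rewrite /ge /= flipK addrC.
have [|k sk gk] := hadamard sgo.
  move=> z Bz; rewrite -squeeze0E.
  by rewrite /go /= flip_squeeze0 subrr mulr0.
have [|d2 d20 [K sK kK]] := whitney_even r0 sk.
  move=> z Bz; have [z1|z1] := eqVneq (z ord0 1) 0; first by rewrite flip_axis.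
  apply: (mulfI z1); rewrite -gk//; have := gk _ (flip_ball Bz).
  by rewrite {1}/go /= flipK pt1 mulN1r /go /= => H; lra.
have [d2p] := andP d20; have [d1p] := andP d10; rewrite !le_min => /andP[d1r d11] /andP[d2r d21].
have fold0 z : fold (squeeze 0 z) = squeeze 0 z by rewrite /fold /squeeze pt0 pt1 mul0r expr0n.
have Dk y : B r y -> pderive 1 go y = k y + y ord0 1 * pderive 1 k y.
  move=> By; rewrite (pderive_ext 1 oB gk)// pderive_mul_coord1//.
  exact: smooth_on_differentiable sk By.
have Dg y : B r y -> pderive 1 go y = 2^-1 * (pderive 1 g y + pderive 1 g (flip y)).
  move=> By; have dg := smooth_on_differentiable sg By; have dgf := smooth_on_differentiable sgf By.
  rewrite -[_ (flip y)]opprK -(pderive_flip sg By).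
  rewrite -(deriveB (diff_derivable dg) (diff_derivable dgf)).
  rewrite -[RHS]/(_ *: _) -deriveZ//; apply: derivableB; exact: diff_derivable.
have K0 z : B d2 z -> K (pt (z ord0 0) 0) = 0.
  move=> Bz; have B0 := squeeze0_ball Bz; have Br0 : B r (squeeze 0 z) by exact: le_ball d2r _ B0.
  rewrite -squeeze0E.
  have := kK _ B0; rewrite fold0 => <-.
  have := Dk _ Br0; rewrite Dg// flip_squeeze0 g1; last exact: le_ball d2r _ Bz.
  by rewrite pt1 !mul0r !addr0 mulr0 => <-.
have [Q sQ KQ] := hadamard sK K0.
exists (Num.min d1 d2).
  by rewrite lt_min d1p d2p /= ge_min (le_trans _ (_ : d1 <= _)) ?le_min ?d1r ?d11.
exists E, Q; split.
- by apply: smooth_on_subset sE; apply: le_ball; rewrite ge_min lexx.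
- by apply: smooth_on_subset sQ; apply: le_ball; rewrite ge_min lexx orbT.
- move=> z Bz; have B1 : B d1 z by apply: le_ball Bz; rewrite ge_min lexx.
  have B2 : B d2 z by apply: le_ball Bz; rewrite ge_min lexx orbT.
  have Br : B r z by exact: le_ball d2r _ B2.
  have -> : g z = ge z + go z by rewrite /ge /go; lra.
  rewrite gE// gk// kK// KQ; last exact: fold_ball.
  by rewrite pt1; ring.
Qed.

End Whitney.

(** * Local diffeomorphisms of Euclidean spaces *)

Section LocalInverse.
Context {R : realType}.

Lemma open_preimage_on (V W : normedModType R) (A : set V) (f : V -> W) (B : set W) :
  open A -> (forall x, A x -> {for x, continuous f}) -> open B -> open (A `&` f @^-1` B).
Proof.
move=> oA cf oB; rewrite openE => x [Ax Bx]; apply: filterI; first exact: open_nbhs_nbhs.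
exact: (near_preimage (cf x Ax) oB Bx).
Qed.

Lemma open_smooth_preimage (V W : normedModType R) (A : set V) (f : V -> W) (B : set W) :
  open A -> smooth_on A f -> open B -> open (A `&` f @^-1` B).
Proof. by move=> oA sf; apply: open_preimage_on => // x; exact: smooth_on_continuous. Qed.

Lemma local_inverse_sym n (F G : 'rV[R]_n -> 'rV[R]_n) x y :
  local_inverse F G x y -> local_inverse G F y x.
Proof.
move=> [A [B [[oA oB] [Ax Fx] [sF sG] AB BA]]]; exists B, A; split=> //.
by rewrite -Fx; case: (AB _ Ax).
Qed.

Lemma local_inverse_restrict n (F G : 'rV[R]_n -> 'rV[R]_n) x y (D : set 'rV[R]_n) :
  open D -> D x -> local_inverse F G x y -> exists (A B : set 'rV[R]_n),
    [/\ open A /\ open B, A x /\ F x = y,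
        smooth_on A F /\ smooth_on B G,
        forall z, A z -> [/\ D z, B (F z) & G (F z) = z] &
        forall z, B z -> A (G z) /\ F (G z) = z].
Proof.
move=> oD Dx [A [B [[oA oB] [Ax Fx] [sF sG] AB BA]]].
exists (A `&` D), (B `&` G @^-1` D); split.
- split; first exact: openI.
  exact: open_smooth_preimage oB sG oD.
- by [].
- by split; [apply: smooth_on_subset sF => z []|apply: smooth_on_subset sG => z []].
- by move=> z [/AB[BFz GFz] Dz]; split=> //; split=> //; rewrite /preimage /= GFz.
- by move=> z [/BA[AGz FGz] DGz].
Qed.

Lemma local_inverse_comp n (F G F' G' : 'rV[R]_n -> 'rV[R]_n) x y z :
  local_inverse F G x y -> local_inverse F' G' y z ->
  local_inverse (F' \o F) (G \o G') x z.
Proof.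
move=> [A [B [[oA oB] [Ax Fx] [sF sG] AB BA]]].
move=> [A' [B' [[oA' oB'] [A'y F'y] [sF' sG'] AB' BA']]].
exists (A `&` F @^-1` A'), (B' `&` G' @^-1` B); split.
- by split; [exact: open_smooth_preimage oA sF oA'|exact: open_smooth_preimage oB' sG' oB].
- by split; [split=> //; rewrite /preimage /= Fx|rewrite /= Fx].
- split.
    apply: (@smooth_on_comp _ _ _ _ _ A') => //.
    + exact: open_smooth_preimage oA sF oA'.
    + by move=> w [].
    + by apply: smooth_on_subset sF => w [].
  apply: (@smooth_on_comp _ _ _ _ _ B) => //.
  + exact: open_smooth_preimage oB' sG' oB.
  + by move=> w [].
  + by apply: smooth_on_subset sG' => w [].
- move=> w [Aw A'w]; have [BF GF] := AB _ Aw; have [BF' GF'] := AB' _ A'w.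
  by split; rewrite /= ?GF' ?GF//; split=> //; rewrite /preimage /= GF'.
- move=> w [B'w Bw]; have [AG FG] := BA _ Bw; have [AG' FG'] := BA' _ B'w.
  by split; rewrite /= ?FG ?FG'//; split=> //; rewrite /preimage /= FG.
Qed.

Lemma derive_local_inverse n (F G : 'rV[R]_n -> 'rV[R]_n) (A B : set 'rV[R]_n) z v :
  open A -> smooth_on A F -> smooth_on B G ->
  (forall z, A z -> B (F z) /\ G (F z) = z) -> A z -> 'D_('D_v F z) G (F z) = v.
Proof.
move=> oA sF sG AB Az; have [BF GF] := AB _ Az.
rewrite -(derive_comp _ (smooth_on_differentiable sF Az) (smooth_on_differentiable sG BF)).
rewrite -[RHS](derive_id z v); apply: near_eq_derive; near=> w => /=.
by have [] : B (F w) /\ G (F w) = w by apply: AB; near: w; exact: open_nbhs_nbhs.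
Unshelve. all: by end_near. Qed.

Lemma smooth_derive_along (V : normedModType R) m n (A : set V) (B : set 'rV[R]_m)
    (g X : V -> 'rV[R]_m) (f : 'rV[R]_m -> 'rV[R]_n) : open A -> open B ->
  (forall x, A x -> B (g x)) -> smooth_on A g -> smooth_on A X -> smooth_on B f ->
  smooth_on A (fun x => 'D_(X x) f (g x)).
Proof.
move=> oA oB AB sg sX sf; apply/smooth_on_coordinates => // i.
apply: (@smooth_on_ext _ _ _ _ (fun x => \sum_j X x ord0 j * (pderive j f (g x)) ord0 i)) => //.
  move=> x Ax; rewrite derive_partials; last by apply: smooth_on_differentiable sf _; exact: AB.
  by rewrite summxE; apply: eq_bigr => j _; rewrite !mxE.
apply: smooth_on_sum => // j _; apply: smooth_onM => //.
  by move: j; apply/smooth_on_coordinates.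
have s : smooth_on A (pderive j f \o g).
  exact: (smooth_on_comp (f := g) (g := pderive j f) oA oB AB sg (pderive_smooth j sf)).
by move: i; apply/smooth_on_coordinates.
Qed.

End LocalInverse.

(** * The null derivative of a frontal in normal form *)

Section Dot.
Context {R : realType} {n : nat}.
Implicit Types (a b : 'rV[R]_n).

Definition dot a b : R := \sum_i a ord0 i * b ord0 i.

Lemma dotDr a b c : dot a (b + c) = dot a b + dot a c.
Proof. by rewrite /dot -big_split; apply: eq_bigr => i _; rewrite mxE mulrDr. Qed.

Lemma dotZr a b k : dot a (k *: b) = k * dot a b.
Proof. by rewrite /dot mulr_sumr; apply: eq_bigr => i _; rewrite mxE mulrCA. Qed.

Lemma dot0r a : dot a 0 = 0.
Proof. by rewrite /dot big1// => i _; rewrite mxE mulr0. Qed.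

Lemma dot_sumr a (I : finType) (b : I -> 'rV[R]_n) : dot a (\sum_i b i) = \sum_i dot a (b i).
Proof.
elim/big_rec2: _ => [|i x y _ <-]; first exact: dot0r.
by rewrite dotDr.
Qed.

Lemma smooth_on_dot (V : normedModType R) (A : set V) (f g : V -> 'rV[R]_n) : open A ->
  smooth_on A f -> smooth_on A g -> smooth_on A (fun x => dot (f x) (g x)).
Proof.
move=> oA sf sg; apply: smooth_on_sum => // i _; apply: smooth_onM => //.
  by move: i; apply/smooth_on_coordinates.
by move: i; apply/smooth_on_coordinates.
Qed.

Lemma derive_dot (V : normedModType R) (f g : V -> 'rV[R]_n) x v :
  differentiable f x -> differentiable g x ->
  'D_v (fun x => dot (f x) (g x)) x = dot ('D_v f x) (g x) + dot (f x) ('D_v g x).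
Proof.
move=> df dg.
have dfi i := iffLR (differentiable_coordinates _ _) df i.
have dgi i := iffLR (differentiable_coordinates _ _) dg i.
have -> : (fun x => dot (f x) (g x)) =
    \sum_i (fun x => f x ord0 i) * (fun x => g x ord0 i).
  by apply/funext => y; rewrite fct_sumE.
rewrite derive_sum; last by move=> i; apply: derivableM; exact: diff_derivable.
rewrite /dot -big_split; apply: eq_bigr => i _ /=.
rewrite (deriveM (diff_derivable (dfi i)) (diff_derivable (dgi i))).
rewrite (derive_coordinates _ _ df) (derive_coordinates _ _ dg) /GRing.scale /=; ring.
Qed.

End Dot.

Section NormalForm.
Context {R : realType}.
Implicit Types (z v w : 'rV[R]_2).

Definition i2 : 'I_3 := @Ordinal 3 2 isT.

Lemma ord3_ind (P : 'I_3 -> Prop) : P 0 -> P 1 -> P i2 -> forall j, P j.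
Proof.
move=> P0 P1 P2 [[|[|[|j]]] lj] //; [rewrite (_ : Ordinal _ = 0)//|
  rewrite (_ : Ordinal _ = 1)//|rewrite (_ : Ordinal _ = i2)//]; exact: val_inj.
Qed.

Lemma sum3E (W : zmodType) (F : 'I_3 -> W) : \sum_j F j = F 0 + F 1 + F i2.
Proof.
rewrite big_ord_recl big_ord_recl big_ord1 addrA.
by congr (_ + F _ + F _); exact: val_inj.
Qed.

Definition pt3 (a b c : R) : 'rV[R]_3 := \row_j [:: a; b; c]`_j.

Lemma smooth_on_pt3 (V : normedModType R) (A : set V) (f g h : V -> R) : open A ->
  smooth_on A f -> smooth_on A g -> smooth_on A h -> smooth_on A (fun x => pt3 (f x) (g x) (h x)).
Proof.
move=> oA sf sg sh; apply/smooth_on_coordinates => //; apply: ord3_ind.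
- by apply: smooth_on_ext sf => // x _; rewrite mxE.
- by apply: smooth_on_ext sg => // x _; rewrite mxE.
- by apply: smooth_on_ext sh => // x _; rewrite mxE.
Qed.

Lemma pt3_0 a b c : pt3 a b c ord0 0 = a. Proof. by rewrite mxE. Qed.
Lemma pt3_1 a b c : pt3 a b c ord0 1 = b. Proof. by rewrite mxE. Qed.
Lemma pt3_2 a b c : pt3 a b c ord0 i2 = c. Proof. by rewrite mxE. Qed.

(** The normal form of a frontal at a non-degenerate singular point whose null direction is
    transversal to the singular curve: the values of [Q] on the first axis decide the type of
    the singularity, and [Q(u, w) = u] gives the cuspidal cross cap. *)
Definition normal_map (Q : 'rV[R]_2 -> R) z : 'rV[R]_3 :=
  pt3 (z ord0 0) (z ord0 1 ^+ 2) (z ord0 1 ^+ 3 * Q (fold z)).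

Variables (Q : 'rV[R]_2 -> R) (r : R).
Hypotheses (r0 : 0 < r) (r1 : r <= 1) (sQ : smooth_on (ball 0 r) Q).
Let B := ball (0 : 'rV[R]_2) r.
Let oB : open B := ball_open _ r.
Let Qf := Q \o fold.

Lemma Qf_smooth : smooth_on B Qf.
Proof.
apply: (@smooth_on_comp_real _ _ _ _ (ball 0 r)) => //; last exact: fold_smooth.
by move=> z; exact: fold_ball.
Qed.

Lemma normal_map_smooth : smooth_on B (normal_map Q).
Proof.
apply: smooth_on_pt3 => //; first exact: smooth_on_coord.
  by apply: smooth_onX => //; exact: smooth_on_coord.
apply: smooth_onM => //; last exact: Qf_smooth.
by apply: smooth_onX => //; exact: smooth_on_coord.
Qed.

Lemma normal_map_derive z v : B z -> 'D_v (normal_map Q) z =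
  pt3 (v ord0 0) (2 * z ord0 1 * v ord0 1)
      (3 * z ord0 1 ^+ 2 * v ord0 1 * Qf z + z ord0 1 ^+ 3 * 'D_v Qf z).
Proof.
move=> Bz; have dH := smooth_on_differentiable normal_map_smooth Bz.
have dQ := smooth_on_differentiable Qf_smooth Bz.
have dc : differentiable (fun z : 'rV[R]_2 => z ord0 1) z by exact: differentiable_coord.
have dX k : derivable ((fun z : 'rV[R]_2 => z ord0 1) ^+ k) z v.
  by apply: derivableX; exact: diff_derivable.
have DX k : 'D_v ((fun z : 'rV[R]_2 => z ord0 1) ^+ k) z = k%:R * z ord0 1 ^+ k.-1 * v ord0 1.
  by rewrite (deriveX k (diff_derivable dc)) derive_coord.
apply/rowP => j; rewrite -derive_coordinates//; move: j; apply: ord3_ind; rewrite ?pt3_0 ?pt3_1 ?pt3_2.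
- by under eq_fun do rewrite pt3_0; rewrite derive_coord.
- have -> : (fun y => normal_map Q y ord0 1) = (fun z : 'rV[R]_2 => z ord0 1) ^+ 2.
    by apply/funext => y; rewrite pt3_1 exprfctE.
  by rewrite DX expr1.
- have -> : (fun y => normal_map Q y ord0 i2) = (fun z : 'rV[R]_2 => z ord0 1) ^+ 3 * Qf.
    by apply/funext => y; rewrite pt3_2 mulrfctE exprfctE.
  rewrite (deriveM (dX 3%N) (diff_derivable dQ)) DX exprfctE /GRing.scale /=; ring.
Qed.

(** The first component forces [v_0 = 0], and then the second one forces [z_1 = 0]. *)
Lemma normal_map_kernel z v : B z -> 'D_v (normal_map Q) z = 0 -> v != 0 ->
  [/\ z ord0 1 = 0, v ord0 0 = 0 & v ord0 1 != 0].
Proof.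
move=> Bz; rewrite normal_map_derive// => /rowP H v0.
have := H 0; rewrite pt3_0 mxE => v00.
have v10 : v ord0 1 != 0.
  apply: contraNneq v0 => v1; apply/eqP/rowP; apply: ord2_ind; by rewrite mxE.
have := H 1; rewrite pt3_1 mxE => /eqP; rewrite mulf_eq0 (negbTE v10) orbF mulf_eq0 pnatr_eq0 /=.
by move=> /eqP.
Qed.

End NormalForm.

Section NullDerivative.
Context {R : realType}.
Variables (Q : 'rV[R]_2 -> R) (r : R).
Hypotheses (r0 : 0 < r) (r1 : r <= 1) (sQ : smooth_on (ball 0 r) Q).
Let B : set 'rV[R]_2 := ball (0 : 'rV[R]_2) r.
Let oB : open B := ball_open _ r.
Let H := normal_map Q.
Let sH : smooth_on B H := normal_map_smooth r1 sQ.

Variables (W V : 'rV[R]_3 -> 'rV[R]_3) (AW BW : set 'rV[R]_3).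
Hypotheses (oAW : open AW) (oBW : open BW) (sW : smooth_on AW W) (sV : smooth_on BW V).
Hypothesis (WK : forall y, AW y -> BW (W y) /\ V (W y) = y).
Hypothesis (VK : forall y, BW y -> AW (V y) /\ W (V y) = y).
Hypothesis (HAW : forall z, B z -> AW (H z)).

Variables (l X : 'rV[R]_2 -> 'rV[R]_3).
Hypotheses (sl : smooth_on B l) (sX : smooth_on B X).
Hypothesis (l0 : forall z, B z -> l z != 0).
Hypothesis (lG : forall z v, B z -> dot (l z) ('D_v (W \o H) z) = 0).
Hypothesis (lX : forall z, B z -> dot (l z) (X z) = 0).

(** The components of the covector [l] and of the vector [X] in the frame
    [pderive i W] carried by the target coordinates [W]. *)
Definition frame_covector i z : R := dot (l z) (pderive i W (H z)).
Definition frame_vector z : 'rV[R]_3 := 'D_(X z) V (W (H z)).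

Let dH z : B z -> differentiable H z := smooth_on_differentiable sH.
Let dW z : B z -> differentiable W (H z).
Proof. by move=> Bz; apply: (smooth_on_differentiable sW); exact: HAW. Qed.

Lemma frame_smooth i : smooth_on B (fun z => pderive i W (H z)).
Proof.
by apply: (smooth_on_comp (f := H) (g := pderive i W) oB oAW) => //; exact: pderive_smooth.
Qed.

Lemma frame_covector_smooth i : smooth_on B (frame_covector i).
Proof. by apply: smooth_on_dot => //; exact: frame_smooth. Qed.

Lemma frame_vector_smooth i : smooth_on B (fun z => frame_vector z ord0 i).
Proof.
have sG : smooth_on B (W \o H) by exact: (smooth_on_comp (f := H) (g := W) oB oAW).
have BWH z : B z -> BW ((W \o H) z) by move=> /HAW/WK[].
have := smooth_derive_along (g := W \o H) (X := X) (f := V) oB oBW BWH sG sX sV.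
by move/(smooth_on_coordinates _ oB).
Qed.

Lemma frame_vectorE z : B z -> X z = \sum_i frame_vector z ord0 i *: pderive i W (H z).
Proof.
move=> Bz; have [BWz VWz] := WK (HAW Bz).
rewrite -derive_partials; last exact: dW.
rewrite /frame_vector; have := derive_local_inverse (X z) oBW sV sW VK BWz.
by rewrite VWz.
Qed.

Lemma frame_covector_lift z v : B z ->
  \sum_i 'D_v H z ord0 i * frame_covector i z = 0.
Proof.
move=> Bz; transitivity (dot (l z) ('D_v (W \o H) z)); last exact: lG.
rewrite (derive_chain _ (dH Bz) (dW Bz)) dot_sumr.
by apply: eq_bigr => i _; rewrite dotZr.
Qed.

Lemma frame_covector_vector z : B z ->
  \sum_i frame_vector z ord0 i * frame_covector i z = 0.
Proof.
move=> Bz; transitivity (dot (l z) (X z)); last exact: lX.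
rewrite [X in dot _ X](frame_vectorE Bz) dot_sumr.
by apply: eq_bigr => i _; rewrite dotZr.
Qed.

Lemma frame_covector_eq0 z : B z -> (forall i, frame_covector i z = 0) -> l z = 0.
Proof.
move=> Bz lz; have lv w : dot (l z) w = 0.
  have [BWz VWz] := WK (HAW Bz).
  have := derive_local_inverse w oBW sV sW VK BWz; rewrite VWz => <-.
  rewrite derive_partials; last exact: dW.
  by rewrite dot_sumr big1// => i _; rewrite dotZr [dot _ _]lz mulr0.
apply/rowP => i; rewrite mxE; have := lv (delta_mx 0 i).
rewrite /dot (bigD1 i)//= big1 ?addr0.
  by rewrite mxE !eqxx mulr1.
by move=> j ji; rewrite mxE eqxx (negbTE ji) mulr0.
Qed.

Let Qf := Q \o fold.
Let sQf : smooth_on B Qf := Qf_smooth r1 sQ.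

(** This is the relation [l (d/dv (W \o H)) = 0] divided by [v]. *)
Lemma frame_covector1 z : B z ->
  frame_covector 1 z = - (2^-1 * (z ord0 1 * ((3 * Qf z + z ord0 1 * pderive 1 Qf z) * frame_covector i2 z))).
Proof.
pose S z := (3 * Qf z + z ord0 1 * pderive 1 Qf z) * frame_covector i2 z.
pose T z := 2 * frame_covector 1 z + z ord0 1 * S z.
have sc1 : smooth_on B (fun z : 'rV[R]_2 => z ord0 1) by exact: smooth_on_coord.
have sS : smooth_on B S.
  apply: smooth_onM => //; last exact: frame_covector_smooth.
  apply: smooth_onD => //; first by apply: smooth_onM => //; exact: smooth_on_cst.
  by apply: smooth_onM => //; exact: pderive_smooth.
have sT : smooth_on B T.
  apply: (smooth_onD oB _ (smooth_onM oB sc1 sS)).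
  by apply: (smooth_onM oB _ (frame_covector_smooth _)); exact: smooth_on_cst.
have vT y : B y -> y ord0 1 * T y = 0.
  move=> By; have := frame_covector_lift (delta_mx 0 1) By.
  rewrite sum3E (normal_map_derive r1 sQ _ By) pt3_0 pt3_1 pt3_2 !mxE /= => <-.
  rewrite /T /S /pderive (_ : Q (fold y) = Qf y)//.
  move: (frame_covector 0 y) (frame_covector 1 y) (frame_covector i2 y) ('D_(delta_mx 0 1) Qf y) (Qf y) (y ord0 1).
  by move=> a b c q' q v; ring.
move=> Bz; suff T0 : T z = 0.
  have -> : frame_covector 1 z = 2^-1 * (T z - z ord0 1 * S z) by rewrite /T; field.
  by rewrite T0 sub0r mulrN.
apply: (coord1_cancel oB sT (smooth_on_cst B 0)) Bz => y By.
by rewrite vT// mulr0.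
Qed.

Lemma frame_covector_axis z : B z -> z ord0 1 = 0 ->
  [/\ frame_covector 0 z = 0, frame_covector 1 z = 0, frame_covector i2 z != 0 &
      frame_vector z ord0 i2 = 0].
Proof.
move=> Bz z1.
have c0 : frame_covector 0 z = 0.
  have := frame_covector_lift (delta_mx 0 0) Bz.
  rewrite sum3E (normal_map_derive r1 sQ _ Bz) pt3_0 pt3_1 pt3_2 z1 !mxE /=.
  move: (frame_covector 0 z) (frame_covector 1 z) (frame_covector i2 z) ('D_(delta_mx 0 0) _ z) (Q (fold z)).
  by move=> a b c q' q h; rewrite -[RHS]h; ring.
have c1 : frame_covector 1 z = 0 by rewrite frame_covector1// z1 !mul0r mulr0 oppr0.
have c2 : frame_covector i2 z != 0.
  apply: contraNneq (l0 Bz) => c2; apply/eqP.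
  exact: (frame_covector_eq0 Bz (ord3_ind c0 c1 c2)).
split=> //; have := frame_covector_vector Bz; rewrite sum3E c0 c1 !mulr0 !add0r => /eqP.
by rewrite mulf_eq0 (negbTE c2) orbF => /eqP.
Qed.

Lemma pderive_frame_axis i z : B z -> z ord0 1 = 0 ->
  pderive 1 (fun z => pderive i W (H z)) z = 0.
Proof.
move=> Bz z1; rewrite /pderive.
have dP : differentiable (pderive i W) (H z).
  by apply: (smooth_on_differentiable (pderive_smooth i sW)); exact: HAW.
rewrite [LHS](derive_comp _ (dH Bz) dP).
have -> : 'D_(delta_mx 0 1) H z = 0.
  rewrite (normal_map_derive r1 sQ _ Bz) z1 !expr0n /= !mulr0 !mul0r addr0.
  by apply/rowP; apply: ord3_ind; rewrite !mxE.
exact: derive0.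
Qed.

Lemma pderive_frame_covector i z : B z -> z ord0 1 = 0 ->
  pderive 1 (frame_covector i) z = dot (pderive 1 l z) (pderive i W (H z)).
Proof.
move=> Bz z1; rewrite [LHS]derive_dot; first last.
- exact: smooth_on_differentiable (frame_smooth i) Bz.
- exact: smooth_on_differentiable sl Bz.
by rewrite [X in _ + dot _ X]pderive_frame_axis// dot0r addr0.
Qed.

(** In the frame, [l] is proportional to [(- v^3 Q_u, - 3/2 v Q - v^3 Q_w, 1)], so
    only its second component has a nonzero derivative along the axis. *)
Theorem null_derivative_axis z : B z -> z ord0 1 = 0 ->
  dot (l z) (pderive 1 X z) =
  3 / 2 * frame_covector i2 z * frame_vector z ord0 1 * Q (pt (z ord0 0) 0).
Proof.
move=> Bz z1; have [c0 c1 c2 x2] := frame_covector_axis Bz z1.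
have dl := smooth_on_differentiable sl Bz; have dX := smooth_on_differentiable sX Bz.
have E : dot (l z) (pderive 1 X z) = - dot (pderive 1 l z) (X z).
  apply/eqP; rewrite -addr_eq0 addrC -(derive_dot _ dl dX); apply/eqP.
  rewrite -[RHS](derive_cst (0 : R) z (delta_mx 0 1)).
  by apply: (pderive_ext 1 oB _ Bz) => y By; exact: lX.
have dotl (a b : R) (w u v : 'rV[R]_3) : dot w (a *: u + b *: v) = a * dot w u + b * dot w v.
  by rewrite dotDr !dotZr.
rewrite E [X in dot _ X](frame_vectorE Bz) sum3E x2 scale0r addr0 dotl.
have P0 := pderive_frame_covector 0 Bz z1; have P1 := pderive_frame_covector 1 Bz z1.
have sc1 : smooth_on B (fun z : 'rV[R]_2 => z ord0 1) by exact: smooth_on_coord.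
have D0 : pderive 1 (frame_covector 0) z = 0.
  have E0 y : B y -> frame_covector 0 y = - (y ord0 1 * (y ord0 1 * (y ord0 1 * (pderive 0 Qf y * frame_covector i2 y)))).
    move=> By; have := frame_covector_lift (delta_mx 0 0) By.
    rewrite sum3E (normal_map_derive r1 sQ _ By) pt3_0 pt3_1 pt3_2 !mxE /= /pderive -/Qf.
    move: (frame_covector 0 y) (frame_covector 1 y) (frame_covector i2 y) ('D_(delta_mx 0 0) Qf y) (Q (fold y)) (y ord0 1).
    move=> a b c q' q v h; transitivity (a - 0); first by rewrite subr0.
    by rewrite -[X in a - X]h; ring.
  rewrite (pderive_ext 1 oB E0 Bz); pose S y := pderive 0 Qf y * frame_covector i2 y.
  have sS : smooth_on B S.
    by apply: smooth_onM => //; [exact: pderive_smooth|exact: frame_covector_smooth].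
  have sS2 : smooth_on B (fun y => y ord0 1 * (y ord0 1 * S y)).
    by apply: smooth_onM => //; exact: smooth_onM.
  have d2 := smooth_on_differentiable sS2 Bz; have dc := smooth_on_differentiable sc1 Bz.
  rewrite /pderive deriveN; last by apply: diff_derivable; exact: differentiableM.
  rewrite [X in - X](deriveM (diff_derivable dc) (diff_derivable d2)) z1.
  by rewrite scale0r mul0r scale0r addr0 oppr0.
have D1 : pderive 1 (frame_covector 1) z = - (3 / 2 * (Qf z * frame_covector i2 z)).
  rewrite (pderive_ext 1 oB frame_covector1 Bz).
  pose S y := (3 * Qf y + y ord0 1 * pderive 1 Qf y) * frame_covector i2 y.
  have sS : smooth_on B S.
    apply: smooth_onM => //; last exact: frame_covector_smooth.
    apply: smooth_onD => //; first by apply: smooth_onM => //; exact: smooth_on_cst.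
    by apply: smooth_onM => //; exact: pderive_smooth.
  have dS := smooth_on_differentiable sS Bz.
  have s3 : smooth_on B (fun y => y ord0 1 * S y) by exact: smooth_onM oB sc1 sS.
  have d3 := diff_derivable (smooth_on_differentiable s3 Bz) (v := delta_mx 0 1).
  have -> : (fun y : 'rV[R]_2 => - (2^-1 * (y ord0 1 * S y))) =
      (- 2^-1) \*: (fun y : 'rV[R]_2 => y ord0 1 * S y).
    by apply/funext => y; rewrite -mulNr.
  rewrite [LHS](deriveZ _ d3) [X in _ *: X](pderive_mul_coord1 dS) z1 mul0r addr0.
  by rewrite /S z1 mul0r addr0 /GRing.scale /=; field.
have Qz : Qf z = Q (pt (z ord0 0) 0) by rewrite /Qf /= /fold z1 expr0n.
rewrite Qz in D1.
have alg (a b c q d0 d1 : R) : d0 = 0 -> d1 = - (3 / 2 * (q * c)) ->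
    - (a * d0 + b * d1) = 3 / 2 * c * b * q.
  by move=> -> ->; field.
exact: (alg _ _ _ _ _ _ (etrans (esym P0) D0) (etrans (esym P1) D1)).
Qed.

Lemma frame_vector_axis_neq0 z : B z -> z ord0 1 = 0 ->
  ~ (exists v, X z = 'D_v (W \o H) z) -> frame_vector z ord0 1 != 0.
Proof.
move=> Bz z1 nX; apply/eqP => x1; apply: nX.
have [_ _ _ x2] := frame_covector_axis Bz z1.
exists (frame_vector z ord0 0 *: delta_mx 0 0).
rewrite [LHS](frame_vectorE Bz) [RHS](derive_chain _ (dH Bz) (dW Bz)) !sum3E x1 x2.
rewrite (normal_map_derive r1 sQ _ Bz) pt3_0 pt3_1 pt3_2 z1 !mxE /=.
have alg (u v w : 'rV[R]_3) (a q d : R) : a *: u + 0 *: v + 0 *: w = (a * 1) *: u +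
    (2 * 0 * (a * 0)) *: v + (3 * 0 ^+ 2 * (a * 0) * q + 0 ^+ 3 * d) *: w.
  by rewrite mulr1 !mulr0 !mul0r expr0n mul0r addr0.
exact: alg.
Qed.

End NullDerivative.

Section AlongCurve.
Context {R : realType}.

(** A frontal read in a chart of the target: [l] and [X] collect the components
    of the lift and of the transversal field, and [dot] is their pairing. *)
Record frontal_data (U : set 'rV[R]_2) (F l X : 'rV[R]_2 -> 'rV[R]_3) (eps : R)
    (gamma eta : R -> 'rV[R]_2) : Prop := FrontalData {
  fd_open : open U;
  fd_base : U (gamma 0);
  fd_map : smooth_on U F;
  fd_lift : smooth_on U l;
  fd_field : smooth_on U X;
  fd_lift_neq0 : forall q, U q -> l q != 0;
  fd_lift_map : forall q w, U q -> dot (l q) ('D_w F q) = 0;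
  fd_lift_field : forall q, U q -> dot (l q) (X q) = 0;
  fd_eps : 0 < eps;
  fd_curve : smooth_on (`]- eps, eps[) gamma;
  fd_null : smooth_on (`]- eps, eps[) eta;
  fd_velocity : derive1 gamma 0 != 0;
  fd_null_neq0 : forall t : R, t \in `]- eps, eps[ -> eta t != 0;
  fd_null_map : forall t : R, t \in `]- eps, eps[ -> U (gamma t) -> 'D_(eta t) F (gamma t) = 0;
  fd_transversal : ~ (exists w, X (gamma 0) = 'D_w F (gamma 0)) }.

Section Coordinates.
Variables (U : set 'rV[R]_2) (F l X : 'rV[R]_2 -> 'rV[R]_3) (eps : R) (gamma eta : R -> 'rV[R]_2).
Hypothesis fd : frontal_data U F l X eps gamma eta.
Variables (phi phi' : 'rV[R]_2 -> 'rV[R]_2) (A B : set 'rV[R]_2).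
Hypotheses (oA : open A) (oB : open B) (sphi : smooth_on A phi) (sphi' : smooth_on B phi').
Hypotheses (Ap : A (gamma 0)) (phip : phi (gamma 0) = 0).
Hypothesis (AB : forall z, A z -> [/\ U z, B (phi z) & phi' (phi z) = z]).
Hypothesis (BA : forall z, B z -> A (phi' z) /\ phi (phi' z) = z).
Variables (W V : 'rV[R]_3 -> 'rV[R]_3) (AW BW : set 'rV[R]_3).
Hypotheses (oAW : open AW) (oBW : open BW) (sW : smooth_on AW W) (sV : smooth_on BW V).
Hypothesis (WK : forall y, AW y -> BW (W y) /\ V (W y) = y).
Hypothesis (VK : forall y, BW y -> AW (V y) /\ W (V y) = y).
Variables (Q : 'rV[R]_2 -> R) (r : R).
Hypotheses (r0 : 0 < r) (r1 : r <= 1) (sQ : smooth_on (ball 0 r) Q).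
Let D : set 'rV[R]_2 := ball (0 : 'rV[R]_2) r.
Let oD : open D := ball_open _ r.
Let H := normal_map Q.
Hypothesis (DB : forall z, D z -> B z).
Hypothesis (HAW : forall z, D z -> AW (H z)).
Hypothesis (FW : forall z, D z -> F (phi' z) = W (H z)).

Let sH : smooth_on D H := normal_map_smooth r1 sQ.
Let D0 : D 0 := ballxx _ r0.
Let sphiD : smooth_on D phi' := smooth_on_subset DB sphi'.

Let DU z : D z -> U (phi' z).
Proof. by move=> /DB/BA[/AB[]]. Qed.

Let lp := l \o phi'.
Let Xp := X \o phi'.

Let sl : smooth_on D lp.
Proof. exact: (smooth_on_comp (f := phi') (g := l) oD (fd_open fd) DU sphiD (fd_lift fd)). Qed.

Let sX : smooth_on D Xp.
Proof. exact: (smooth_on_comp (f := phi') (g := X) oD (fd_open fd) DU sphiD (fd_field fd)). Qed.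

Lemma derive_source z v : D z -> 'D_v (W \o H) z = 'D_('D_v phi' z) F (phi' z).
Proof.
move=> Dz; rewrite -(derive_comp _ (smooth_on_differentiable sphiD Dz)
  (smooth_on_differentiable (fd_map fd) (DU Dz))).
apply: near_eq_derive; near=> w.
by rewrite /= -FW//; near: w; exact: open_nbhs_nbhs.
Unshelve. all: by end_near. Qed.

Let l0 z : D z -> lp z != 0.
Proof. by move=> /DU; exact: (fd_lift_neq0 fd). Qed.

Let lG z v : D z -> dot (lp z) ('D_v (W \o H) z) = 0.
Proof. by move=> Dz; rewrite derive_source//; apply: (fd_lift_map fd); exact: DU. Qed.

Let lX z : D z -> dot (lp z) (Xp z) = 0.
Proof. by move=> Dz; apply: (fd_lift_field fd); exact: DU. Qed.

Let c2 := frame_covector Q W lp i2.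
Let x1 z := frame_vector Q W V Xp z ord0 1.

Let J : set R := [set t | [/\ t \in `]- eps, eps[, A (gamma t) & D (phi (gamma t))]].

Let J0 : J 0.
Proof. by split=> //=; [rewrite in_itv /= oppr_lt0 !(fd_eps fd)|rewrite phip]. Qed.

Let oI : open ([set` `]- eps, eps[] : set R). Proof. exact: interval_open. Qed.

Let oJ : open J.
Proof.
have -> : J = [set` `]- eps, eps[] `&` gamma @^-1` (A `&` phi @^-1` D).
  by apply/seteqP; split=> t /= => [[? ? ?]|[? [? ?]]].
exact: open_smooth_preimage oI (fd_curve fd) (open_smooth_preimage oA sphi oD).
Qed.

Let JI t : J t -> t \in `]- eps, eps[. Proof. by case. Qed.
Let JA t : J t -> A (gamma t). Proof. by case. Qed.
Let JD t : J t -> D (phi (gamma t)). Proof. by case. Qed.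

Let zt := phi \o gamma.
Let vt t := 'D_(eta t) phi (gamma t).

Let sgamma : smooth_on J gamma := smooth_on_subset JI (fd_curve fd).
Let szt : smooth_on J zt.
Proof. exact: (smooth_on_comp (f := gamma) (g := phi) oJ oA JA sgamma sphi). Qed.

Let svt j : smooth_on J (fun t => vt t ord0 j).
Proof.
have seta : smooth_on J eta := smooth_on_subset JI (fd_null fd).
have := smooth_derive_along (g := gamma) (X := eta) (f := phi) oJ oA JA sgamma seta sphi.
by move/(smooth_on_coordinates _ oJ).
Qed.

Let derive_phi' t : J t -> 'D_(vt t) phi' (zt t) = eta t.
Proof.
move=> Jt; apply: (derive_local_inverse _ oA sphi sphi' _ (JA Jt)).
by move=> z /AB[].
Qed.

(** The null direction of [F] is that of the normal form, in the new coordinates. *)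
Lemma curve_axis t : J t -> [/\ zt t ord0 1 = 0, vt t ord0 0 = 0 & vt t ord0 1 != 0].
Proof.
move=> Jt; have Dz := JD Jt.
have v0 : vt t != 0.
  apply: contraNneq (fd_null_neq0 fd (JI Jt)) => v0.
  by rewrite -(derive_phi' Jt) v0 derive0.
apply: (normal_map_kernel r1 sQ Dz _ v0).
have e : phi' (zt t) = gamma t by have [] := AB (JA Jt).
have WH0 : 'D_(vt t) (W \o H) (zt t) = 0.
  rewrite derive_source// derive_phi'// e; apply: (fd_null_map fd (JI Jt)).
  by have [] := AB (JA Jt).
have dH := smooth_on_differentiable sH Dz.
have dW : differentiable W (H (zt t)) by apply: smooth_on_differentiable sW _; exact: HAW.
rewrite (derive_comp _ dH dW) in WH0.
by rewrite -(derive_local_inverse ('D_(vt t) H (zt t)) oAW sW sV WK (HAW Dz)) WH0 derive0.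
Qed.

Let m t := vt t ord0 1 * (3 / 2 * c2 (zt t) * x1 (zt t)).
Let s t := zt t ord0 0.

(** The null vector at [gamma t] is a nonzero multiple of [d/dv] in the coordinates of the
    normal form. *)
Lemma null_derivative_curve t : J t ->
  dot (l (gamma t)) ('D_(eta t) X (gamma t)) = m t * Q (pt (s t) 0).
Proof.
move=> Jt; have Dz := JD Jt; have [z1 v0 v1] := curve_axis Jt.
have e : phi' (zt t) = gamma t by have [] := AB (JA Jt).
have dX : differentiable X (phi' (zt t)) by apply: smooth_on_differentiable (fd_field fd) (DU Dz).
have dp := smooth_on_differentiable sphiD Dz.
rewrite -(derive_phi' Jt) -e -(derive_comp _ dp dX).
have -> : vt t = vt t ord0 1 *: delta_mx 0 1.
  by apply/rowP; apply: ord2_ind; rewrite !mxE ?v0 /= ?mulr0 ?mulr1.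
rewrite (derive_scale_dir _ _ (smooth_on_differentiable sX Dz)) dotZr -mulrA; congr (_ * _).
have h := null_derivative_axis r1 sQ oAW oBW sW sV WK VK HAW sl sX l0 lG lX Dz z1.
exact: h.
Qed.

Let smc : smooth_on J m.
Proof.
have sc2 : smooth_on D c2 := frame_covector_smooth r1 sQ oAW sW HAW sl i2.
have sx1 : smooth_on D x1 := frame_vector_smooth r1 sQ oAW oBW sW sV WK HAW sX 1.
have sc2t : smooth_on J (c2 \o zt) := smooth_on_comp_real (f := zt) (g := c2) oJ JD szt sc2.
have sx1t : smooth_on J (x1 \o zt) := smooth_on_comp_real (f := zt) (g := x1) oJ JD szt sx1.
exact: (smooth_onM oJ (svt 1) (smooth_onM oJ (smooth_onM oJ (smooth_on_cst _ _) sc2t) sx1t)).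
Qed.

Let z0 : zt 0 = 0. Proof. exact: phip. Qed.
Let z01 : zt 0 ord0 1 = 0. Proof. by rewrite z0 mxE. Qed.

Let m0 : m 0 != 0.
Proof.
have [_ _ v1] := curve_axis J0; have Dz : D (zt 0) := JD J0.
have [_ _ c20 _] := frame_covector_axis r1 sQ oAW oBW sW sV WK VK HAW (X := Xp) sl l0 lG lX Dz z01.
have x10 : x1 (zt 0) != 0.
  apply: (frame_vector_axis_neq0 r1 sQ oAW oBW sW sV WK VK HAW sl l0 lG lX Dz z01).
  move=> [v Xv]; apply: (fd_transversal fd); exists ('D_v phi' (zt 0)).
  have e : phi' (zt 0) = gamma 0 by have [] := AB Ap.
  by rewrite -e -(derive_source _ Dz) -Xv.
by rewrite /m !mulf_neq0// invr_eq0 pnatr_eq0.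
Qed.

Let dphi : differentiable phi (gamma 0) := smooth_on_differentiable sphi Ap.
Let dgamma : differentiable gamma 0 := smooth_on_differentiable sgamma J0.
Let dzt : differentiable zt 0 := smooth_on_differentiable szt J0.

Let derive_zt : 'D_1 zt 0 = 'D_(derive1 gamma 0) phi (gamma 0).
Proof. by rewrite derive1E [LHS](derive_comp _ dgamma dphi). Qed.

Let derive_zt1 : 'D_1 zt 0 ord0 1 = 0.
Proof.
rewrite -(derive_coordinates _ _ dzt) -[RHS](derive_cst (0 : R) (0 : R) 1).
apply: near_eq_derive; near=> t.
have Jt : J t by near: t; exact: open_nbhs_nbhs.
by have [] := curve_axis Jt.
Unshelve. all: by end_near. Qed.

Let derive_zt0 : 'D_1 zt 0 ord0 0 != 0.
Proof.
apply: contraNneq (fd_velocity fd) => d0.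
have D0' : 'D_(derive1 gamma 0) phi (gamma 0) = 0.
  by rewrite -derive_zt; apply/rowP; apply: ord2_ind; rewrite mxE.
have AB' z : A z -> B (phi z) /\ phi' (phi z) = z by move=> /AB[].
by rewrite -(derive_local_inverse (derive1 gamma 0) oA sphi sphi' AB' Ap) D0' derive0.
Qed.

(** The null direction [(0, k)] is transversal to the tangent [(s', 0)] of the axis. *)
Lemma curve_transversal : row_free (col_mx (eta 0) (derive1 gamma 0)).
Proof.
have [_ v0 v1] := curve_axis J0.
apply/inj_row_free => w; rewrite -[w]hsubmxK mul_row_col.
set a := lsubmx w; set b := rsubmx w.
rewrite [a]mx11_scalar [b]mx11_scalar !mul_scalar_mx => ab.
have : a 0 0 *: vt 0 + b 0 0 *: 'D_1 zt 0 = 0.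
  rewrite derive_zt /vt !deriveE// -!linearZ -linearD ab linear0 //.
move: v0 v1 derive_zt0 derive_zt1; move: (vt 0) ('D_1 zt 0) => v w' v0 v1 w0 w1.
move=> /rowP h; have := h 0; have := h 1.
rewrite !mxE v0 w1 !mulr0 add0r addr0.
move=> /eqP; rewrite mulf_eq0 (negbTE v1) orbF => /eqP a0.
move=> /eqP; rewrite mulf_eq0 (negbTE w0) orbF => /eqP b0.
by rewrite a0 b0 raddf0 -[RHS]hsubmxK !raddf0.
Qed.

Lemma null_derivative_germ (psi : R -> R) :
  (\forall t \near 0, psi t = dot (l (gamma t)) ('D_(eta t) X (gamma t))) ->
  (psi 0 = 0 <-> Q 0 = 0) /\ (Q 0 = 0 -> derive1 psi 0 != 0 <-> pderive 0 Q 0 != 0).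
Proof.
move=> psiE; pose q (t : R) := Q (pt (s t) 0).
have s0 : pt (s 0) 0 = 0 by rewrite /s z0 mxE [RHS]ptE !mxE.
have psim : \forall t \near 0, psi t = (m * q) t.
  near=> t; have Jt : J t by near: t; exact: open_nbhs_nbhs.
  transitivity (dot (l (gamma t)) ('D_(eta t) X (gamma t))); first by near: t.
  exact: null_derivative_curve Jt.
split.
  have -> : psi 0 = m 0 * Q 0 by rewrite (nbhs_singleton psim) mulrfctE /q s0.
  split=> [/eqP|->]; last by rewrite mulr0.
  by rewrite mulf_eq0 (negbTE m0) => /eqP.
move=> Q0; rewrite derive1E (near_eq_derive _ psim).
have dm : differentiable m 0 := smooth_on_differentiable smc J0.
pose sp := (fun t : R => pt (s t) 0).
have dsp : differentiable sp 0.
  apply/differentiable_coordinates; apply: ord2_ind => /=.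
    under eq_fun do rewrite mxE /=.
    by move: dzt => /differentiable_coordinates /(_ 0).
  by under eq_fun do rewrite mxE /=; exact: differentiable_cst.
have dQ : differentiable Q (sp 0).
  by rewrite /sp s0; apply: smooth_on_differentiable sQ _; exact: ballxx.
have dq : differentiable q 0 by exact: (differentiable_comp dsp dQ).
have Dsp : 'D_1 sp 0 = 'D_1 zt 0 ord0 0 *: delta_mx 0 0.
  apply/rowP; apply: ord2_ind; rewrite -(derive_coordinates _ _ dsp) !mxE /=.
    rewrite mulr1 -(derive_coordinates _ _ dzt).
    by have -> : (fun y => sp y ord0 0) = (fun y => zt y ord0 0) by apply/funext => t; rewrite mxE.
  rewrite mulr0 -[RHS](derive_cst (0 : R) (0 : R) 1).
  by have -> : (fun y => sp y ord0 1) = (fun=> 0) by apply/funext => t; rewrite mxE.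
have Dq : 'D_1 q 0 = 'D_1 zt 0 ord0 0 * pderive 0 Q 0.
  rewrite [LHS](derive_comp _ dsp dQ) Dsp; have e : sp 0 = 0 by exact: s0.
  by rewrite e in dQ *; exact: (derive_scale_dir _ _ dQ).
rewrite (deriveM (diff_derivable dm) (diff_derivable dq)) Dq /q s0 Q0 scale0r addr0.
have neq (a b c : R) : a != 0 -> b != 0 -> a *: (b * c) != 0 <-> c != 0.
  by move=> a0 b0; rewrite /GRing.scale /= !mulf_eq0 (negbTE a0) (negbTE b0).
exact: neq.
Unshelve. all: by end_near. Qed.

End Coordinates.

(** On the singular curve the null derivative is [m(t) Q(s(t), 0)], where [m] does not vanish
    and [s] is a local parameter of the axis, so its zeros are those of [Q]. *)
Theorem normal_form_criterion (U : set 'rV[R]_2) (F l X : 'rV[R]_2 -> 'rV[R]_3) (eps : R)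
    (gamma eta : R -> 'rV[R]_2) (phi phi' : 'rV[R]_2 -> 'rV[R]_2)
    (W V : 'rV[R]_3 -> 'rV[R]_3) (Q : 'rV[R]_2 -> R) (d : R) (psi : R -> R) :
  frontal_data U F l X eps gamma eta ->
  local_inverse phi phi' (gamma 0) 0 -> local_inverse W V 0 (F (gamma 0)) ->
  0 < d -> smooth_on (ball 0 d) Q ->
  (\forall z \near (0 : 'rV[R]_2), F (phi' z) = W (normal_map Q z)) ->
  (\forall t \near (0 : R), psi t = dot (l (gamma t)) ('D_(eta t) X (gamma t))) ->
  [/\ row_free (col_mx (eta 0) (derive1 gamma 0)), psi 0 = 0 <-> Q 0 = 0 &
      Q 0 = 0 -> derive1 psi 0 != 0 <-> pderive 0 Q 0 != 0].
Proof.
move=> fd lphi [AW [BW [[oAW oBW] [AW0 _] [sW sV] WK VK]]] d0 sQ FW psiE.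
have [A [B [[oA oB] [Ap phip] [sphi sphi'] AB BA]]] :=
  local_inverse_restrict (fd_open fd) (fd_base fd) lphi.
pose e := Num.min d 1.
have e0 : 0 < e by rewrite lt_min d0 ltr01.
have sQe : smooth_on (ball (0 : 'rV[R]_2) e) Q.
  by apply: smooth_on_subset sQ => z; apply: le_ball; rewrite ge_min lexx.
have e1 : e <= 1 by rewrite ge_min lexx orbT.
have H0 : normal_map Q 0 = 0.
  by apply/rowP; apply: ord3_ind; rewrite !mxE /= ?mxE ?expr0n ?mul0r.
have nB : \forall z \near (0 : 'rV[R]_2), B z.
  by apply: open_nbhs_nbhs; split=> //; rewrite -phip; case: (AB _ Ap).
have nA : \forall z \near (0 : 'rV[R]_2), AW (normal_map Q z).
  apply: (near_preimage _ oAW); last by rewrite H0.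
  by apply: (smooth_on_continuous (normal_map_smooth e1 sQe)); exact: ballxx.
have [a a0 HA] := near_ballW (near_and3 nB nA FW).
pose r := Num.min e a.
have r0 : 0 < r by rewrite lt_min e0.
have r1 : r <= 1 by rewrite ge_min e1.
have ra z : ball (0 : 'rV[R]_2) r z -> ball (0 : 'rV[R]_2) a z.
  by apply: le_ball; rewrite ge_min lexx orbT.
have sQr : smooth_on (ball (0 : 'rV[R]_2) r) Q.
  by apply: smooth_on_subset sQe => z; apply: le_ball; rewrite ge_min lexx.
have DB z : ball (0 : 'rV[R]_2) r z -> B z by move=> /ra/HA[].
have HAW z : ball (0 : 'rV[R]_2) r z -> AW (normal_map Q z) by move=> /ra/HA[].
have FWr z : ball (0 : 'rV[R]_2) r z -> F (phi' z) = W (normal_map Q z) by move=> /ra/HA[].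
have [p1 p2] := null_derivative_germ fd oA sphi sphi' Ap phip AB BA oAW oBW sW sV WK VK
  r0 r1 sQr DB HAW FWr psiE.
split=> //.
exact: (curve_transversal fd oA sphi sphi' Ap phip AB BA oAW sW sV WK r0 r1 sQr DB HAW FWr).
Qed.
End AlongCurve.

(** * Normal form of a frontal at a non-degenerate singular point *)

Section SquareRoot.
Context {R : realType}.

Lemma smooth_sqrt : smooth_on [set x : R | 0 < x] (@Num.sqrt R).
Proof.
have o : open [set x : R | 0 < x] by exact: open_gt.
have d (x : R) : 0 < x -> differentiable (@Num.sqrt R) x.
  by move=> x0; apply/derivable1_diffP; have [] := is_derive1_sqrt x0.
elim=> [|k IH]; first by move=> x _; exact: sqrt_continuous.
split=> [x|v]; first exact: d.
apply: (@Ck_ext _ _ _ _ _ (fun x => v * (2 * Num.sqrt x)^-1)) => // [x /= x0|].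
  rewrite (derive_derive1 _ (d x x0)) derive1E; congr (_ *: _).
  by have [_ ->] := is_derive1_sqrt x0.
apply: CkM => //; first exact: Ck_cst.
have C2 : Ck k [set x : R | 0 < x] (fun x => 2 * Num.sqrt x) by apply: CkM => //; exact: Ck_cst.
apply: (Ck_comp1 (f := fun x => 2 * Num.sqrt x) (g := GRing.inv) o (open_neq0 (R := R)) _ C2).
  by move=> x /= x0; rewrite mulf_neq0// gt_eqF// sqrtr_gt0.
exact: smooth_inv.
Qed.

End SquareRoot.

Section CoordinateFactors.
Context {R : realType}.
Implicit Types (z : 'rV[R]_2) (A : set 'rV[R]_2).

(** As [g x = 0], the increment of [k] is multiplied by [g = O(y - x)] and does not contribute
    to the first order: continuity of [k] is enough. *)
Lemma diff_continuous_mul (V : normedModType R) (h k g : V -> R) x w :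
  (\forall y \near x, h y = k y * g y) -> {for x, continuous k} ->
  differentiable g x -> g x = 0 -> 'd h x w = k x * 'd g x w.
Proof.
move=> hkg ck dg g0; have h0 : h x = 0 by rewrite (nbhs_singleton hkg) g0 mulr0.
have clin : continuous (k x \*: 'd g x : V -> R).
  by move=> y; apply: cvgZr; exact: diff_continuous.
suff [_ ->] : differentiable h x /\ 'd h x = (k x \*: 'd g x : {linear V -> R}) :> (V -> R).
  by [].
apply: differentiable_estimate => // e e0.
have [C C0 LC] := linear_lipschitz (diff_continuous dg).
have C1 : 0 < C + 1 by rewrite addr_gt0.
pose K := `|k x| + 1; have K1 : 0 < K by rewrite ltr_wpDl.
have e1 : 0 < e / (2 * (C + 1)) by rewrite divr_gt0// mulr_gt0.
have e2 : 0 < e / (2 * K) by rewrite divr_gt0// mulr_gt0.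
have H1 : \forall y \near (0 : V), `|k (y + x) - k x| <= e / (2 * (C + 1)).
  apply/(near_shift_to0 x (fun y => `|k y - k x| <= _)); have /continuous_estimate/(_ _ e1) := ck.
  by apply: filterS => y /ltW; rewrite distrC.
have H2 := estimate_of_differentiable dg e2.
have H3 := estimate_of_differentiable dg ltr01.
near=> y.
have hy : h (y + x) = k (y + x) * g (y + x) by near: y; apply/(near_shift_to0 x (fun y => h y = _ * _)).
have ky : `|k (y + x) - k x| <= e / (2 * (C + 1)) by near: y.
have gy : `|g (y + x) - g x - 'd g x y| <= e / (2 * K) * `|y| by near: y.
have gy1 : `|g (y + x) - g x - 'd g x y| <= 1 * `|y| by near: y.
rewrite g0 subr0 mul1r in gy gy1; rewrite hy h0 subr0 /=.
have gC : `|g (y + x)| <= (C + 1) * `|y|.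
  rewrite -[g _](subrK ('d g x y)) mulrDl mul1r addrC.
  by apply: le_trans (ler_normD _ _) _; apply: lerD => //; exact: LC.
have -> : k (y + x) * g (y + x) - k x *: 'd g x y =
    (k (y + x) - k x) * g (y + x) + k x * (g (y + x) - 'd g x y).
  by rewrite /GRing.scale /=; ring.
apply: le_trans (ler_normD _ _) _; rewrite !normrM.
have -> : e * `|y| = e / (2 * (C + 1)) * ((C + 1) * `|y|) + K * (e / (2 * K) * `|y|).
  by field; rewrite !gt_eqF.
apply: lerD; apply: ler_pM => //.
by rewrite /K lerDl.
Unshelve. all: by end_near. Qed.

(** The first quotient by [v] still vanishes on the axis, where it equals [g_v]. *)
Lemma hadamard2 (g : 'rV[R]_2 -> R) (r : R) : smooth_on (ball 0 r) g ->
  (forall z, ball 0 r z -> g (pt (z ord0 0) 0) = 0) ->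
  (forall z, ball 0 r z -> pderive 1 g (pt (z ord0 0) 0) = 0) ->
  exists2 k, smooth_on (ball 0 r) k & forall z, ball 0 r z -> g z = z ord0 1 ^+ 2 * k z.
Proof.
move=> sg g0 g1; have oB : open (ball (0 : 'rV[R]_2) r) by exact: ball_open.
have [h sh gh] := hadamard sg g0.
have h0 z : ball 0 r z -> h (pt (z ord0 0) 0) = 0.
  move=> Bz; set y := pt _ _; have By : ball (0 : 'rV[R]_2) r y := ball_axis Bz.
  rewrite -(g1 z Bz) -/y (pderive_ext 1 oB gh By).
  rewrite (pderive_mul_coord1 (smooth_on_differentiable sh By)).
  by rewrite /y pt1 mul0r addr0.
have [k sk hk] := hadamard sh h0; exists k => // z Bz.
by rewrite gh// hk// mulrA.
Qed.

End CoordinateFactors.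

Section Triple.
Context {R : realType}.
Implicit Types (a b c : 'rV[R]_3).

Definition triple a b c : R := \det (\matrix_(i < 3) nth a [:: a; b; c] i).

Lemma tripleE a b c : triple a b c =
  a ord0 0 * (b ord0 1 * c ord0 i2 - b ord0 i2 * c ord0 1)
  - a ord0 1 * (b ord0 0 * c ord0 i2 - b ord0 i2 * c ord0 0)
  + a ord0 i2 * (b ord0 0 * c ord0 1 - b ord0 1 * c ord0 0).
Proof.
rewrite /triple (expand_det_row _ 0) sum3E /cofactor !mxE /=.
rewrite !(expand_det_row _ 0) !big_ord_recl !big_ord0 /cofactor !det_mx11 !mxE /=.
have L (i : 'I_3) (j : 'I_2) (k : 'I_3) : bump i j = k -> lift i j = k by move=> h; exact: val_inj.
rewrite (L 0 ord0 1)// (L 1 ord0 0)// (L i2 ord0 0)//.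
rewrite (L 0 (lift ord0 0) i2)// (L 1 (lift ord0 0) i2)// (L i2 (lift ord0 0) 1)//.
rewrite (L 0 (lift (lift ord0 ord0) 0) 1)// (L 1 (lift (lift ord0 ord0) 0) 0)//.
rewrite (L i2 (lift (lift ord0 ord0) 0) 0)//.
rewrite (_ : 1 %% 3 = 1)%N// /bump /=; ring.
Qed.

Lemma triple_row1 a b c x y z : triple (x *: a + y *: b + z *: c) b c = x * triple a b c.
Proof. rewrite !tripleE !mxE; ring. Qed.

Lemma triple_row2 a b c x y z : triple a (x *: a + y *: b + z *: c) c = y * triple a b c.
Proof. rewrite !tripleE !mxE; ring. Qed.

Lemma triple_row3 a b c x y z : triple a b (x *: a + y *: b + z *: c) = z * triple a b c.
Proof. rewrite !tripleE !mxE; ring. Qed.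

Lemma triple_free a b c x y z : triple a b c != 0 ->
  x *: a + y *: b + z *: c = 0 -> [/\ x = 0, y = 0 & z = 0].
Proof.
move=> abc xyz.
have := triple_row1 a b c x y z; have := triple_row2 a b c x y z.
have := triple_row3 a b c x y z.
have t0 : [/\ triple 0 b c = 0, triple a 0 c = 0 & triple a b 0 = 0].
  by split; rewrite tripleE !mxE; ring.
have [t1 t2 t3] := t0; rewrite xyz t1 t2 t3.
do 3! (move=> /esym/eqP; rewrite mulf_eq0 (negbTE abc) orbF => /eqP ?).
by [].
Qed.

Lemma triple_mix a b c x y x' y' :
  triple (x *: a + y *: b) (x' *: a + y' *: b) c = (x * y' - y * x') * triple a b c.
Proof. rewrite !tripleE !mxE; ring. Qed.

Lemma triple_scale2 a b c k : triple a (k *: b) c = k * triple a b c.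
Proof. rewrite !tripleE !mxE; ring. Qed.

Lemma triple_continuous (V : normedModType R) (f g h : V -> 'rV[R]_3) x :
  {for x, continuous f} -> {for x, continuous g} -> {for x, continuous h} ->
  {for x, continuous (fun y => triple (f y) (g y) (h y))}.
Proof.
move=> cf cg ch; 
have -> : (fun y => triple (f y) (g y) (h y)) = (fun y =>
    f y ord0 0 * (g y ord0 1 * h y ord0 i2 - g y ord0 i2 * h y ord0 1)
  - f y ord0 1 * (g y ord0 0 * h y ord0 i2 - g y ord0 i2 * h y ord0 0)
  + f y ord0 i2 * (g y ord0 0 * h y ord0 1 - g y ord0 1 * h y ord0 0)).
  by apply/funext => y; rewrite tripleE.
have cc (k : V -> 'rV[R]_3) j : {for x, continuous k} -> {for x, continuous (fun y => k y ord0 j)}.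
  move=> ck; apply: (continuous_comp (g := fun z : 'rV[R]_3 => z ord0 j) ck).
  exact: coord_continuous'.
have cM (p q : V -> R) : {for x, continuous p} -> {for x, continuous q} ->
    {for x, continuous (fun y => p y * q y)} by move=> cp cq; exact: continuousM.
have cB (p q : V -> R) : {for x, continuous p} -> {for x, continuous q} ->
    {for x, continuous (fun y => p y - q y)} by move=> cp cq; exact: continuousB.
have cD (p q : V -> R) : {for x, continuous p} -> {for x, continuous q} ->
    {for x, continuous (fun y => p y + q y)} by move=> cp cq; exact: continuousD.
have cgh i j : {for x, continuous (fun y => g y ord0 i * h y ord0 j - g y ord0 j * h y ord0 i)}.
  by apply: cB; apply: cM; exact: cc.
have cfgh k i j : {for x, continuous
    (fun y => f y ord0 k * (g y ord0 i * h y ord0 j - g y ord0 j * h y ord0 i))}.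
  by apply: (cM _ _ _ (cgh i j)); exact: cc.
exact: (cD _ _ (cB _ _ (cfgh 0 1 i2) (cfgh 1 0 i2)) (cfgh i2 0 1)).
Qed.

End Triple.

Section NullCoordinates.
Context {R : realType}.
Variables (U : set 'rV[R]_2) (F l X : 'rV[R]_2 -> 'rV[R]_3) (eps : R) (gamma eta : R -> 'rV[R]_2).
Hypothesis fd : frontal_data U F l X eps gamma eta.
Hypothesis transversal : row_free (col_mx (eta 0) (derive1 gamma 0)).

Let I : set R := [set` `]- eps, eps[].
Let oI : open I. Proof. exact: interval_open. Qed.
Let I0 : I 0. Proof. by rewrite /I /= in_itv /= oppr_lt0 !(fd_eps fd). Qed.

Let strip : set 'rV[R]_2 := [set z | I (z ord0 0)].
Let ostrip : open strip.
Proof.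
have := @open_preimage_on R 'rV[R]_2 R setT (fun z => z ord0 0) I openT.
rewrite setTI; apply; last exact: oI.
by move=> x _; exact: coord_continuous'.
Qed.

Let sstrip (g : R -> 'rV[R]_2) : smooth_on I g ->
  smooth_on strip (fun z : 'rV[R]_2 => g (z ord0 0)).
Proof.
move=> sg; apply/smooth_on_coordinates => // j.
apply: (@smooth_on_comp1 _ _ _ I (fun z : 'rV[R]_2 => z ord0 0) (fun t => g t ord0 j)) => //.
  exact: smooth_on_coord.
by move: j; apply/smooth_on_coordinates.
Qed.

(** Coordinates in which the singular curve is [v = 0] and [d/dv] is null along it. *)
Definition null_chart (z : 'rV[R]_2) : 'rV[R]_2 := gamma (z ord0 0) + z ord0 1 *: eta (z ord0 0).

Lemma null_chart_smooth : smooth_on strip null_chart.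
Proof.
apply: smooth_onD => //; first exact: (sstrip (fd_curve fd)).
apply/smooth_on_coordinates => // j.
apply: (@smooth_on_ext _ _ _ _ (fun z : 'rV[R]_2 => z ord0 1 * eta (z ord0 0) ord0 j)) => //.
  by move=> z _; rewrite mxE.
apply: smooth_onM => //; first exact: smooth_on_coord.
have := sstrip (fd_null fd); move/(smooth_on_coordinates _ ostrip); exact.
Qed.

Lemma null_chart_derive1 z : strip z -> pderive 1 null_chart z = eta (z ord0 0).
Proof.
move=> Sz; have e : forall h : R, null_chart (h *: delta_mx 0 1 + z) = null_chart z + h *: eta (z ord0 0).
  by move=> h; rewrite /null_chart !mxE /= mulr0 add0r mulr1 scalerDl addrCA addrC.
rewrite /pderive /derive.
have -> : (fun h : R => h^-1 *: ((null_chart \o shift z) (h *: delta_mx 0 1) - null_chart z)) =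
    (fun h : R => h^-1 *: (h *: eta (z ord0 0))).
  by apply/funext => h /=; rewrite e addrAC subrr add0r.
apply: cvg_lim => //; apply: cvg_near_cst; near=> h.
by rewrite scalerA mulVf ?scale1r//; near: h; exact: nbhs_dnbhs_neq.
Unshelve. all: by end_near. Qed.

Lemma null_chart_derive_axis : pderive 0 null_chart 0 = derive1 gamma 0.
Proof.
rewrite derive1E /pderive /derive.
suff -> : (fun h : R => h^-1 *: ((null_chart \o shift 0) (h *: delta_mx 0 0) - null_chart 0)) =
    (fun h => h^-1 *: ((gamma \o shift 0) (h *: 1) - gamma 0)) by [].
apply/funext => h /=; rewrite [h *: 1]mulr1.
by rewrite /null_chart !mxE /= mulr0 mulr1 !addr0 !scale0r !addr0.
Qed.

Let dn0 v : 'D_v null_chart 0 = v ord0 0 *: derive1 gamma 0 + v ord0 1 *: eta 0.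
Proof.
have S0 : strip 0 by rewrite /strip /= mxE.
rewrite derive_partials; last exact: smooth_on_differentiable null_chart_smooth S0.
by rewrite sum2E null_chart_derive_axis null_chart_derive1// mxE.
Qed.

Let indep a b : a *: derive1 gamma 0 + b *: eta 0 = 0 -> a = 0 /\ b = 0.
Proof.
move=> ab; pose w : 'rV[R]_(1 + 1) := row_mx b%:M a%:M.
have : w *m col_mx (eta 0) (derive1 gamma 0) = 0.
  by rewrite mul_row_col !mul_scalar_mx addrC.
rewrite -(mul0mx _ (col_mx (eta 0) (derive1 gamma 0))) => /(row_free_inj transversal) w0.
have wl : w ord0 (lshift 1 ord0) = 0 by rewrite w0 mxE.
have wr : w ord0 (rshift 1 ord0) = 0 by rewrite w0 mxE.
by split; [move: wr; rewrite row_mxEr|move: wl; rewrite row_mxEl]; rewrite mxE eqxx mulr1n.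
Qed.

Lemma null_chart_inverse : exists psi, local_inverse null_chart psi 0 (gamma 0).
Proof.
have S0 : strip 0 by rewrite /strip /= mxE.
have -> : gamma 0 = null_chart 0 by rewrite /null_chart !mxE scale0r addr0.
apply: (inverse_function ostrip S0 null_chart_smooth) => v; rewrite dn0 => /indep[v0 v1].
by rewrite [v]ptE v0 v1 [RHS]ptE !mxE.
Qed.

Variables (N : 'rV[R]_2 -> 'rV[R]_3) (k h : 'rV[R]_2 -> R) (w : 'rV[R]_2).
Hypotheses (cN : {for gamma 0, continuous N}) (ck : {for gamma 0, continuous k}).
Hypothesis areaE : \forall q \near gamma 0,
  h q = k q * triple (pderive 0 F q) (pderive 1 F q) (N q).
Hypothesis area_nondegenerate : 'd h (gamma 0) w != 0.

(** In the coordinates [null_chart] the derivative [F_v] vanishes on the axis, hence is [v K],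
    and the area density is [v] times a continuous function, whose value at the base point
    cannot be 0 if the area density has a nonzero differential there. *)
Lemma null_coordinates : exists psi r K,
  [/\ local_inverse null_chart psi 0 (gamma 0), 0 < r <= 1,
      smooth_on (ball 0 r) (F \o null_chart) /\ smooth_on (ball 0 r) K,
      forall z, ball 0 r z -> pderive 1 (F \o null_chart) z = z ord0 1 *: K z &
      triple (pderive 0 (F \o null_chart) 0) (K 0) (N (gamma 0)) != 0].
Proof.
have [psi lpsi] := null_chart_inverse.
have S0 : strip 0 by rewrite /strip /= mxE.
have n0 : null_chart 0 = gamma 0 by rewrite /null_chart !mxE scale0r addr0.
have [A [B [[oA oB] [A0 _] [sn spsi] AB BA]]] :=
  local_inverse_restrict ostrip S0 lpsi.
have oAU : open (A `&` null_chart @^-1` U).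
  exact: open_smooth_preimage oA sn (fd_open fd).
have nA : \forall z \near (0 : 'rV[R]_2), (A `&` null_chart @^-1` U) z.
  by apply: open_nbhs_nbhs; split=> //; split=> //; rewrite /preimage /= n0; exact: fd_base fd.
have [a a0 HA] := near_ballW nA.
pose r := Num.min a 1.
have r0 : 0 < r by rewrite lt_min a0 ltr01.
have rA z : ball (0 : 'rV[R]_2) r z -> A z /\ U (null_chart z).
  by move=> /(le_ball (_ : r <= a)) Bz; apply: HA; apply: Bz; rewrite ge_min lexx.
have oD : open (ball (0 : 'rV[R]_2) r) by exact: ball_open.
have DU z : ball (0 : 'rV[R]_2) r z -> U (null_chart z) by move=> /rA[].
have snD : smooth_on (ball (0 : 'rV[R]_2) r) null_chart.
  by apply: smooth_on_subset sn => z /rA[].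
pose G := F \o null_chart.
have sG : smooth_on (ball (0 : 'rV[R]_2) r) G.
  exact: (smooth_on_comp (f := null_chart) (g := F) oD (fd_open fd) DU snD (fd_map fd)).
have dG z v : ball (0 : 'rV[R]_2) r z -> 'D_v G z = 'D_('D_v null_chart z) F (null_chart z).
  move=> Dz; apply: derive_comp; first exact: smooth_on_differentiable snD Dz.
  exact: smooth_on_differentiable (fd_map fd) (DU _ Dz).
have Dstrip z : ball (0 : 'rV[R]_2) r z -> strip z by move=> /rA[/AB[]].
have G1 z : ball (0 : 'rV[R]_2) r z -> pderive 1 G (pt (z ord0 0) 0) = 0.
  move=> /ball_axis Dz; rewrite /pderive dG// [X in 'D_X F _](null_chart_derive1 (Dstrip _ Dz)) pt0.
  have := DU _ Dz; have := Dstrip _ Dz; rewrite /strip /null_chart /= pt0 pt1 scale0r addr0.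
  by move=> It Ut; exact: (fd_null_map fd).
have sG1 : smooth_on (ball (0 : 'rV[R]_2) r) (pderive 1 G) by exact: pderive_smooth.
have /choice[K0 HK] (j : 'I_3) : exists K : 'rV[R]_2 -> R, smooth_on (ball (0 : 'rV[R]_2) r) K /\
    forall z, ball (0 : 'rV[R]_2) r z -> pderive 1 G z ord0 j = z ord0 1 * K z.
  have [K sK HK] : exists2 K, smooth_on (ball (0 : 'rV[R]_2) r) K &
      forall z, ball (0 : 'rV[R]_2) r z -> pderive 1 G z ord0 j = z ord0 1 * K z.
    apply: (hadamard (g := fun z => pderive 1 G z ord0 j)); last by move=> z /G1 ->; rewrite mxE.
    by move: j; apply/smooth_on_coordinates.
  by exists K.
pose K z : 'rV[R]_3 := \row_j K0 j z.
have sK : smooth_on (ball (0 : 'rV[R]_2) r) K.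
  apply/smooth_on_coordinates => // j.
  by apply: smooth_on_ext (HK j).1 => // z _; rewrite mxE.
have GK z : ball (0 : 'rV[R]_2) r z -> pderive 1 G z = z ord0 1 *: K z.
  by move=> Dz; apply/rowP => j; rewrite (HK j).2// !mxE.
exists psi, r, K; split=> //; first by rewrite r0 ge_min lexx orbT.
have D0 : ball (0 : 'rV[R]_2) r 0 by exact: ballxx.
apply: contraNneq area_nondegenerate => T0.
(* [J] is the Jacobian determinant of [null_chart] *)
pose T z := triple (pderive 0 G z) (K z) (N (null_chart z)).
pose u z := pderive 0 null_chart z; pose v z := pderive 1 null_chart z.
pose J z := u z ord0 0 * v z ord0 1 - u z ord0 1 * v z ord0 0.
have TJ z : ball (0 : 'rV[R]_2) r z -> z ord0 1 * T z =
    J z * triple (pderive 0 F (null_chart z)) (pderive 1 F (null_chart z)) (N (null_chart z)).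
  move=> Dz; rewrite /T -triple_scale2 -GK//.
  have dF : differentiable F (null_chart z) := smooth_on_differentiable (fd_map fd) (DU _ Dz).
  have dGi i : pderive i G z = pderive i null_chart z ord0 0 *: pderive 0 F (null_chart z) +
      pderive i null_chart z ord0 1 *: pderive 1 F (null_chart z).
    by rewrite [LHS]dG// (derive_partials _ dF) sum2E.
  by rewrite !dGi triple_mix.
have su : smooth_on (ball (0 : 'rV[R]_2) r) u := pderive_smooth 0 snD.
have sv : smooth_on (ball (0 : 'rV[R]_2) r) v := pderive_smooth 1 snD.
have sJ : smooth_on (ball (0 : 'rV[R]_2) r) J.
  have cu j : smooth_on (ball (0 : 'rV[R]_2) r) (fun z => u z ord0 j).
    by move: j; apply/smooth_on_coordinates.
  have cv j : smooth_on (ball (0 : 'rV[R]_2) r) (fun z => v z ord0 j).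
    by move: j; apply/smooth_on_coordinates.
  exact: (smooth_onB oD (smooth_onM oD (cu 0) (cv 1)) (smooth_onM oD (cu 1) (cv 0))).
have J0 : J 0 != 0.
  rewrite /J /u /v null_chart_derive_axis null_chart_derive1// mxE.
  set x := derive1 gamma 0; set y := eta 0.
  apply/eqP => xy.
  have [x0 y0] : y ord0 1 = 0 /\ - x ord0 1 = 0.
    apply: indep; apply/rowP; apply: ord2_ind; rewrite !mxE -/x -/y.
      by rewrite -[RHS]xy; ring.
    ring.
  have [x1 y1] : y ord0 0 = 0 /\ - x ord0 0 = 0.
    apply: indep; apply/rowP; apply: ord2_ind; rewrite !mxE -/x -/y.
      ring.
    by rewrite -[RHS]oppr0 -xy; ring.
  have : 1 = 0 :> R.
    have [] // := indep (a := 1) (b := 0) _.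
    rewrite scale1r scale0r addr0; apply/rowP; apply: ord2_ind; rewrite mxE.
      by apply/eqP; rewrite -oppr_eq0 y1.
    by apply/eqP; rewrite -oppr_eq0 y0.
  by move/eqP; rewrite oner_eq0.
have cT : {for 0, continuous T}.
  apply: triple_continuous.
  - exact: smooth_on_continuous (pderive_smooth 0 sG) D0.
  - exact: smooth_on_continuous sK D0.
  - apply: continuous_comp; first exact: smooth_on_continuous snD D0.
    by rewrite n0.
have [Bp psip] : B (gamma 0) /\ psi (gamma 0) = 0.
  by have [_] := AB _ A0; rewrite n0.
have cpsi : {for gamma 0, continuous psi} := smooth_on_continuous spsi Bp.
have cTpsi : {for gamma 0, continuous (T \o psi)}.
  by apply: (continuous_comp cpsi); rewrite psip; exact: cT.
have cJpsi : {for gamma 0, continuous (J \o psi)}.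
  by apply: (continuous_comp cpsi); rewrite psip; exact: smooth_on_continuous sJ D0.
have npsi : \forall q \near gamma 0, (B q /\ ball (0 : 'rV[R]_2) r (psi q)) /\ J (psi q) != 0.
  near=> q; split; [split|].
  - by near: q; exact: open_nbhs_nbhs.
  - by near: q; apply: (near_preimage cpsi oD); rewrite psip.
  - by near: q; apply: (near_neq0 cJpsi); rewrite /= psip.
pose kk q := k q * (T (psi q) / J (psi q)).
pose g q := psi q ord0 1.
have dpsi : differentiable psi (gamma 0) := smooth_on_differentiable spsi Bp.
have := @diff_continuous_mul R _ h kk g (gamma 0) w.
have -> : kk (gamma 0) = 0 by rewrite /kk psip /T n0 T0 mul0r mulr0.
rewrite mul0r => ->//.
- near=> q.
  have [[Bq Dq] Jq] : (B q /\ ball (0 : 'rV[R]_2) r (psi q)) /\ J (psi q) != 0 by near: q.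
  have [_ nq] := BA _ Bq.
  have -> : h q = k q * triple (pderive 0 F q) (pderive 1 F q) (N q) by near: q.
  have := TJ _ Dq; rewrite nq => TJq.
  rewrite /kk /g -mulrA; congr (_ * _).
  have alg (x t y s : R) : y != 0 -> x * t = y * s -> s = t / y * x.
    by move=> y0 e; rewrite mulrAC [t * x]mulrC e mulrAC mulfV// mul1r.
  exact: alg Jq TJq.
- apply: (continuousM ck); apply: (continuousM cTpsi).
  by apply: (continuousV _ cJpsi); rewrite /= psip.
- by move: dpsi => /differentiable_coordinates; apply.
- by rewrite /g psip mxE.
Unshelve. all: by end_near. Qed.

End NullCoordinates.

Section Plane.
Context {R : realType}.

Definition plane (y : 'rV[R]_3) : 'rV[R]_2 := pt (y ord0 0) (y ord0 1).

Lemma plane0 : plane 0 = 0.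
Proof. by rewrite /plane !mxE [RHS]ptE !mxE. Qed.

Lemma plane_smooth (A : set 'rV[R]_3) : open A -> smooth_on A plane.
Proof.
by move=> oA; apply: smooth_on_pt => //; exact: smooth_on_coord.
Qed.

Lemma open_cylinder (D : set 'rV[R]_2) : open D -> open [set y | D (plane y)].
Proof.
move=> oD; have := @open_preimage_on R 'rV[R]_3 'rV[R]_2 setT plane D openT.
rewrite setTI; apply; last exact: oD.
by move=> x _; exact: smooth_on_continuous (plane_smooth openT) _.
Qed.

End Plane.

Section FoldForm.
Context {R : realType}.
Variables (G K : 'rV[R]_2 -> 'rV[R]_3) (c : 'rV[R]_3) (r : R).
Hypotheses (r0 : 0 < r) (sG : smooth_on (ball 0 r) G) (sK : smooth_on (ball 0 r) K).
Hypothesis GK : forall z, ball 0 r z -> pderive 1 G z = z ord0 1 *: K z.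
Hypothesis frame : triple (pderive 0 G 0) (K 0) c != 0.

Let D : set 'rV[R]_2 := ball (0 : 'rV[R]_2) r.
Let oD : open D := ball_open _ r.
Let D0 : D 0 := ballxx _ r0.

Let base (y : 'rV[R]_3) : 'rV[R]_2 := pt (y ord0 0) 0.

Lemma base_is_linear : linear base.
Proof. by move=> a x y; apply/rowP; apply: ord2_ind; rewrite !mxE//=; ring. Qed.

HB.instance Definition _ := GRing.isLinear.Build R 'rV[R]_3 'rV[R]_2 _ base base_is_linear.

Let sbase (A : set 'rV[R]_3) : open A -> smooth_on A base.
Proof.
move=> oA; apply: smooth_on_pt => //; first exact: smooth_on_coord.
exact: smooth_on_cst.
Qed.

(** The inverse of this map sends the image [G(u, 0)] of the singular curve to the first axis,
    and [K 0], the direction of [G_vv], to the second one. *)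
Definition straighten (y : 'rV[R]_3) : 'rV[R]_3 :=
  G (base y) + (y ord0 1 *: K 0 + y ord0 i2 *: c).

Let S : set 'rV[R]_3 := [set y | D (base y)].
Let oS : open S.
Proof.
have := @open_preimage_on R 'rV[R]_3 'rV[R]_2 setT base D openT.
rewrite setTI; apply; last exact: oD.
by move=> x _; exact: smooth_on_continuous (sbase openT) _.
Qed.

Let scZ (A : set 'rV[R]_3) j (v : 'rV[R]_3) : open A ->
  smooth_on A (fun y : 'rV[R]_3 => y ord0 j *: v).
Proof.
move=> oA; apply/smooth_on_coordinates => // i.
apply: (@smooth_on_ext _ _ _ _ (fun y : 'rV[R]_3 => y ord0 j * v ord0 i)) => //.
  by move=> y _; rewrite mxE.
by apply: smooth_onM => //; [exact: smooth_on_coord|exact: smooth_on_cst].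
Qed.

Lemma straighten_smooth : smooth_on S straighten.
Proof.
apply: smooth_onD => //; last by apply: smooth_onD => //; exact: scZ.
exact: (smooth_on_comp (f := base) (g := G) oS oD (fun y => id) (sbase oS) sG).
Qed.

Let dstraighten v : 'D_v straighten 0 =
  v ord0 0 *: pderive 0 G 0 + v ord0 1 *: K 0 + v ord0 i2 *: c.
Proof.
pose lin (y : 'rV[R]_3) : 'rV[R]_3 := y ord0 1 *: K 0 + y ord0 i2 *: c.
have slin : smooth_on S lin by apply: smooth_onD => //; exact: scZ.
have base0 : base 0 = 0 by apply/rowP; apply: ord2_ind; rewrite !mxE.
have S0 : S 0 by rewrite /S /= base0; exact: D0.
have dbase : differentiable base 0 := smooth_on_differentiable (sbase oS) S0.
have dG : differentiable G (base 0) by rewrite base0; exact: smooth_on_differentiable sG D0.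
have dlin := smooth_on_differentiable slin S0.
have dGb : differentiable (G \o base) 0 by exact: differentiable_comp.
have -> : straighten = (G \o base) + lin by [].
rewrite (deriveD (diff_derivable dGb) (diff_derivable dlin)) (derive_comp _ dbase dG).
have cb : continuous base by move=> y; apply: smooth_on_continuous (sbase openT) _.
rewrite (derive_linear _ _ cb) base0.
rewrite [X in 'D_X G _](_ : _ = v ord0 0 *: delta_mx 0 0); last first.
  by apply/rowP; apply: ord2_ind; rewrite !mxE /= ?mulr1 ?mulr0.
rewrite (derive_scale_dir _ _ (smooth_on_differentiable sG D0)) -addrA; congr (_ + _).
have dc j : derivable (fun y : 'rV[R]_3 => y ord0 j) 0 v.
  by apply: diff_derivable; exact: differentiable_coord.
apply/rowP => j; rewrite -(derive_coordinates _ _ dlin) !mxE.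
have -> : (fun y => lin y ord0 j) =
    (K 0 ord0 j \*: (fun y : 'rV[R]_3 => y ord0 1)) + (c ord0 j \*: (fun y : 'rV[R]_3 => y ord0 i2)).
  by apply/funext => y; rewrite /lin !mxE; congr (_ + _); exact: mulrC.
rewrite deriveD; [|exact: derivableZ|exact: derivableZ].
by rewrite !deriveZ// !derive_coord /GRing.scale /= mulrC [c _ _ * _]mulrC.
Qed.

Let base0 : base 0 = 0. Proof. by apply/rowP; apply: ord2_ind; rewrite !mxE. Qed.
Let S0 : S 0. Proof. by rewrite /S /= base0; exact: D0. Qed.
Let straighten0 : straighten 0 = G 0.
Proof. by rewrite /straighten base0 !mxE !scale0r !addr0. Qed.

Lemma straighten_inverse : exists V0, local_inverse straighten V0 0 (G 0).
Proof.
rewrite -straighten0; apply: (inverse_function oS S0 straighten_smooth) => v.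
rewrite dstraighten => /(triple_free frame)[v0 v1 v2].
by apply/rowP; apply: ord3_ind; rewrite mxE.
Qed.

(** In the straightened coordinates the map is [(u + ..., v ^ 2 b, ...)]; that [b] is positive
    reflects the second derivative [K 0] of the map along the null direction. *)
Lemma straightened : exists (V0 : 'rV[R]_3 -> 'rV[R]_3) (b : 'rV[R]_2 -> R) (a : R),
  [/\ local_inverse straighten V0 0 (G 0), 0 < a <= r,
      smooth_on (ball 0 a) (V0 \o G) /\ smooth_on (ball 0 a) b,
      forall z : 'rV[R]_2, ball 0 a z -> straighten (V0 (G z)) = G z /\
        V0 (G (pt (z ord0 0) 0)) = pt3 (z ord0 0) 0 0 &
      forall z : 'rV[R]_2, ball 0 a z -> [/\ pderive 1 (V0 \o G) (pt (z ord0 0) 0) = 0, 0 < b z &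
        V0 (G z) ord0 1 = z ord0 1 ^+ 2 * b z]].
Proof.
have [V0 lV0] := straighten_inverse.
have [A [B [[oA oB] [A0 _] [sS sV] AB BA]]] := local_inverse_restrict oS S0 lV0.
have BG0 : B (G 0) by have [_] := AB _ A0; rewrite straighten0.
have nB : \forall z \near (0 : 'rV[R]_2), B (G z).
  by apply: near_preimage BG0 => //; exact: smooth_on_continuous sG D0.
pose axis (z : 'rV[R]_2) := pt3 (z ord0 0) 0 0.
have saxis : smooth_on D axis.
  apply: smooth_on_pt3 => //; try exact: smooth_on_cst.
  exact: smooth_on_coord.
have axis0 : axis 0 = 0 by apply/rowP; apply: ord3_ind; rewrite !mxE.
have nA : \forall z \near (0 : 'rV[R]_2), A (axis z).
  apply: near_preimage => //; last by rewrite axis0.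
  exact: smooth_on_continuous saxis D0.
have nD : \forall z \near (0 : 'rV[R]_2), D z by exact: open_nbhs_nbhs.
have [a1 a10 H1] := near_ballW (near_and3 nD nB nA).
pose G1 := V0 \o G.
have H z : ball (0 : 'rV[R]_2) a1 z -> [/\ D z, B (G z) & A (axis z)] by exact: H1.
have oE : open (ball (0 : 'rV[R]_2) a1) by exact: ball_open.
have E0 : ball (0 : 'rV[R]_2) a1 0 by exact: ballxx.
have ED z : ball (0 : 'rV[R]_2) a1 z -> D z by case/H.
have EB z : ball (0 : 'rV[R]_2) a1 z -> B (G z) by case/H.
have sGE := smooth_on_subset ED sG; have sKE := smooth_on_subset ED sK.
have sG1 : smooth_on (ball (0 : 'rV[R]_2) a1) G1.
  exact: (smooth_on_comp (f := G) (g := V0) oE oB EB sGE sV).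
have G1ax z : ball (0 : 'rV[R]_2) a1 z -> G1 (pt (z ord0 0) 0) = pt3 (z ord0 0) 0 0.
  move=> /H[_ _ /AB[_ _ e]]; rewrite -[RHS]/(axis z) -e /G1 /=; congr V0.
  by rewrite /straighten /base !mxE /= !scale0r !addr0.
(* [d(V0 \o G)/dv = v kk], and [kk 0 = (0, 1, 0)] since [V0] inverts [straighten] *)
pose kk z := 'D_(K z) V0 (G z).
have dG1 z : ball (0 : 'rV[R]_2) a1 z -> pderive 1 G1 z = z ord0 1 *: kk z.
  move=> Ez; have dV := smooth_on_differentiable sV (EB _ Ez).
  have dG := smooth_on_differentiable sGE Ez.
  rewrite /pderive (derive_comp _ dG dV) -[X in 'D_X V0 _]/(pderive 1 G z) GK; last exact: ED.
  exact: (derive_scale_dir _ _ dV).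
have skk : smooth_on (ball (0 : 'rV[R]_2) a1) kk.
  exact: (smooth_derive_along oE oB EB sGE sKE sV).
have G10 z : ball (0 : 'rV[R]_2) a1 z -> pderive 1 G1 (pt (z ord0 0) 0) = 0.
  by move=> /ball_axis/dG1 ->; rewrite pt1 scale0r.
have sg1 : smooth_on (ball (0 : 'rV[R]_2) a1) (fun z => G1 z ord0 1).
  by move/(smooth_on_coordinates _ oE): sG1.
have dg1 z : ball (0 : 'rV[R]_2) a1 z ->
    pderive 1 (fun z => G1 z ord0 1) z = z ord0 1 * kk z ord0 1.
  move=> Ez; have := dG1 z Ez; move/rowP/(_ 1); rewrite mxE => <-.
  exact: (derive_coordinates _ _ (smooth_on_differentiable sG1 Ez)).
have [b sb G1b] : exists2 b, smooth_on (ball (0 : 'rV[R]_2) a1) b &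
    forall z, ball (0 : 'rV[R]_2) a1 z -> G1 z ord0 1 = z ord0 1 ^+ 2 * b z.
  apply: hadamard2 => // z Ez; first by rewrite G1ax// pt3_1.
  by rewrite dg1 ?pt1 ?mul0r//; exact: ball_axis.
have sc1 : smooth_on (ball (0 : 'rV[R]_2) a1) (fun z : 'rV[R]_2 => z ord0 1).
  exact: smooth_on_coord.
(* both sides multiplied by [v] are the derivative of [v ^ 2 b] *)
have kb : kk 0 ord0 1 = 2 * b 0.
  have sdb : smooth_on (ball (0 : 'rV[R]_2) a1) (pderive 1 b) by exact: pderive_smooth.
  have skk1 : smooth_on (ball (0 : 'rV[R]_2) a1) (fun z => kk z ord0 1).
    by move/(smooth_on_coordinates _ oE): skk.
  have srhs : smooth_on (ball (0 : 'rV[R]_2) a1) (fun z => 2 * b z + z ord0 1 * pderive 1 b z).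
    exact: (smooth_onD oE (smooth_onM oE (smooth_on_cst _ _) sb) (smooth_onM oE sc1 sdb)).
  rewrite (coord1_cancel oE skk1 srhs _ E0) ?mxE ?mul0r ?addr0// => z Ez.
  rewrite -dg1// (pderive_ext 1 oE G1b Ez).
  have s1b : smooth_on (ball (0 : 'rV[R]_2) a1) (fun z => z ord0 1 * b z) by exact: smooth_onM oE sc1 sb.
  under eq_fun do rewrite expr2 -mulrA.
  rewrite (pderive_mul_coord1 (smooth_on_differentiable s1b Ez)).
  rewrite (pderive_mul_coord1 (smooth_on_differentiable sb Ez)).
  by move: (pderive 1 b z) (b z) (z ord0 1) => p q v; ring.
have kk0 : kk 0 = delta_mx 0 1.
  have e : K 0 = 'D_(delta_mx 0 1) straighten 0.
    by rewrite dstraighten !mxE /= !scale0r add0r addr0 scale1r.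
  rewrite /kk e -straighten0; apply: (derive_local_inverse _ oA sS sV _ A0).
  by move=> z /AB[].
have b0 : 0 < b 0.
  have : 2 * b 0 = 1 by rewrite -kb kk0 mxE.
  by move=> h; rewrite -(pmulr_rgt0 (b 0) (ltr0n R 2)) h ltr01.
have nb : \forall z \near (0 : 'rV[R]_2), 0 < b z.
  have cb : {for 0, continuous b} := smooth_on_continuous sb E0.
  have o : open [set x : R | 0 < x] by exact: open_gt.
  exact: (near_preimage cb o b0).
have nE : \forall z \near (0 : 'rV[R]_2), ball (0 : 'rV[R]_2) a1 z.
  exact: open_nbhs_nbhs.
have [a2 a20 H2] := near_ballW (near_and3 nE nE nb).
pose a := Num.min a2 r.
have aE z : ball (0 : 'rV[R]_2) a z -> ball (0 : 'rV[R]_2) a1 z /\ 0 < b z.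
  by move=> az; have [] // := H2 z; apply: le_ball az; rewrite ge_min lexx.
have aE1 z : ball (0 : 'rV[R]_2) a z -> ball (0 : 'rV[R]_2) a1 z by case/aE.
exists V0, b, a; split=> //.
- by rewrite lt_min a20 r0 ge_min lexx orbT.
- by split; [exact: smooth_on_subset aE1 sG1|exact: smooth_on_subset aE1 sb].
- move=> z /aE1 Ez; split; last exact: G1ax.
  by have [] := BA _ (EB _ Ez).
- move=> z /aE[Ez bz]; split=> //; first exact: G10.
  exact: G1b.
Qed.

(** Taking [v sqrt b] as a coordinate makes the first two components [(u, v ^ 2)]; the third
    one is then brought to normal form by a shear of the target. *)
Lemma fold_form : exists (phi theta : 'rV[R]_2 -> 'rV[R]_2) (W V : 'rV[R]_3 -> 'rV[R]_3)
    (Q : 'rV[R]_2 -> R) (d : R),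
  [/\ local_inverse phi theta 0 0, local_inverse W V 0 (G 0), 0 < d, smooth_on (ball 0 d) Q &
      \forall z \near (0 : 'rV[R]_2), G (theta z) = W (normal_map Q z)].
Proof.
have [V0 [b [a [lV0 /andP[a0 ar] [sG1 sb] H H']]]] := straightened.
pose C : set 'rV[R]_2 := ball (0 : 'rV[R]_2) a.
have oC : open C by exact: ball_open.
have C0 : C 0 by exact: ballxx.
pose g j (z : 'rV[R]_2) : R := V0 (G z) ord0 j.
have sg j : smooth_on C (g j).
  have := sG1; move/(smooth_on_coordinates _ oC); exact.
have gax z j : C z -> g j (pt (z ord0 0) 0) = pt3 (z ord0 0) 0 0 ord0 j.
  by move=> /H[_ e]; rewrite /g e.
have dg1 z j : C z -> pderive 1 (g j) (pt (z ord0 0) 0) = 0.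
  move=> Cz; have [e _ _] := H' _ Cz.
  rewrite [LHS](derive_coordinates _ _ (smooth_on_differentiable sG1 (ball_axis Cz))).
  by move: e; rewrite /pderive => ->; rewrite mxE.
have nC : \forall z \near (0 : 'rV[R]_2), C z by exact: open_nbhs_nbhs.
have dg0 z j : C z -> pderive 0 (g j) (squeeze 0 z) = (j == 0)%:R.
  move=> Cz; have Csq : C (squeeze 0 z) by rewrite squeeze0E; exact: ball_axis.
  have [_ <- _] := pderive_squeeze (smooth_on_differentiable (sg j) Csq).
  have e y : C y -> (g j \o squeeze 0) y = pt3 (y ord0 0) 0 0 ord0 j.
    by move=> Cy; rewrite /= squeeze0E gax.
  rewrite (pderive_ext 0 oC e Cz) /pderive; move: j {e}; apply: ord3_ind.
  - by under eq_fun do rewrite pt3_0; rewrite derive_coord mxE.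
  - by under eq_fun do rewrite pt3_1; rewrite derive_cst.
  - by under eq_fun do rewrite pt3_2; rewrite derive_cst.
have dgi0 y w : C y -> y ord0 1 = 0 -> 'D_w (g i2) y = 0.
  move=> Cy y1; rewrite (derive_partials _ (smooth_on_differentiable (sg i2) Cy)) sum2E.
  have := dg0 y i2 Cy; have := dg1 y i2 Cy.
  by rewrite -squeeze0E (squeeze0_axis y1) => -> ->; rewrite !scaler0 addr0.
have sq0 : squeeze 0 (0 : 'rV[R]_2) = 0 by rewrite squeeze0E mxE [RHS]ptE !mxE.
pose ss z : R := Num.sqrt (b z).
have pos z : C z -> [set x : R | 0 < x] (b z) by case/H'.
have sss : smooth_on C ss.
  apply: (smooth_on_comp1 (f := b) (g := @Num.sqrt R) oC _ pos sb smooth_sqrt).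
  exact: open_gt.
have sc1 : smooth_on C (fun z : 'rV[R]_2 => z ord0 1) by exact: smooth_on_coord.
(* in these coordinates the second component [v ^ 2 b] becomes a square *)
pose phi z : 'rV[R]_2 := pt (g 0 z) (z ord0 1 * ss z).
have sphi : smooth_on C phi.
  exact: (smooth_on_pt oC (sg 0) (smooth_onM oC sc1 sss)).
have g00 j : g j 0 = 0.
  have := gax _ j C0; rewrite -squeeze0E sq0 => ->; rewrite mxE.
  by move: j; apply: ord3_ind; rewrite mxE.
have phi0 : phi 0 = 0 by apply/rowP; apply: ord2_ind; rewrite !mxE /= ?g00 ?mxE ?mul0r.
have [theta ltheta] : exists theta, local_inverse phi theta 0 0.
  rewrite -{2}phi0; apply: (inverse_function oC C0 sphi) => v dv.
  have dphi := smooth_on_differentiable sphi C0.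
  have h0 := derive_coordinates v 0 dphi; have h1 := derive_coordinates v 1 dphi.
  rewrite dv mxE in h0; rewrite dv mxE in h1.
  have v0 : v ord0 0 = 0.
    rewrite -h0; have -> : (fun y => phi y ord0 0) = g 0 by apply/funext => y; rewrite pt0.
    rewrite (derive_partials _ (smooth_on_differentiable (sg 0) C0)) sum2E.
    have := dg0 _ 0 C0; have := dg1 _ 0 C0; rewrite -squeeze0E sq0 => -> ->.
    by rewrite eqxx scaler0 addr0 /GRing.scale /= mulr1.
  have v1 : v ord0 1 = 0.
    move: h1; have -> : (fun y => phi y ord0 1) = (fun z : 'rV[R]_2 => z ord0 1) * ss.
      by apply/funext => y; rewrite pt1.
    have dc := smooth_on_differentiable sc1 C0; have ds := smooth_on_differentiable sss C0.
    rewrite (deriveM (diff_derivable dc) (diff_derivable ds)) derive_coord mxE scale0r add0r.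
    move/eqP; rewrite /GRing.scale /= mulf_eq0 => /orP[|/eqP//].
    by rewrite gt_eqF// sqrtr_gt0; case: (H' _ C0).
  by rewrite [v]ptE v0 v1 [RHS]ptE !mxE.
have [A [B [[oA oB] [A0 _] [_ stheta] AB BA]]] := local_inverse_restrict oC C0 ltheta.
have theta0 : B 0 /\ theta 0 = 0 by have := AB _ A0; rewrite phi0 => -[].
have [e1 e10 eB] := near_ballW (open_nbhs_nbhs (conj oB theta0.1)).
have oE : open (ball (0 : 'rV[R]_2) e1) by exact: ball_open.
have EC z : ball (0 : 'rV[R]_2) e1 z -> C (theta z) by move=> /eB/BA[/AB[]].
have sthetaE : smooth_on (ball (0 : 'rV[R]_2) e1) theta by exact: smooth_on_subset eB stheta.
pose h := g i2 \o theta.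
have sh : smooth_on (ball (0 : 'rV[R]_2) e1) h.
  exact: (smooth_on_comp_real (f := theta) (g := g i2) oE EC sthetaE (sg i2)).
have th z : ball (0 : 'rV[R]_2) e1 z -> g 0 (theta z) = z ord0 0 /\
    theta z ord0 1 * ss (theta z) = z ord0 1.
  move=> /eB/BA[_ e]; split; first by rewrite -{2}e pt0.
  by rewrite -{3}e pt1.
have dh z : ball (0 : 'rV[R]_2) e1 z -> pderive 1 h (squeeze 0 z) = 0.
  move=> Ez; have Esq : ball (0 : 'rV[R]_2) e1 (squeeze 0 z).
    by rewrite squeeze0E; exact: ball_axis.
  have [_] := th _ Esq; rewrite squeeze0E pt1 -squeeze0E => /eqP; rewrite mulf_eq0 => /orP[|]; last first.
    by rewrite gt_eqF// sqrtr_gt0; case: (H' _ (EC _ Esq)).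
  move=> /eqP t1; have Cy := EC _ Esq.
  have dgi := smooth_on_differentiable (sg i2) Cy.
  rewrite [LHS](derive_comp _ (smooth_on_differentiable sthetaE Esq) dgi).
  exact: dgi0.
have [d /andP[d0 de] [E [Q [sE sQ hEQ]]]] := fold_normal_form e10 sh dh.
have E0 : E 0 = 0.
  have := hEQ 0 (ballxx _ d0); rewrite /h /= theta0.2 g00 /fold !mxE !expr0n /= mul0r addr0.
  by rewrite (_ : pt 0 0 = 0)// [RHS]ptE !mxE.
(* [shear 1] adds the even part [E(u, v ^ 2)] of the third component back *)
pose shear (s : R) (y : 'rV[R]_3) := pt3 (y ord0 0) (y ord0 1) (y ord0 i2 + s * E (plane y)).
pose T : set 'rV[R]_3 := [set y | ball (0 : 'rV[R]_2) d (plane y)].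
have oBd : open (ball (0 : 'rV[R]_2) d) by exact: ball_open.
have oT : open T by exact: open_cylinder.
have sshear s : smooth_on T (shear s).
  have sEt : smooth_on T (E \o plane).
    exact: (smooth_on_comp_real (f := plane) (g := E) oT (fun y => id) (plane_smooth oT) sE).
  apply: smooth_on_pt3 => //; try exact: smooth_on_coord.
  apply: smooth_onD => //; first exact: smooth_on_coord.
  exact: (smooth_onM oT (smooth_on_cst _ _) sEt).
have plane_shear s y : plane (shear s y) = plane y by rewrite /plane !mxE.
have shearK s y : shear (- s) (shear s y) = y.
  apply/rowP; apply: ord3_ind; rewrite !mxE //= plane_shear mulNr addrK //.
have lshear : local_inverse (shear 1) (shear (- 1)) 0 0.
  exists T, T; split.
  - by [].
  - split; first by rewrite /T /= plane0; exact: ballxx.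
    by apply/rowP; apply: ord3_ind; rewrite !mxE //= plane0 E0 mulr0 addr0.
  - by split; exact: sshear.
  - by move=> y Ty; rewrite shearK; split=> //; rewrite /T /= plane_shear.
  - move=> y Ty; split; first by rewrite /T /= plane_shear.
    by rewrite -{1}[1]opprK shearK.
exists phi, theta, (straighten \o shear 1), (shear (- 1) \o V0), Q, d; split=> //.
  exact: local_inverse_comp lshear lV0.
have nEd : \forall z \near (0 : 'rV[R]_2), ball (0 : 'rV[R]_2) d z.
  by apply: open_nbhs_nbhs; split => //; exact: ballxx.
apply: filterS nEd => z dz.
have Ez : ball (0 : 'rV[R]_2) e1 z.
  by apply: le_ball dz; rewrite (le_trans de)// ge_min lexx.
have Cz := EC _ Ez; have [t0 t1] := th _ Ez.
have [<- _] := H _ Cz; rewrite /=; congr straighten.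
apply/rowP; apply: ord3_ind.
- by rewrite -[LHS]/(g 0 (theta z)) t0 /shear pt3_0 pt3_0.
- have [_ bz ->] := H' _ Cz; rewrite /shear pt3_1 pt3_1 -t1 exprMn sqr_sqrtr//; exact: ltW.
- rewrite -[LHS]/(h z) hEQ// /shear pt3_2 pt3_2 mul1r addrC; congr (_ + E _).
  by rewrite /plane /fold pt3_0 pt3_1.
Qed.

End FoldForm.

(** * The cuspidal cross cap *)

Section CrossCap.
Context {R : realType}.

Definition cross_cap : 'rV[R]_2 -> 'rV[R]_3 := normal_map (fun z : 'rV[R]_2 => z ord0 0).

Lemma cross_capE z : cuspidal_cross_cap z = cross_cap z.
Proof.
apply/rowP; apply: ord3_ind; rewrite mxE /cross_cap /normal_map ?pt3_0 ?pt3_1 ?pt3_2 //=.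
by rewrite /fold pt0 mulrC.
Qed.

(** With [Q(0) = 0] and [Q_u(0) <> 0], taking [Q] as first coordinate in the source and in
    the target turns the normal form into the cuspidal cross cap. *)
Lemma normal_map_cross_cap (Q : 'rV[R]_2 -> R) (d : R) :
  0 < d -> smooth_on (ball 0 d) Q -> Q 0 = 0 -> pderive 0 Q 0 != 0 ->
  exists (phi theta : 'rV[R]_2 -> 'rV[R]_2) (W V : 'rV[R]_3 -> 'rV[R]_3),
    [/\ local_inverse phi theta 0 0, local_inverse W V 0 0 &
      \forall z \near (0 : 'rV[R]_2), normal_map Q (theta z) = W (cross_cap z)].
Proof.
move=> d0' sQ' Q0 Qu; pose d1 := Num.min d 1.
have d0 : 0 < d1 by rewrite lt_min d0' ltr01.
have d11 : d1 <= 1 by rewrite ge_min lexx orbT.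
have sQ : smooth_on (ball (0 : 'rV[R]_2) d1) Q.
  by apply: smooth_on_subset sQ' => z; apply: le_ball; rewrite ge_min lexx.
pose D : set 'rV[R]_2 := ball (0 : 'rV[R]_2) d1.
have oD : open D by exact: ball_open.
have D0 : D 0 by exact: ballxx.
pose M (y : 'rV[R]_3) : 'rV[R]_3 := pt3 (Q (plane y)) (y ord0 1) (y ord0 i2).
pose S : set 'rV[R]_3 := [set y | D (plane y)].
have oS : open S by exact: open_cylinder.
have S0 : S 0 by rewrite /S /= plane0.
have sQp : smooth_on S (Q \o plane).
  exact: (smooth_on_comp_real (f := plane) (g := Q) oS (fun y => id) (plane_smooth oS) sQ).
have sM : smooth_on S M.
  by apply: smooth_on_pt3 => //; exact: smooth_on_coord.
have M0 : M 0 = 0 by apply/rowP; apply: ord3_ind; rewrite !mxE //= plane0.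
have dQ : differentiable Q 0 := smooth_on_differentiable sQ D0.
have [V lV] : exists V, local_inverse M V 0 0.
  rewrite -{2}M0; apply: (inverse_function oS S0 sM) => v dv.
  have dM := smooth_on_differentiable sM S0.
  have h j : 'D_v (fun y => M y ord0 j) 0 = 0 by rewrite (derive_coordinates _ _ dM) dv mxE.
  have v1 : v ord0 1 = 0.
    have := h 1; under [X in 'D_v X _]eq_fun do rewrite pt3_1.
    by rewrite derive_coord.
  have v2 : v ord0 i2 = 0.
    have := h i2; under [X in 'D_v X _]eq_fun do rewrite pt3_2.
    by rewrite derive_coord.
  have v0 : v ord0 0 = 0.
    have := h 0; under [X in 'D_v X _]eq_fun do rewrite pt3_0.
    have dp : differentiable plane 0 := smooth_on_differentiable (plane_smooth oS) S0.
    have dQp : differentiable Q (plane 0) by rewrite plane0.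
    rewrite (derive_comp _ dp dQp) plane0 (derive_partials _ dQ) sum2E.
    have e0 : 'D_v plane 0 ord0 0 = v ord0 0.
      rewrite -(derive_coordinates _ _ dp); under [X in 'D_v X _]eq_fun do rewrite pt0.
      exact: derive_coord.
    have e1 : 'D_v plane 0 ord0 1 = v ord0 1.
      rewrite -(derive_coordinates _ _ dp); under [X in 'D_v X _]eq_fun do rewrite pt1.
      exact: derive_coord.
    rewrite e0 e1 v1 scale0r addr0 => /eqP.
    by rewrite /GRing.scale /= mulf_eq0 (negbTE Qu) orbF => /eqP.
  by apply/rowP; apply: ord3_ind; rewrite mxE.
(* [M (normal_map Q z) = cross_cap (phi z)] *)
pose phi (z : 'rV[R]_2) : 'rV[R]_2 := pt (Q (fold z)) (z ord0 1).
have sQf : smooth_on D (Q \o fold) := Qf_smooth d11 sQ.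
have sphi : smooth_on D phi.
  by apply: smooth_on_pt => //; exact: smooth_on_coord.
have fold0 : fold 0 = 0 :> 'rV[R]_2 by rewrite /fold !mxE expr0n [RHS]ptE !mxE.
have phi0 : phi 0 = 0 by rewrite /phi fold0 Q0 mxE [RHS]ptE !mxE.
have [theta ltheta] : exists theta, local_inverse phi theta 0 0.
  rewrite -{2}phi0; apply: (inverse_function oD D0 sphi) => v dv.
  have dphi := smooth_on_differentiable sphi D0.
  have h j : 'D_v (fun y => phi y ord0 j) 0 = 0 by rewrite (derive_coordinates _ _ dphi) dv mxE.
  have v1 : v ord0 1 = 0.
    have := h 1; under [X in 'D_v X _]eq_fun do rewrite pt1.
    by rewrite derive_coord.
  have v0 : v ord0 0 = 0.
    have := h 0; under [X in 'D_v X _]eq_fun do rewrite pt0.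
    have [df [Df _]] := @is_diff_fold R 0.
    have dQf := smooth_on_differentiable sQf D0.
    have dQ0 : differentiable Q (fold 0) by rewrite fold0.
    rewrite (derive_partials _ dQf) sum2E v1 scale0r addr0 /pderive.
    rewrite (derive_comp _ df dQ0) Df fold0 => /eqP.
    by rewrite /GRing.scale /= mulf_eq0 (negbTE Qu) orbF => /eqP.
  by rewrite [v]ptE v0 v1 [RHS]ptE !mxE.
exists phi, theta, V, M; split=> //; first exact: local_inverse_sym.
have [A [B [[oA oB] [A0 _] [sp st] AB BA]]] := local_inverse_restrict oD D0 ltheta.
have [A' [B' [[oA' oB'] [A'0 _] [sM' sV'] AB' BA']]] := lV.
have B0 : B 0 by have := AB _ A0; rewrite phi0 => -[].
have t0 : theta 0 = 0 by have := AB _ A0; rewrite phi0 => -[].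
have nB : \forall z \near (0 : 'rV[R]_2), B z by exact: open_nbhs_nbhs.
have H0 : normal_map Q 0 = 0.
  by apply/rowP; apply: ord3_ind; rewrite !mxE /= ?mxE ?expr0n ?mul0r.
have nA : \forall z \near (0 : 'rV[R]_2), A' (normal_map Q (theta z)).
  apply: (near_preimage (f := normal_map Q \o theta) _ oA'); last by rewrite /= t0 H0.
  apply: continuous_comp; first exact: smooth_on_continuous st B0.
  by rewrite t0; exact: smooth_on_continuous (normal_map_smooth d11 sQ) D0.
near=> z.
have Bz : B z by near: z.
have A'z : A' (normal_map Q (theta z)) by near: z.
have [_ VM] := AB' _ A'z; rewrite -VM; congr V.
have [_ e] := BA _ Bz.
rewrite -[in RHS]e /M /cross_cap /normal_map /plane pt3_0 pt3_1 pt3_2 /phi pt0 pt1.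
by rewrite /fold !pt0.
Unshelve. all: by end_near. Qed.

(** The criterion in a chart. The area density is only known up to a continuous factor [k],
    which comes from the volume element. *)
Theorem cross_cap_criterion (U : set 'rV[R]_2) (F l X N : 'rV[R]_2 -> 'rV[R]_3) (eps : R)
    (gamma eta : R -> 'rV[R]_2) (k h : 'rV[R]_2 -> R) (w : 'rV[R]_2) (psi : R -> R) :
  frontal_data U F l X eps gamma eta ->
  {for gamma 0, continuous N} -> {for gamma 0, continuous k} ->
  (\forall q \near gamma 0, h q = k q * triple (pderive 0 F q) (pderive 1 F q) (N q)) ->
  'd h (gamma 0) w != 0 ->
  (\forall t \near (0 : R), psi t = dot (l (gamma t)) ('D_(eta t) X (gamma t))) ->
  (exists (phi theta : 'rV[R]_2 -> 'rV[R]_2) (W V : 'rV[R]_3 -> 'rV[R]_3),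
    [/\ local_inverse phi theta (gamma 0) 0, local_inverse W V 0 (F (gamma 0)) &
      \forall z \near (0 : 'rV[R]_2), F (theta z) = W (cross_cap z)]) <->
  row_free (col_mx (eta 0) (derive1 gamma 0)) /\ (psi 0 = 0 /\ derive1 psi 0 != 0).
Proof.
move=> fd cN ck areaE nd psiE; split.
  move=> [phi [theta [W [V [lphi lW FW]]]]].
  have sX0 : smooth_on (ball (0 : 'rV[R]_2) 1) (fun z : 'rV[R]_2 => z ord0 0).
    exact: smooth_on_coord.
  have [tr p0 p1] := normal_form_criterion fd lphi lW ltr01 sX0 FW psiE.
  have Q0 : (0 : 'rV[R]_2) ord0 0 = 0 by rewrite mxE.
  split=> //; split; first exact/p0.
  by apply/p1 => //; rewrite /pderive derive_coord mxE oner_neq0.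
move=> [tr [psi0 psi1]].
have [psi' [r [K [lnull /andP[r0 _] [sG sK] GK frame]]]] := null_coordinates fd tr cN ck areaE nd.
have n0 : null_chart gamma eta 0 = gamma 0 by rewrite /null_chart !mxE scale0r addr0.
have [phi [theta [W [V [Q [d [lphi lW d0 sQ GW]]]]]]] := fold_form r0 sG sK GK frame.
have lphi' := local_inverse_comp (local_inverse_sym lnull) lphi.
rewrite /= n0 in lW.
have [_ p0 p1] := normal_form_criterion fd lphi' lW d0 sQ GW psiE.
have Q0 : Q 0 = 0 by exact/p0.
have Qu : pderive 0 Q 0 != 0 by exact/p1.
have [phi2 [theta2 [W2 [V2 [lphi2 lW2 QW]]]]] := normal_map_cross_cap d0 sQ Q0 Qu.
exists (phi2 \o (phi \o psi')), ((null_chart gamma eta \o theta) \o theta2), (W \o W2), (V2 \o V).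
split; [exact: local_inverse_comp lphi' lphi2|exact: local_inverse_comp lW2 lW|].
have [A [B [[oA oB] [A0 phi0] [_ st] AB _]]] := lphi2.
have B0 : B 0 by have := AB _ A0; rewrite phi0 => -[].
have t0 : theta2 0 = 0 by have := AB _ A0; rewrite phi0 => -[].
have ct : {for 0, continuous theta2} := smooth_on_continuous st B0.
have GWt : \forall z \near (0 : 'rV[R]_2),
    F (null_chart gamma eta (theta (theta2 z))) = W (normal_map Q (theta2 z)).
  have [a a0 Ha] := near_ballW GW.
  apply: filterS (near_preimage ct (ball_open 0 a) _) => [z /Ha //|].
  by rewrite t0; exact: ballxx.
by near=> z; rewrite /= -(_ : normal_map Q (theta2 z) = W2 (cross_cap z)); near: z.
Unshelve. all: by end_near. Qed.

End CrossCap.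

(** * Charts *)

Section Charts.
Context {R : realType} {n : nat} (N : manifold R n).
Implicit Types (i j k : chart N) (x : N).

Definition transition i j : 'rV[R]_n -> 'rV[R]_n := cmap j \o cinv i.

Lemma open_chart_image i (W : set N) : open W -> open (cmap i @` (W `&` cdom i)).
Proof.
move=> oW; rewrite openE => _ [x [Wx ix] <-].
have Iz : (cmap i @` cdom i) (cmap i x) by exists x.
have nW : \forall z \near cmap i x, W (cinv i z).
  apply: (cinv_continuous Iz); rewrite cmapK//; exact: open_nbhs_nbhs.
have nI : \forall z \near cmap i x, (cmap i @` cdom i) z.
  by apply: open_nbhs_nbhs; split=> //; exact: open_cimg.
near=> z.
have Wz : W (cinv i z) by near: z.
have [y iy yz] : (cmap i @` cdom i) z by near: z.
by exists y => //; split=> //; rewrite -(cmapK iy) yz.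
Unshelve. all: by end_near. Qed.

Lemma open_overlap i j : open (cmap i @` (cdom i `&` cdom j)).
Proof. by rewrite setIC; apply: open_chart_image; exact: open_cdom. Qed.

Lemma mem_overlap i j x : cdom i x -> cdom j x -> (cmap i @` (cdom i `&` cdom j)) (cmap i x).
Proof. by move=> ix jx; exists x. Qed.

Lemma transition_differentiable i j x : cdom i x -> cdom j x ->
  differentiable (transition i j) (cmap i x).
Proof.
move=> ix jx; apply: smooth_on_differentiable (mem_overlap ix jx).
exact: transition_smooth.
Qed.

Lemma transitionE i j x : cdom i x -> transition i j (cmap i x) = cmap j x.
Proof. by move=> ix; rewrite /transition /= cmapK. Qed.

Lemma near_chart i (W : set N) x : cdom i x -> open W -> W x ->
  \forall z \near cmap i x, W (cinv i z) /\ cdom i (cinv i z) /\ cmap i (cinv i z) = z.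
Proof.
move=> ix oW Wx.
have : \forall z \near cmap i x, (cmap i @` (W `&` cdom i)) z.
  by apply: open_nbhs_nbhs; split; [exact: open_chart_image|exists x].
by apply: filterS => _ [y [Wy iy] <-]; rewrite cmapK.
Qed.

(** The chain rule for changes of charts; all the rules of transformation of components are
    instances of it, since tangent vectors are given by components in a preferred chart. *)
Lemma transition_derive i j k x v : cdom i x -> cdom j x -> cdom k x ->
  'D_('D_v (transition i j) (cmap i x)) (transition j k) (cmap j x) =
  'D_v (transition i k) (cmap i x).
Proof.
move=> ix jx kx; rewrite -(transitionE j ix).
have dij := transition_differentiable ix jx.
have djk : differentiable (transition j k) (transition i j (cmap i x)).
  by rewrite (transitionE j ix); exact: transition_differentiable jx kx.
rewrite -(derive_comp _ dij djk); apply: near_eq_derive.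
have := near_chart ix (open_cdom j) jx; apply: filterS => z [jz [iz e]].
by rewrite /transition /= cmapK.
Qed.

Lemma transition_derive_id i x v : cdom i x -> 'D_v (transition i i) (cmap i x) = v.
Proof.
move=> ix; rewrite -[RHS](derive_id (cmap i x) v); apply: near_eq_derive.
by have := near_chart ix (open_cdom i) ix; apply: filterS => z [_ [_ e]].
Qed.

Lemma componentsE i x (v : tangent x) : cdom i x ->
  components i v = 'D_v (transition (chart_at x) i) (cmap (chart_at x) x).
Proof.
move=> ix; rewrite deriveE//; apply: transition_differentiable => //.
exact: chart_atP.
Qed.

Lemma coord_fieldE i a x : cdom i x ->
  coord_field i a x = 'D_(delta_mx 0 a) (transition i (chart_at x)) (cmap i x).
Proof.
move=> ix; rewrite deriveE//; apply: transition_differentiable => //.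
exact: chart_atP.
Qed.

Lemma componentsK i x (v : tangent x) : cdom i x ->
  'D_(components i v) (transition i (chart_at x)) (cmap i x) = v.
Proof.
move=> ix; have cx := chart_atP x; rewrite componentsE// transition_derive//.
exact: transition_derive_id.
Qed.

Lemma components_inj i x (v w : tangent x) : cdom i x ->
  components i v = components i w -> v = w.
Proof. by move=> ix vw; rewrite -(componentsK v ix) vw componentsK. Qed.

Lemma components_sum i x (v : tangent x) : cdom i x ->
  v = \sum_a components i v ord0 a *: coord_field i a x.
Proof.
move=> ix; rewrite -{1}(componentsK v ix) derive_partials.
  by apply: eq_bigr => a _; rewrite coord_fieldE.
by apply: transition_differentiable => //; exact: chart_atP.
Qed.

Lemma components_transition i j x (v : tangent x) : cdom i x -> cdom j x ->
  components j v = 'D_(components i v) (transition i j) (cmap i x).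
Proof.
move=> ix jx; rewrite (componentsE v ix) (componentsE v jx).
exact/esym/(transition_derive _ (chart_atP x) ix jx).
Qed.

Lemma coord_field_smooth i a : smooth_field (cdom i) (coord_field i a).
Proof.
move=> j; set P := cmap j @` _.
have oP : open P by apply: open_chart_image; exact: open_cdom.
have PQ z : P z -> (cmap i @` (cdom i `&` cdom j)) (transition j i z).
  by move=> [x [ix jx] <-]; rewrite transitionE//; exists x.
have s1 : smooth_on P (transition j i) by rewrite /P setIC; exact: transition_smooth.
have s2 : smooth_on (cmap i @` (cdom i `&` cdom j)) (pderive a (transition i j)).
  by apply: pderive_smooth; exact: transition_smooth.
have := smooth_on_comp (f := transition j i) (g := pderive a (transition i j)) oP
  (@open_overlap i j) PQ s1 s2.
apply: smooth_on_ext => // _ [x [ix jx] <-].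
rewrite /= (transitionE i jx) (cmapK jx) (componentsE _ jx) (coord_fieldE _ ix).
exact/esym/(transition_derive _ ix (chart_atP x) jx).
Qed.

(** [coord_field_smooth] is the smoothness required by [cov_linear]. *)
Lemma cov0 (D : connection N) i a x : cdom i x -> D x 0 (coord_field i a) = 0.
Proof.
move=> ix; have := @cov_linear _ _ _ D (cdom i) x (coord_field i a) 1 0 0 (open_cdom i) ix
  (coord_field_smooth i a).
rewrite scale1r addr0 scale1r => /eqP; rewrite -{1}[D x 0 _]addr0 (inj_eq (addrI _)).
by move=> /eqP <-.
Qed.

End Charts.

Section Localization.
Context {R : realType} {N : manifold R 3}.
Variables (U : set 'rV[R]_2) (f : 'rV[R]_2 -> N) (i : chart N).
Hypotheses (oU : open U) (sf : smooth_map (M := euclidean R 2) U f).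
Implicit Types (q w : 'rV[R]_2) (j : chart N).

Definition in_chart j : set 'rV[R]_2 := U `&` f @^-1` cdom j.

Lemma map_continuous q : U q -> {for q, continuous f}.
Proof. by case: sf => cf _; exact: cf. Qed.

Lemma open_in_chart j : open (in_chart j).
Proof.
rewrite openE => q [Uq jq]; apply: filterI; first exact: open_nbhs_nbhs.
apply: (map_continuous Uq); apply: open_nbhs_nbhs; split=> //; exact: open_cdom.
Qed.

Lemma map_smooth j : smooth_on (in_chart j) (cmap j \o f).
Proof.
case: sf => _ /(_ tt j); apply: smooth_on_subset => q [Uq jq].
by exists q.
Qed.

Lemma map_differentiable j q : in_chart j q -> differentiable (cmap j \o f) q.
Proof. exact: (smooth_on_differentiable (@map_smooth j)). Qed.

Lemma near_in_chart j q : in_chart j q -> \forall q' \near q, in_chart j q'.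
Proof. by move=> jq; apply: open_nbhs_nbhs; split=> //; exact: open_in_chart. Qed.

Lemma map_transition j k q w : in_chart j q -> in_chart k q ->
  'D_w (cmap k \o f) q = 'D_('D_w (cmap j \o f) q) (transition j k) (cmap j (f q)).
Proof.
move=> jq kq; have [_ jfq] := jq; have [_ kfq] := kq.
rewrite -(derive_comp _ (map_differentiable jq) (transition_differentiable jfq kfq)).
apply: near_eq_derive; apply: filterS (near_in_chart jq) => q' [_ jq'].
by rewrite /transition /= cmapK.
Qed.

Lemma components_tangent_map j q w : in_chart j q ->
  components j (tangent_map f q w) = 'D_w (cmap j \o f) q.
Proof.
move=> jq; have [Uq jfq] := jq.
have cq : in_chart (chart_at (f q)) q by split=> //; exact: chart_atP.
by rewrite (map_transition w cq jq) componentsE// /tangent_map -(deriveE _ (map_differentiable cq)).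
Qed.

Variables (L : forall q, cotangent (f q)) (X : forall q, tangent (f q)).
Hypotheses (sL : smooth_coalong U L) (sX : smooth_along U X).

Definition lift_coords q : 'rV[R]_3 := \row_a L q (coord_field i a (f q)).
Definition field_coords (Y : forall q, tangent (f q)) q : 'rV[R]_3 := components i (Y q).

Lemma lift_pairing q (v : tangent (f q)) : in_chart i q ->
  L q v = dot (lift_coords q) (components i v).
Proof.
move=> [_ iq]; rewrite {1}(components_sum v iq) linear_sum.
by apply: eq_bigr => a _; rewrite linearZ mxE mulrC.
Qed.

Lemma lift_coords_smooth : smooth_on (in_chart i) lift_coords.
Proof.
apply/smooth_on_coordinates; first exact: open_in_chart.
by move=> a; apply: smooth_on_ext (@open_in_chart i) _ (sL i a) => q _; rewrite mxE.
Qed.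

Lemma field_coords_smooth : smooth_on (in_chart i) (field_coords X).
Proof. exact: sX. Qed.

(** Along a null direction the Christoffel terms drop out. So does the choice of the chart in
    which [X] is differentiated: the matrix of the change of components is a function of
    [f q], whose derivative in that direction is 0. *)
Lemma lift_pullback_cov (D : connection N) q w : in_chart i q -> tangent_map f q w = 0 ->
  L q (pullback_cov D X q w) = dot (lift_coords q) ('D_w (field_coords X) q).
Proof.
move=> iq fw0; have [Uq ifq] := iq; set c := chart_at (f q).
have cfq : cdom c (f q) by exact: chart_atP.
have cq : in_chart c q by [].
have e1 : pullback_cov D X q w = 'd (fun q' => components c (X q')) q w.
  rewrite /pullback_cov fw0 -/c [RHS]row_sum_delta; apply: eq_bigr => a _.
  rewrite cov0// scaler0 addr0; congr (_ *: _).
  by rewrite coord_fieldE// transition_derive_id.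
have dXi : differentiable (field_coords X) q := smooth_on_differentiable field_coords_smooth iq.
have dXc : differentiable (fun q' => components c (X q')) q := smooth_on_differentiable (sX c) cq.
have F0 : 'D_w (cmap i \o f) q = 0.
  by rewrite -components_tangent_map// fw0 componentsE// derive0.
have dtr a : differentiable (pderive a (transition i c)) (cmap i (f q)).
  apply: smooth_on_differentiable (mem_overlap ifq cfq).
  by apply: pderive_smooth; exact: transition_smooth.
have e2 : 'd (fun q' => components c (X q')) q w =
    \sum_a 'D_w (field_coords X) q ord0 a *: pderive a (transition i c) (cmap i (f q)).
  pose S q' : 'rV[R]_3 := \sum_a field_coords X q' ord0 a *:
      pderive a (transition i c) (cmap i (f q')).
  have SX : \forall q' \near q, components c (X q') = S q'.
    near=> q'.
    have [_ iq'] : in_chart i q' by near: q'; exact: near_in_chart.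
    have [_ cq'] : in_chart c q' by near: q'; exact: near_in_chart.
    rewrite (components_transition (X q') iq' cq') derive_partials//.
    exact: transition_differentiable.
  have dS : differentiable S q := differentiable_near_eq SX dXc.
  transitivity ('D_w S q).
    by rewrite -(near_eq_derive _ SX) (deriveE _ dXc).
  pose row_j (j : 'I_3) y : 'rV[R]_3 := \row_a pderive a (transition i c) y ord0 j.
  have drow (j : 'I_3) : differentiable (row_j j) (cmap i (f q)).
    apply/differentiable_coordinates => a; under eq_fun do rewrite mxE.
    by have /differentiable_coordinates := dtr a; exact.
  have dF := map_differentiable iq.
  have drowF (j : 'I_3) : differentiable (row_j j \o (cmap i \o f)) q by exact: differentiable_comp.
  apply/rowP => j.
  have SE : (fun q' => S q' ord0 j) =
      (fun q' => dot (field_coords X q') ((row_j j \o (cmap i \o f)) q')).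
    by apply/funext => y; rewrite /S summxE; apply: eq_bigr => a _; rewrite !mxE.
  rewrite -(derive_coordinates _ _ dS) SE.
  rewrite (derive_dot _ dXi (drowF j)) (derive_comp _ dF (drow j)) F0 derive0 dot0r addr0.
  by rewrite summxE; apply: eq_bigr => a _; rewrite !mxE.
rewrite e1 e2.
have dt := transition_differentiable ifq cfq.
transitivity (L q ('D_('D_w (field_coords X) q) (transition i c) (cmap i (f q)))).
  by rewrite [X in _ = L q X](derive_partials _ dt).
rewrite lift_pairing// componentsE//; congr (dot _ _).
by rewrite transition_derive// transition_derive_id.
Unshelve. all: by end_near. Qed.

End Localization.

Section ChartCriterion.
Context {R : realType} {N : manifold R 3}.
Variables (U : set 'rV[R]_2) (f : 'rV[R]_2 -> N) (i : chart N).
Variables (L : forall q, cotangent (f q)) (X : forall q, tangent (f q)).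
Variables (eps : R) (gamma eta : R -> 'rV[R]_2).
Hypotheses (oU : open U) (sf : smooth_map (M := euclidean R 2) U f).

Lemma chart_frontal_data : U (gamma 0) -> cdom i (f (gamma 0)) -> admissible_lift U L ->
  smooth_along U X -> (forall q, U q -> L q (X q) = 0) ->
  ~ (exists w, X (gamma 0) = tangent_map f (gamma 0) w) ->
  0 < eps -> singular_curve U f eps gamma -> null_field f eps gamma eta ->
  frontal_data (in_chart U f i) (cmap i \o f) (lift_coords i L) (field_coords i X) eps gamma eta.
Proof.
move=> Up ip [sL L0 Lf] sX LX nX eps0 [sg g0 _ _] [seta eta0].
have I0 : (0 : R) \in `]- eps, eps[ by rewrite in_itv /= oppr_lt0 !eps0.
split=> //.
- exact: open_in_chart.
- exact: map_smooth.
- exact: lift_coords_smooth.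
- exact: field_coords_smooth.
- move=> q iq; have [Uq _] := iq; have [v] := L0 q Uq; apply: contra_neq => l0.
  by rewrite (lift_pairing L v iq) l0 /dot big1// => a _; rewrite mxE mul0r.
- move=> q w iq; have [Uq _] := iq.
  by rewrite -(components_tangent_map oU sf w iq) -(lift_pairing L _ iq) Lf.
- by move=> q iq; have [Uq _] := iq; rewrite -(lift_pairing L _ iq) LX.
- exact: g0.
- by move=> t /eta0[].
- move=> t It iq; rewrite -(components_tangent_map oU sf _ iq).
  have [_ /(_ (eta t)) [_ ->]] := eta0 t It; last by exists 1; rewrite scale1r.
  by have [_ ifq] := iq; rewrite componentsE// derive0.
- move=> [w Xw]; apply: nX; exists w; apply: (components_inj ip).
  by rewrite (components_tangent_map oU sf w (conj Up ip)).
Qed.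

Variables (g : riemannian_metric N) (nu : forall q, tangent (f q)).

Definition gram q : R := Num.sqrt (\det (\matrix_(a < 3, b < 3)
  g (f q) (coord_field i a (f q)) (coord_field i b (f q)))).

Lemma gram_continuous q : in_chart U f i q -> {for q, continuous gram}.
Proof.
move=> iq; pose G (a b : 'I_3) q := g (f q) (coord_field i a (f q)) (coord_field i b (f q)) : R.
have oi : open (in_chart U f i) by exact: open_in_chart.
have sG a b : smooth_on (in_chart U f i) (G a b).
  have := metric_smooth g i a b i; rewrite setIid => s.
  have UI q' : in_chart U f i q' -> (cmap i @` cdom i) (cmap i (f q')).
    by move=> [_ iq']; exists (f q').
  have := smooth_on_comp_real (f := cmap i \o f) oi UI (@map_smooth _ _ _ _ sf i) s.
  apply: (@smooth_on_ext _ _ _ (in_chart U f i)); first exact: oi.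
  by move=> q' [_ iq'] /=; rewrite cmapK.
have sdet : smooth_on (in_chart U f i) (fun q => \det (\matrix_(a < 3, b < 3) G a b q)).
  by apply: smooth_on_det => // a b; apply: smooth_on_ext (sG a b) => // z _; rewrite mxE.
have cdet := smooth_on_continuous sdet iq.
by apply: (continuous_comp cdet); exact: sqrt_continuous.
Qed.

Lemma area_densityE q : in_chart U f i q -> area_density g nu i q =
  gram q * triple (pderive 0 (cmap i \o f) q) (pderive 1 (cmap i \o f) q) (field_coords i nu q).
Proof.
move=> iq; rewrite /area_density /volume_form; congr (_ * \det _).
apply/matrixP => a b; rewrite !mxE.
by move: a; apply: ord3_ind => //=; rewrite (components_tangent_map oU sf _ iq).
Qed.

End ChartCriterion.

Section Equivalence.
Context {R : realType} {N : manifold R 3}.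
Variables (U : set 'rV[R]_2) (f : 'rV[R]_2 -> N) (i : chart N) (p : 'rV[R]_2).
Hypotheses (oU : open U) (sf : smooth_map (M := euclidean R 2) U f) (ip : in_chart U f i p).

Lemma local_diffeo_euclidean m (F G : 'rV[R]_m -> 'rV[R]_m) x y :
  local_diffeo (M := euclidean R m) (N := euclidean R m) F G x y <-> local_inverse F G x y.
Proof.
split=> [[A [B [[oA oB] Ax [[_ sF] [_ sG]] AB BA]]]|[A [B [[oA oB] Ax [sF sG] AB BA]]]].
  exists A, B; split=> //; split.
    by have := sF tt tt; apply: smooth_on_subset => z Az; exists z.
  by have := sG tt tt; apply: smooth_on_subset => z Bz; exists z.
exists A, B; split=> //; split; split.
- by move=> z Az; exact: (smooth_on_continuous sF Az).
- by move=> [] []; apply: smooth_on_subset sF => _ [z [[Az _] _] <-].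
- by move=> z Bz; exact: (smooth_on_continuous sG Bz).
- by move=> [] []; apply: smooth_on_subset sG => _ [z [[Bz _] _] <-].
Qed.

(** Charts translate equivalences of germs into equivalences of the coordinate
    expression of [f], and conversely. *)
Lemma A_equivalent_chart : A_equivalent f p (@cuspidal_cross_cap R) 0 <->
  exists (phi theta : 'rV[R]_2 -> 'rV[R]_2) (W V : 'rV[R]_3 -> 'rV[R]_3),
    [/\ local_inverse phi theta p 0, local_inverse W V 0 (cmap i (f p)) &
      \forall z \near (0 : 'rV[R]_2), cmap i (f (theta z)) = W (cross_cap z)].
Proof.
have ifp : cdom i (f p) by case: ip.
have Up : U p by case: ip.
have cc0 : cross_cap 0 = 0 :> 'rV[R]_3.
  by apply/rowP; apply: ord3_ind; rewrite !mxE /= ?mxE ?expr0n ?mul0r.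
split.
  move=> [phi [theta [Phi [Psi [lphi lPhi eqf]]]]].
  move: lphi => /local_diffeo_euclidean lphi.
  have [A [B [[oA oB] [Ap phip] [sp st] AB BA]]] := lphi.
  have t0 : B 0 /\ theta 0 = p by have := AB _ Ap; rewrite phip.
  move: lPhi => [A' [B' [[oA' oB'] [A'p Phip] [sPhi sPsi] AB' BA']]].
  rewrite cross_capE cc0 in Phip.
  have Psi0 : Psi 0 = f p by have [_] := AB' _ A'p; rewrite Phip.
  have B'0 : B' 0 by have [+ _] := AB' _ A'p; rewrite Phip.
  pose A1 : set 'rV[R]_3 := B' `&` Psi @^-1` cdom i.
  pose B1 : set 'rV[R]_3 := cmap i @` (A' `&` cdom i).
  have sW : smooth_on A1 (cmap i \o Psi).
    have [_ /(_ tt i)] := sPsi; apply: smooth_on_subset => z [Bz iz].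
    by exists z.
  have sV : smooth_on B1 (Phi \o cinv i).
    have [_ /(_ i tt)] := sPhi; apply: smooth_on_subset => _ [x [A'x ix] <-].
    by exists x.
  exists phi, theta, (cmap i \o Psi), (Phi \o cinv i); split=> //.
    exists A1, B1; split.
    - split; last exact: open_chart_image.
      rewrite openE => z [Bz iz]; apply: filterI; first exact: open_nbhs_nbhs.
      have [cPsi _] := sPsi; apply: (cPsi z Bz); apply: open_nbhs_nbhs; split=> //.
      exact: open_cdom.
    - by split; [split=> //; rewrite /preimage /= Psi0|rewrite /= Psi0].
    - by split.
    - move=> z [Bz iz]; have [A'z Phiz] := BA' z Bz; split; first by exists (Psi z).
      by rewrite /= cmapK.
    - move=> _ [x [A'x ix] <-]; have [B'x Psix] := AB' x A'x.
      by rewrite /= cmapK//; split; [split=> //; rewrite /preimage /= Psix|rewrite /= Psix].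
  have nA : \forall z \near (0 : 'rV[R]_2), A' (f (theta z)).
    have ct : {for 0, continuous theta} by apply: smooth_on_continuous st _; case: t0.
    have cf : {for theta 0, continuous f} by rewrite t0.2; exact: map_continuous sf _ Up.
    have := continuous_comp ct cf; apply.
    by apply: open_nbhs_nbhs; rewrite /= t0.2.
  near=> z; rewrite /= -cross_capE.
  have -> : cuspidal_cross_cap z = Phi (f (theta z)) by near: z.
  have A'z : A' (f (theta z)) by near: z.
  by have [_ ->] := AB' _ A'z.
move=> [phi [theta [W [V [lphi lW FW]]]]].
have [A [B [[oA oB] [A0 W0] [sW sV] AB BA]]] := lW.
exists phi, theta, (V \o cmap i), (cinv i \o W); split.
- exact/local_diffeo_euclidean.
- rewrite cross_capE cc0.
  pose A1 : set N := cdom i `&` cmap i @^-1` B.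
  pose B1 : set 'rV[R]_3 := A `&` W @^-1` (cmap i @` cdom i).
  have oA1 : open A1.
    rewrite openE => x [ix Bx]; apply: filterI; first by apply: open_nbhs_nbhs; split=> //; exact: open_cdom.
    by apply: (cmap_continuous ix); exact: open_nbhs_nbhs.
  have oB1 : open B1.
    apply: open_preimage_on => //; last exact: open_cimg.
    by move=> z Az; exact: smooth_on_continuous sW Az.
  have V0 : V (cmap i (f p)) = 0 by have [_] := AB _ A0; rewrite W0.
  have BF : B (cmap i (f p)) by have [] := AB _ A0; rewrite W0.
  have cPhi x : A1 x -> {for x, continuous (V \o cmap i)}.
    move=> [ix Bx]; apply: continuous_comp; first exact: cmap_continuous.
    exact: (smooth_on_continuous sV Bx).
  have cPsi y : B1 y -> {for y, continuous (cinv i \o W)}.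
    move=> [Ay iWy]; apply: continuous_comp; first exact: (smooth_on_continuous sW Ay).
    exact: cinv_continuous.
  exists A1, B1; split.
  + by [].
  + by [].
  + split; split=> //.
      move=> j [].
      have s : smooth_on (cmap j @` (A1 `&` cdom j)) (V \o transition j i).
        have o : open (cmap j @` (A1 `&` cdom j)) by exact: open_chart_image.
        apply: (smooth_on_comp (f := transition j i) (g := V) o oB _ _ sV).
          by move=> _ [x [[ix Bx] jx] <-]; rewrite transitionE.
        apply: smooth_on_subset (@transition_smooth _ _ N j i).
        by move=> _ [x [[ix Bx] jx] <-]; exists x.
      apply: smooth_on_subset s => _ [x [[A1x jx] _] <-]; by exists x.
    move=> [] j.
    have s : smooth_on (B1 `&` (cinv i \o W) @^-1` cdom j) (transition i j \o W).
      have o : open (B1 `&` (cinv i \o W) @^-1` cdom j).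
        rewrite openE => y [B1y jy]; apply: filterI; first exact: open_nbhs_nbhs.
        by apply: (cPsi y B1y); apply: open_nbhs_nbhs; split=> //; exact: open_cdom.
      apply: (smooth_on_comp (f := W) (g := transition i j) o (@open_overlap _ _ N i j)).
      - move=> y [[Ay [x ix xW]] jy]; exists x => //; split=> //.
        by move: jy; rewrite /preimage /= -xW cmapK.
      - by apply: smooth_on_subset sW => y [[]].
      - exact: transition_smooth.
    by apply: smooth_on_subset s => _ [y [[B1y _] jy] <-].
  + move=> x [ix Bx]; have [AV WV] := BA _ Bx; rewrite /= WV cmapK//; split=> //.
    by split=> //; rewrite /preimage /= WV; exists x.
  + move=> y [Ay [x ix xW]]; have [BW VW] := AB _ Ay.
    by rewrite /= -xW cmapK// xW; split=> //; split=> //; rewrite /preimage /= xW.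
have nA : \forall z \near (0 : 'rV[R]_2), A (cross_cap z).
  have s1 : smooth_on (ball (0 : 'rV[R]_2) 1) (fun z : 'rV[R]_2 => z ord0 0).
    exact: smooth_on_coord.
  apply: (near_preimage _ oA); last by rewrite cc0.
  by apply: (smooth_on_continuous (normal_map_smooth (lexx 1) s1)); exact: ballxx.
near=> z; rewrite cross_capE /=.
have -> : cmap i (f (theta z)) = W (cross_cap z) by near: z.
by have [] // := AB (cross_cap z) _; near: z.
Unshelve. all: by end_near. Qed.

End Equivalence.

Theorem theorem1p4 (R : realType) (U : set 'rV[R]_2) (N : manifold R 3)
    (f : 'rV[R]_2 -> N) (L : forall q, cotangent (f q)) (D : connection N)
    (eps : R) (gamma : R -> 'rV[R]_2) (X : forall q, tangent (f q))
    (eta : R -> 'rV[R]_2) :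
  open U -> connected U ->
  frontal U f ->
  admissible_lift U L ->
  0 < eps ->
  nondegenerate_point U f (gamma 0) ->
  singular_curve U f eps gamma ->
  smooth_along U X ->
  (forall q, U q -> L q (X q) = 0) ->
  ~ (exists w, X (gamma 0) = tangent_map f (gamma 0) w) ->
  null_field f eps gamma eta ->
  let psi := fun t : R => L (gamma t) (pullback_cov D X (gamma t) (eta t)) in
  A_equivalent f (gamma 0) (@cuspidal_cross_cap R) 0 <->
  row_free (col_mx (eta 0) (derive1 gamma 0)) /\ (psi 0 = 0 /\ derive1 psi 0 != 0).
Proof.
move=> oU _ [sf _] aL eps0 [[Up _] [g [nu [i [[snu _ _] ip [w nd]]]]]] sg sX LX nX neta psi.
have iq : in_chart U f i (gamma 0) by [].
have fd := chart_frontal_data oU sf Up ip aL sX LX nX eps0 sg neta.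
have cN : {for gamma 0, continuous (field_coords i nu)}.
  by apply: smooth_on_continuous iq; exact: (field_coords_smooth i snu).
have areaE : \forall q \near gamma 0, area_density g nu i q = gram f i g q *
    triple (pderive 0 (cmap i \o f) q) (pderive 1 (cmap i \o f) q) (field_coords i nu q).
  by apply: filterS (near_in_chart oU sf iq) => q; exact: area_densityE.
have psiE : \forall t \near 0, psi t =
    dot (lift_coords i L (gamma t)) ('D_(eta t) (field_coords i X) (gamma t)).
  have [seta eta0] := neta; have [sgm _ _ _] := sg.
  have I0 : (0 : R) \in `]- eps, eps[ by rewrite in_itv /= oppr_lt0 !eps0.
  have cg : {for 0, continuous gamma} := smooth_on_continuous sgm I0.
  have nI : \forall t \near 0, t \in `]- eps, eps[ by exact: near_in_itvoo.
  have ni : \forall t \near 0, in_chart U f i (gamma t).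
    by apply: (near_preimage cg _ iq); exact: open_in_chart.
  near=> t; have It : t \in `]- eps, eps[ by near: t.
  have it : in_chart U f i (gamma t) by near: t.
  have [_ /(_ (eta t))[_ eta1]] := eta0 t It.
  by apply: (lift_pullback_cov oU sf L sX D it); apply: eta1; exists 1; rewrite scale1r.
have gc := gram_continuous (g := g) oU sf iq.
apply: (iff_trans (A_equivalent_chart sf iq)).
exact: (cross_cap_criterion fd cN gc areaE nd psiE).
Unshelve. all: by end_near. Qed.
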